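(* Let $\mu$ be a partition of the integer $k$ with $\ell(\mu)$ parts, and let $(S_1,S_2)$ be a fixed couple of pair-partitions of $[2k]$ of type $\mu$. Then, as functions on the set of all Young diagrams (of any size), $$\Sigma^{(2)}_\mu=\frac{1}{2^{\ell(\mu)}}\sum_{S_0}(-1)^{\mathcal{L}(S_0,S_1)}\,2^{|\mathcal{L}(S_0,S_1)|}\,N^{(1)}_{S_0,S_1,S_2},$$ where the sum runs over all pair-partitions $S_0$ of $[2k]$.
   Context: A pair-partition of $[2k]$ is a set of pairwise disjoint two-element subsets with union $[2k]$, identified with the fixed-point-free involution sending each element to its partner. For pair-partitions $A,B$ of $[2k]$, $\mathcal{L}(A,B)$ is the bipartite graph with a black vertex for each pair of $A$, a white vertex for each pair of $B$, and for each $i\in[2k]$ an edge joining the pair of $A$ containing $i$ to the pair of $B$ containing $i$; it is a disjoint union of loops (viewed also as subsets of $[2k]$ via edge labels) of lengths $2\ell_1\ge2\ell_2\ge\cdots$; $(\ell_1,\ell_2,\dots)$ is the type of $(A,B)$, $|\mathcal{L}(A,B)|$ the number of loops, and $(-1)^{\mathcal{L}(A,B)}=(-1)^{k-|\mathcal{L}(A,B)|}$. For a Young diagram $\lambda$, $N^{(1)}_{S_0,S_1,S_2}(\lambda)$ is the number of functions $f$ from $[2k]$ to the boxes of $\lambda$ such that for every $l\in[2k]$: $f(l)=f(S_0(l))$; $f(l)$ and $f(S_1(l))$ are in the same column; $f(l)$ and $f(S_2(l))$ are in the same row. Zonal characters: write the Jack polynomial (Macdonald's $J$-normalization; for $\alpha=2$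 it is the zonal polynomial $Z_\lambda$) as $J^{(\alpha)}_\lambda=\sum_{|\rho|=|\lambda|}\theta^{(\alpha)}_\rho(\lambda)p_\rho$ in the power-sum basis. For $|\lambda|\ge|\mu|$ set $\Sigma^{(\alpha)}_\mu(\lambda)=\binom{|\lambda|-|\mu|+m_1(\mu)}{m_1(\mu)}\,z_\mu\,\theta^{(\alpha)}_{\mu\cup 1^{|\lambda|-|\mu|}}(\lambda)$, and $\Sigma^{(\alpha)}_\mu(\lambda)=0$ if $|\lambda|<|\mu|$; here $m_i(\mu)$ is the multiplicity of $i$ in $\mu$ and $z_\mu=\prod_i i^{m_i(\mu)}m_i(\mu)!$. *)

(* Defs.v *)
From HB Require Import structures.
From mathcomp Require Import all_boot all_order all_algebra all_fingroup.
From mathcomp.multinomials Require Import mpoly.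

Set Implicit Arguments.
Unset Strict Implicit.
Unset Printing Implicit Defensive.

Import GRing.Theory.
Local Open Scope ring_scope.

Definition is_part (l : seq nat) : bool :=
  sorted geq l && all (fun x => 0 < x)%N l.

Definition parts_of (n : nat) : seq (seq nat) :=
  undup [seq filter (fun a => 0 < a)%N [seq val i | i <- val t]
        | t <- enum {: n.-tuple 'I_n.+1}
        & sorted geq [seq val i | i <- val t] &&
          (sumn [seq val i | i <- val t] == n)].

Definition mult (i : nat) (mu : seq nat) : nat := count_mem i mu.

Definition zee (mu : seq nat) : nat :=
  \prod_(i <- undup mu) (i ^ mult i mu * (mult i mu)`!)%N.

Definition conjpart_at (lam : seq nat) (j : nat) : nat :=
  count (fun a => j < a)%N lam.

Definition dominated (mu lam : seq nat) : bool :=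
  (sumn mu == sumn lam) &&
  all (fun i => sumn (take i mu) <= sumn (take i lam))%N
      (iota 0 (size mu + size lam).+1).

(* c_lambda(alpha) = prod_{s in lambda} (alpha a(s) + l(s) + 1),
   boxes s = (i,j) 0-indexed, a(s) = lambda_i - j - 1, l(s) = lambda'_j - i - 1. *)
Definition hookc (alpha : rat) (lam : seq nat) : rat :=
  \prod_(i < size lam) \prod_(j < nth 0%N lam i)
    (alpha * (nth 0%N lam i - j - 1)%N%:R
     + (conjpart_at lam j - i - 1)%N%:R + 1).

Definition psum (n r : nat) : {mpoly rat[n]} := \sum_(i < n) 'X_i ^+ r.

Definition ppow (n : nat) (rho : seq nat) : {mpoly rat[n]} :=
  \prod_(r <- rho) psum n r.

Definition msymm (n : nat) (mu : seq nat) : {mpoly rat[n]} :=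
  \sum_(e : {ffun 'I_n -> 'I_(sumn mu).+1} |
        sort geq (filter (fun a => 0 < a)%N [seq val (e i) | i <- enum 'I_n])
          == mu)
    \prod_(i < n) 'X_i ^+ e i.

(* ---------- Jack polynomials, J-normalization, in the power-sum basis -----
   J lam rho stands for theta^{(alpha)}_rho(lam), the coefficient of p_rho in
   J^{(alpha)}_lam.  The characterization is Macdonald's (VI.10):
   J_lam = c_lam(alpha) P_lam, where P_lam = m_lam + sum_{mu < lam} u m_mu
   (dominance) and the P_lam are pairwise orthogonal for the scalar product
   <p_rho, p_sigma>_alpha = delta z_rho alpha^{l(rho)}.  Degree-n symmetric
   functions are faithfully represented in n variables. *)
Definition jack_J_family (alpha : rat) (J : seq nat -> seq nat -> rat) : Prop :=
  forall n : nat,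
    (forall lam, lam \in parts_of n ->
       exists u : seq nat -> rat,
         \sum_(rho <- parts_of n) J lam rho *: ppow n rho =
         hookc alpha lam *:
           (msymm n lam +
            \sum_(mu <- parts_of n | dominated mu lam && (mu != lam))
                u mu *: msymm n mu))
    /\
    (forall lam mu, lam \in parts_of n -> mu \in parts_of n -> lam != mu ->
       \sum_(rho <- parts_of n)
          J lam rho * J mu rho * (zee rho)%:R * alpha ^+ size rho = 0).

Definition Sigma (J : seq nat -> seq nat -> rat) (mu lam : seq nat) : rat :=
  if (sumn mu <= sumn lam)%N then
    ('C(sumn lam - sumn mu + mult 1 mu, mult 1 mu))%:R * (zee mu)%:R *
    J lam (mu ++ nseq (sumn lam - sumn mu) 1%N)
  else 0.

(* pair-partition of [2k] = fixed-point-free involution *)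
Definition is_pp (m : nat) (S : {perm 'I_m}) : bool :=
  [forall x, (S (S x) == x) && (S x != x)].

(* two edge labels are adjacent in L(A,B) if they share a vertex *)
Definition loop_rel (m : nat) (A B : {perm 'I_m}) : rel 'I_m :=
  fun i j => (j == A i) || (j == B i).

(* loops of L(A,B), as subsets of [2k] (sets of edge labels) *)
Definition loops (m : nat) (A B : {perm 'I_m}) : {set {set 'I_m}} :=
  [set [set j | connect (loop_rel A B) i j] | i : 'I_m].

Definition nloops (m : nat) (A B : {perm 'I_m}) : nat := #|loops A B|.

(* type (l_1 >= l_2 >= ...), a loop of length 2 l having 2 l edges *)
Definition ltype (m : nat) (A B : {perm 'I_m}) : seq nat :=
  sort geq [seq (#|C| %/ 2)%N | C : {set 'I_m} <- enum (mem (loops A B))].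

Definition in_diag (lam : seq nat) (b : nat * nat) : bool :=
  (b.2 < nth 0%N lam b.1)%N.

Definition N1 (m : nat) (S0 S1 S2 : {perm 'I_m}) (lam : seq nat) : nat :=
  #|[set f : {ffun 'I_m -> 'I_(sumn lam) * 'I_(sumn lam)} |
     [forall l,
        in_diag lam (val (f l).1, val (f l).2) &&
        [&& f l == f (S0 l),
            (f l).2 == (f (S1 l)).2 &
            (f l).1 == (f (S2 l)).1]]]|.

(* Main.v *)
Require Import Defs.
From mathcomp Require Import all_boot all_order all_algebra all_fingroup.
From mathcomp.multinomials Require Import mpoly.
From mathcomp Require Import zify.

(** Let [X] be the set of the [2n] cells obtained by cutting each box of [lam] into two halves,
    and [flip] the pair-partition of [X] exchanging the two halves of each box.  Put
    [Y_lam = \sum_(A, B) (-1)^L(flip, A) p_type(A, B)], where [A] matches the left half of each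
    column with its right half and [B] preserves the rows.  Then [Y_lam = J_lam]:
    - conjugation by a transposition of two cells of a half-column changes the sign, so [Y_lam]
      only involves [m_nu] with [nu] dominated by [lam];
    - [z_rho 2^l(rho)] counts the automorphisms of a couple of type [rho], and the same sign
      argument gives orthogonality;
    - the coefficient of [m_lam] is the expectation of a product of squares of leading minors of
      a Gaussian matrix; Cayley's identity removes the minors one at a time, and each step
      contributes the hook factors of one column of [lam].
    Finally [2^L(S0, S1) N1] counts maps [f : [2k] -> X] carrying [S0] to [flip] and compatible
    with [S1] and [S2].  Non-injective maps cancel, and an injective one extends, by [flip]
    outside its image, to a couple [(A, B)] of type [mu] plus parts equal to 1; each such couple
    arises [2^l(mu) z_mu 'C(n - k + m_1(mu), m_1(mu))] times. *)

Set Implicit Arguments.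
Unset Strict Implicit.
Unset Printing Implicit Defensive.

Import GRing.Theory.
Local Open Scope ring_scope.

(** * Loops of a couple of pair-partitions *)

(** The sign [(-1)^L] is not multiplicative in its arguments. It becomes tractable once both
    pair-partitions exchange the classes of a two-colouring: their product then permutes one class,
    and the sign is the signature of this permutation. Hence the requirement that [A] match left
    halves with right halves; for a map [f] from [[2k]] to [X] the colour of [z] is the half
    containing [f z]. Triangularity and orthogonality fix [Y_lam] only up to a scalar, while
    Macdonald's normalization demands the exact coefficient of [m_lam]. The Gaussian matrix enters
    there: by Wick's theorem, the pairings that preserve the rows and a filling are counted by a
    moment of the monomial in variables indexed by row and value. The signed sum over the
    arrangements of each half-column assembles these monomials into one minor per half-column, hence
    a square per column. Integrating one minor by parts gives row [i] of its column the weight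
    [2 a + l + 1]: the row lies in the other copy of this minor and in two copies of each of the [a]
    later columns reaching it, and [l] rows of the column lie below it. *)

Section Pairings.
Variable T : finType.
Implicit Types (A B : {perm T}) (x y : T).

(* [pp], [gloops] and [gltype] are [is_pp], [loops] and [ltype] over an arbitrary
   finite type; over ['I_m] the two versions are convertible. *)
Definition pp A := [forall x, (A (A x) == x) && (A x != x)].

Lemma ppK A : pp A -> involutive A.
Proof. by move=> /forallP ppA x; case/andP: (ppA x) => /eqP. Qed.

Lemma pp_neq A x : pp A -> A x != x.
Proof. by move=> /forallP /(_ x) /andP[]. Qed.

Definition lrel A B : rel T := fun i j => (j == A i) || (j == B i).
Definition loop A B x : {set T} := [set y | connect (lrel A B) x y].
Definition gloops A B : {set {set T}} := [set loop A B x | x : T].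
Definition gltype A B :=
  sort geq [seq (#|C| %/ 2)%N | C : {set T} <- enum (mem (gloops A B))].

Section Two.
Variables A B : {perm T}.
Hypotheses (ppA : pp A) (ppB : pp B).
Let q := (A * B)%g.

Lemma lrel_sym x y : lrel A B x y = lrel A B y x.
Proof.
rewrite /lrel; congr (_ || _); apply/eqP/eqP => ->; by rewrite ppK.
Qed.

Lemma loop_csym : connect_sym (lrel A B).
Proof. by apply: sym_connect_sym => x y; exact: lrel_sym. Qed.

Lemma loop_refl x : x \in loop A B x.
Proof. by rewrite inE connect0. Qed.

Lemma loopA x y : (A y \in loop A B x) = (y \in loop A B x).
Proof.
rewrite !inE; apply/idP/idP => h; apply: (connect_trans h); apply: connect1.
  by rewrite /lrel ppK ?eqxx.
by rewrite /lrel eqxx.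
Qed.

Lemma loopB x y : (B y \in loop A B x) = (y \in loop A B x).
Proof.
rewrite !inE; apply/idP/idP => h; apply: (connect_trans h); apply: connect1.
  by rewrite /lrel (ppK ppB) ?eqxx ?orbT.
by rewrite /lrel eqxx orbT.
Qed.

Lemma loop_eq x y : (loop A B x == loop A B y) = (y \in loop A B x).
Proof.
apply/eqP/idP => [->|]; first exact: loop_refl.
rewrite inE => xy; apply/setP => z; rewrite !inE.
exact: (same_connect loop_csym xy).
Qed.

Lemma loop_memC x y : (y \in loop A B x) = (x \in loop A B y).
Proof. by rewrite -!loop_eq eq_sym. Qed.

Lemma loop_ind (P : pred T) x :
  (forall y, P y -> P (A y)) -> (forall y, P y -> P (B y)) ->
  P x -> forall y, y \in loop A B x -> P y.
Proof.
move=> PA PB Px y; rewrite inE => /connectP[p + ->] {y}.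
elim: p x Px => //= z p IHp x Px /andP[/orP[]/eqP-> pz]; apply: IHp => //.
  exact: PA. exact: PB.
Qed.

Lemma ABV x : q^-1%g x = A (B x).
Proof. by apply: (canLR (permK q)); rewrite permM !ppK. Qed.

(* In the dihedral group generated by [A] and [B] no rotation [q ^+ i] agrees with the
   reflection [A] at a point, as reflections have no fixed point; hence a loop is the
   disjoint union of an orbit of [q] and its image under [A]. *)
Lemma refl_notin i x : (q ^+ i)%g x != A x.
Proof.
elim/ltn_ind: i x => -[|[|i]] IHi x.
- by rewrite expg0 perm1 eq_sym pp_neq.
- by rewrite expg1 permM pp_neq.
have := IHi i _ (q x); rewrite ltnW // => /(_ isT); apply: contra_neq => e.
have -> : (q ^+ i)%g (q x) = q^-1%g ((q ^+ i.+2)%g x).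
  by rewrite -permM -expgS [in RHS]expgSr [in RHS]permM permK.
by rewrite e ABV permM.
Qed.

Lemma porbit_refl_notin x y : y \in porbit q x -> A y \notin porbit q x.
Proof.
rewrite -eq_porbit_mem => /eqP <-.
by apply/negP => /porbitP[i] /esym/eqP; apply/negP/refl_notin.
Qed.

Lemma porbitq x y : (q y \in porbit q x) = (y \in porbit q x).
Proof. by rewrite -!eq_porbit_mem -{2}(expg1 q) porbit_perm. Qed.

Lemma in_loop x y :
  (y \in loop A B x) = (y \in porbit q x) || (A y \in porbit q x).
Proof.
apply/idP/idP; last first.
  have sub z : z \in porbit q x -> z \in loop A B x.
    case/porbitP => i ->; elim: i => [|i IHi]; first by rewrite expg0 perm1 loop_refl.
    by rewrite expgSr permM permM loopB // loopA.
  by case/orP => /sub //; rewrite loopA.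
apply: (loop_ind (P := fun z => (z \in porbit q x) || (A z \in porbit q x))).
- by move=> z; rewrite (ppK ppA) orbC.
- move=> z; rewrite orbC => /orP[] h; apply/orP; [left|right].
    by rewrite -(ppK ppA z) -permM porbitq.
  by rewrite -porbitq permM (ppK ppA) (ppK ppB).
- by rewrite porbit_id.
Qed.

Lemma card_loop x : #|loop A B x| = #|porbit q x|.*2.
Proof.
have -> : loop A B x = porbit q x :|: A @: porbit q x.
  apply/setP => y; rewrite in_loop inE; congr (_ || _).
  by rewrite -{2}(ppK ppA y) mem_imset //; exact: perm_inj.
rewrite cardsU card_imset; last exact: perm_inj.
have -> : porbit q x :&: A @: porbit q x = set0.
  apply/setP => y; rewrite !inE; apply/negP => /andP[h /imsetP[z hz e]].
  by move: (porbit_refl_notin hz); rewrite -e h.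
by rewrite cards0 subn0 addnn.
Qed.

Lemma card_loop_half x : (#|loop A B x| %/ 2 = #|porbit q x|)%N.
Proof. by rewrite card_loop -muln2 mulnK. Qed.

Lemma mem_gloops x : loop A B x \in gloops A B.
Proof. exact: imset_f. Qed.

Lemma gloopsP C : reflect (exists x, C = loop A B x) (C \in gloops A B).
Proof. by apply: (iffP imsetP) => [[x _ ->]|[x ->]]; exists x. Qed.

Lemma mem_loop_eq C x : C \in gloops A B -> x \in C -> C = loop A B x.
Proof. by case/gloopsP => y -> xy; apply/eqP; rewrite loop_eq. Qed.

Lemma gloops_partition : partition (gloops A B) [set: T].
Proof.
apply/and3P; split.
- apply/eqP/setP => x; rewrite inE; apply/bigcupP.
  by exists (loop A B x); [exact: mem_gloops | exact: loop_refl].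
- apply/trivIsetP => C D hC hD; apply: contraNT => /pred0Pn[x /andP[/= xC xD]].
  by rewrite (mem_loop_eq hC xC) (mem_loop_eq hD xD).
- by apply/negP => /gloopsP[x] /setP/(_ x); rewrite loop_refl inE.
Qed.

(** A function invariant under [A] and [B] is a function on the set of loops; distributivity then
    gives one factor per loop. It serves to count colourings and to expand products of power
    sums. *)
Lemma sum_const_on_loops (R : comNzRingType) (V : finType) (w : T -> V -> R) :
  \sum_(c : {ffun T -> V} | [forall x, (c (A x) == c x) && (c (B x) == c x)])
     \prod_x w x (c x) =
  \prod_(C in gloops A B) \sum_v \prod_(x in C) w x v.
Proof.
rewrite [RHS]big_sub bigA_distr_bigA /=.
have exC (C : {C | C \in gloops A B}) : exists x, x \in val C.
  by case/gloopsP: (valP C) => x e; exists x; rewrite e loop_refl.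
pose l x : {C | C \in gloops A B} := Sub (loop A B x) (mem_gloops x).
rewrite (reindex_onto (fun g : {ffun {C | C \in gloops A B} -> V} => [ffun x => g (l x)])
  (fun c => [ffun C => c (xchoose (exC C))])).
  apply: eq_big => [g|g _].
    apply/andP; split.
      apply/forallP => x; rewrite !ffunE; apply/andP; split; apply/eqP; congr (g _);
      by apply/val_inj/eqP; rewrite /= loop_eq loop_memC ?loopA ?loopB loop_refl.
    apply/eqP/ffunP => C; rewrite !ffunE; congr (g _); apply/val_inj => /=.
    by rewrite -(mem_loop_eq (valP C) (xchooseP (exC C))).
  rewrite (eq_bigl (fun x => x \in [set: T])); last by move=> x; rewrite inE.
  rewrite (set_partition_big _ gloops_partition) /=.
  rewrite big_sub /=; apply: eq_bigr => C _; apply: eq_bigr => x xC.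
  rewrite ffunE; congr (w x (g _)); apply/val_inj => /=.
  by rewrite -(mem_loop_eq (valP C) xC).
move=> c /forallP hc; apply/ffunP => x; rewrite !ffunE.
have: xchoose (exC (l x)) \in loop A B x by exact: (xchooseP (exC (l x))).
have h : forall y, y \in loop A B x -> c y == c x.
  apply: loop_ind => [y|y|] //.
    by case/andP: (hc y) => /eqP ->.
  by case/andP: (hc y) => _ /eqP ->.
by move/h/eqP.
Qed.

End Two.
End Pairings.

(** * Two-colourings and signs *)

Section Colouring.
Variables (T : finType) (A B : {perm T}).
Hypotheses (ppA : pp A) (ppB : pp B).
Let q := (A * B)%g.

(** Each loop consists of two orbits of [q], exchanged by [A] and by [B]; the colour of a point
    tells whether it lies in the orbit of the root of its loop. *)
Lemma two_colouring_exists :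
  exists h : {ffun T -> bool}, forall x, h (A x) = ~~ h x /\ h (B x) = ~~ h x.
Proof.
pose r := fingraph.root (lrel A B).
have rE x y : y \in loop A B x -> r y = r x.
  by rewrite inE => xy; apply/esym/(fingraph.rootP (loop_csym ppA ppB)).
have rA x : r (A x) = r x by apply: rE; rewrite loopA // loop_refl.
have rB x : r (B x) = r x by apply: rE; rewrite loopB // loop_refl.
have colA x : (A x \in porbit q (r x)) = ~~ (x \in porbit q (r x)).
  apply/idP/idP => [h|].
    by apply/negP => /(porbit_refl_notin ppA ppB)/negP; apply.
  have : x \in loop A B (r x).
    by rewrite loop_memC // inE connect_root.
  by rewrite in_loop // => /orP[-> //|].
exists [ffun x => x \in porbit q (r x)] => x; rewrite !ffunE rA rB colA; split=> //.
by rewrite -colA -(porbitq A B _ (A x)) permM (ppK ppA).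
Qed.

Definition two_colourings : {set {ffun T -> bool}} :=
  [set h : {ffun T -> bool} | [forall x, (h (A x) == ~~ h x) && (h (B x) == ~~ h x)]].

(** Adding a fixed two-colouring modulo 2 turns alternating functions into functions constant on
    loops, with two values for each loop. *)
Lemma card_two_colourings : #|two_colourings|%:R = 2 ^+ #|gloops A B| :> rat.
Proof.
have [h0 hh0] := two_colouring_exists.
have := @sum_const_on_loops _ _ _ ppA ppB rat bool (fun _ _ => 1).
under [RHS]eq_bigr do rewrite big_bool /= !prodr_const !expr1n -[1 + 1]/2.
rewrite prodr_const => <-; rewrite -sumr_const.
pose t (h : {ffun T -> bool}) := [ffun x => h x (+) h0 x].
have tK : involutive t by move=> h; apply/ffunP => x; rewrite !ffunE addbK.
rewrite (reindex_inj (can_inj tK)) /=; apply: eq_big => [h|h _]; last by rewrite big1.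
rewrite inE; apply: eq_forallb => x; rewrite !ffunE; have [-> ->] := hh0 x.
by case: (h (A x)); case: (h (B x)); case: (h x); case: (h0 x).
Qed.

(* If [A] and [B] both exchange the two classes of [half], then [A * B] preserves each
   class, and on one class its orbits correspond to the loops: the sign of the loop graph
   is the signature of the restriction. *)
Section Sign.
Variables (half : T -> bool).
Hypotheses (hA : forall x, half (A x) = ~~ half x)
           (hB : forall x, half (B x) = ~~ half x).
Let S := [set x | ~~ half x].
Let p := restr_perm S q.

Lemma restr_mul_in x : ~~ half x -> p x = B (A x).
Proof.
move=> hx; rewrite /p restr_permE ?permM ?inE //=.
by apply/subsetP => y; rewrite !inE /= /aperm permM hB hA !negbK.
Qed.

Lemma restr_mul_out x : half x -> p x = x.
Proof. by move=> hx; apply: (out_perm (restr_perm_on S q)); rewrite inE hx. Qed.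

Lemma card_half_loops : #|S|.*2 = #|T|.
Proof.
have <- : (#|S| + #|~: S| = #|T|)%N by rewrite cardsC.
have -> : ~: S = A @: S.
  apply/setP => x; rewrite -{2}(ppK ppA x) mem_imset; last exact: perm_inj.
  by rewrite !inE hA.
by rewrite card_imset ?addnn //; exact: perm_inj.
Qed.

(** Points of the class [half] are fixed by [p], which accounts for [#|S|]; every loop meets [S] in
    exactly one orbit of [p]. *)
Lemma porbits_restr : #|porbits p| = (#|S| + #|gloops A B|)%N.
Proof.
have halfq i x : half ((q ^+ i)%g x) = half x.
  elim: i => [|i IHi]; first by rewrite expg0 perm1.
  by rewrite expgSr permM permM hB hA negbK.
have pin x : x \in S -> porbit p x = loop A B x :&: S.
  rewrite inE => hx.
  have e i : (p ^+ i)%g x = (q ^+ i)%g x.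
    elim: i => [|i IHi]; first by rewrite !expg0.
    by rewrite !expgSr !permM IHi restr_mul_in ?halfq.
  apply/setP => y; rewrite in_setI in_loop // inE.
  have -> : (y \in porbit p x) = (y \in porbit q x).
    by apply/porbitP/porbitP => -[i ->]; exists i.
  have hq z : z \in porbit q x -> ~~ half z by case/porbitP => i ->; rewrite halfq.
  apply/idP/idP => [h|]; first by rewrite h hq.
  by case/andP => /orP[//|/hq]; rewrite hA => /negP.
have pout x : half x -> porbit p x = [set x].
  move=> hx; apply/setP => y; rewrite inE; apply/porbitP/eqP => [[i ->]|->]; last first.
    by exists 0%N; rewrite expg0 perm1.
  by elim: i => [|i IHi]; rewrite ?expg0 ?perm1 // expgSr permM IHi restr_mul_out.
have -> : porbits p = set1 @: (~: S) :|: (fun C => C :&: S) @: gloops A B.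
  apply/setP => C; rewrite inE; apply/imsetP/orP => [[x _ ->]|].
    case: (boolP (half x)) => hx; [left|right].
      by rewrite pout //; apply: imset_f; rewrite !inE hx.
    by rewrite pin ?inE //; apply: imset_f; rewrite mem_gloops.
  case=> /imsetP[].
    by move=> x; rewrite !inE negbK => hx ->; exists x; rewrite ?pout.
  move=> D /gloopsP[x ->] ->.
  case: (boolP (half x)) => hx; last by exists x; rewrite ?pin ?inE.
  exists (A x) => //; rewrite pin ?inE ?hA ?hx //; congr (_ :&: _).
  by apply/eqP; rewrite loop_eq // loopA // loop_refl.
have hit C : C \in gloops A B -> exists2 x, x \in C & x \in S.
  case/gloopsP => x ->; case: (boolP (half x)) => hx.
    by exists (A x); rewrite ?loopA ?loop_refl // inE hA hx.
  by exists x; rewrite ?loop_refl ?inE.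
rewrite cardsU card_imset; last exact: set1_inj.
rewrite card_in_imset; last first.
  move=> C D hC hD e; have [x xC xS] := hit C hC.
  have : x \in D :&: S by rewrite -e inE xC.
  rewrite inE => /andP[xD _].
  by rewrite (mem_loop_eq ppA ppB hC xC) (mem_loop_eq ppA ppB hD xD).
have -> : set1 @: (~: S) :&: (fun C => C :&: S) @: gloops A B = set0.
  apply/setP => C; rewrite !inE; apply/negP => /andP[/imsetP[x xS ->]].
  case/imsetP => D hD e; have [y yD yS] := hit D hD.
  have : y \in [set x] by rewrite e inE yD.
  by rewrite inE => /eqP yx; move: xS; rewrite inE -yx yS.
rewrite cards0 subn0; congr (_ + _)%N.
by have := cardsC S; rewrite -card_half_loops; lia.
Qed.

Lemma nloops_le : (#|gloops A B|.*2 <= #|T|)%N.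
Proof.
have : (#|porbits p| <= #|T|)%N by apply: (leq_trans (leq_imset_card _ _)); exact: max_card.
by rewrite porbits_restr -card_half_loops; lia.
Qed.

Lemma loop_sign k : #|T| = (2 * k)%N ->
  (-1) ^+ (k - #|gloops A B|) = (-1) ^+ odd_perm (restr_perm S q) :> rat.
Proof.
move=> Tk; rewrite /odd_perm porbits_restr.
have le := nloops_le.
have := card_half_loops; rewrite Tk => Sk.
have {Sk}-> : #|S| = k by lia.
by rewrite -signr_odd oddB ?oddM ?oddD //; lia.
Qed.

End Sign.
End Colouring.

(** Both points lie in one class, so conjugation changes the permutation of the class [~~ half] by a
    single transposition: [tperm x y] after it, or [tperm (A x) (A y)] before it. All sign
    cancellations between pair-partitions rest on this. *)
Lemma loop_sign_flip (T : finType) (A B : {perm T}) (half : T -> bool) (x y : T) k :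
  pp A -> pp B -> #|T| = (2 * k)%N ->
  (forall z, half (A z) = ~~ half z) -> (forall z, half (B z) = ~~ half z) ->
  x != y -> half x = half y ->
  (-1) ^+ (k - #|gloops A (B ^ tperm x y)|) = - (-1) ^+ (k - #|gloops A B|) :> rat.
Proof.
move=> ppA ppB Tk hA hB nxy hxy.
set t := tperm x y.
have ht z : half (t z) = half z by rewrite /t; case: tpermP => // ->.
have BtE z : (B ^ t)%g z = t (B (t z)) by rewrite conjgE !permM tpermV.
have ppBt : pp (B ^ t).
  apply/forallP => z; rewrite !BtE tpermK (ppK ppB) tpermK eqxx /=.
  by rewrite -(inj_eq (perm_inj (s := t))) tpermK pp_neq.
have hBt z : half ((B ^ t)%g z) = ~~ half z by rewrite BtE ht hB ht.
rewrite (loop_sign ppA ppBt hA hBt Tk) (loop_sign ppA ppB hA hB Tk).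
suff -> : odd_perm (restr_perm [set z | ~~ half z] (A * B ^ t)) =
  ~~ odd_perm (restr_perm [set z | ~~ half z] (A * B)) by rewrite signrN.
set p' := restr_perm _ _; set p := restr_perm _ _.
case: (boolP (half x)) => hx.
  have -> : p' = (tperm (A x) (A y) * p)%g.
    apply/permP => z; rewrite permM; case: (boolP (half z)) => hz.
      rewrite tpermD ?restr_mul_out //.
        by apply: contraTneq hz => <-; rewrite hA hx.
      by apply: contraTneq hz => <-; rewrite hA -hxy hx.
    have hz' : ~~ half (tperm (A x) (A y) z).
      by case: tpermP => // _; rewrite hA -?hxy hx.
    rewrite !restr_mul_in // BtE.
    have -> : A (tperm (A x) (A y) z) = t (A z).
      by rewrite inj_tperm ?(ppK ppA) //; exact: perm_inj.
    have hb : ~~ half (B (t (A z))) by rewrite hB ht hA negbK.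
    by rewrite {1}/t tpermD //; apply: contraNneq hb => <-; rewrite -?hxy.
  by rewrite odd_mul_tperm (inj_eq perm_inj) nxy.
have -> : p' = (p * t)%g.
  apply/permP => z; rewrite permM; case: (boolP (half z)) => hz.
    by rewrite !restr_mul_out // /t tpermD //; apply: contraTneq hz => <-; rewrite -?hxy.
  rewrite !restr_mul_in // BtE; congr (t (B _)).
  have ha : half (A z) by rewrite hA hz.
  by rewrite /t tpermD //; apply: contraTneq ha => <-; rewrite -?hxy.
by rewrite odd_permM odd_tperm nxy addbT.
Qed.

(** * Counting embeddings of couples of pair-partitions *)

Lemma perm_iter_eq_mod (T : finType) (s : {perm T}) (x : T) i j :
  ((s ^+ i)%g x == (s ^+ j)%g x) = (i == j %[mod #|porbit s x|]).
Proof.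
set m := #|porbit s x|.
have m0 : (0 < m)%N by rewrite lt0n card_porbit_neq0.
have it n : (s ^+ n)%g x = (s ^+ (n %% m))%g x.
  rewrite {1}(divn_eq n m) addnC expgD permM mulnC expgM.
  have fix_m k : ((s ^+ m) ^+ k)%g ((s ^+ (n %% m))%g x) = (s ^+ (n %% m))%g x.
    elim: k => [|k IHk]; first by rewrite expg0 perm1.
    rewrite expgSr permM IHk -permM -expgD addnC expgD permM; congr (_ _).
    by rewrite permX iter_porbit.
  exact: fix_m.
rewrite it (it j) !permX -!(nth_traject s (n := m)) ?ltn_mod //.
by rewrite nth_uniq ?size_traject ?ltn_mod // uniq_traject_porbit.
Qed.

(** * Equivariant maps between loops of equal length *)

Section Transport.
Variables (T X : finType) (A B : {perm T}) (A' B' : {perm X}).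
Hypotheses (ppA : pp A) (ppB : pp B) (ppA' : pp A') (ppB' : pp B').
Let q := (A * B)%g.
Let q' := (A' * B')%g.

Definition equivariant_at (t : T -> X) z := (t (A z) == A' (t z)) && (t (B z) == B' (t z)).

(* The equivariant map from the loop of [x] to a loop of the same length sending [x] to [y]. *)
Definition transport x y z : X :=
  let idx z := index z (traject q x #|porbit q x|) in
  if z \in porbit q x then (q' ^+ idx z)%g y else A' ((q' ^+ idx (A z))%g y).

Lemma transportE x y i : #|loop A B x| = #|loop A' B' y| ->
  transport x y ((q ^+ i)%g x) = (q' ^+ i)%g y.
Proof.
rewrite !card_loop // => /double_inj e; rewrite /transport mem_porbit.
set j := index _ _.
have jlt : (j < #|porbit q x|)%N.
  by rewrite -[X in (_ < X)%N](size_traject q x) /j index_mem -porbit_traject mem_porbit.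
have : (q ^+ j)%g x == (q ^+ i)%g x.
  rewrite [X in X == _]permX -(nth_traject q jlt) nth_index //.
  by rewrite -porbit_traject mem_porbit.
(* The two orbits have the same length, so exponents equivalent for [x] are equivalent for [y]. *)
by rewrite perm_iter_eq_mod e -perm_iter_eq_mod => /eqP.
Qed.

Lemma transportAE x y i : #|loop A B x| = #|loop A' B' y| ->
  transport x y (A ((q ^+ i)%g x)) = A' ((q' ^+ i)%g y).
Proof.
move=> e; rewrite /transport (negbTE (porbit_refl_notin _ _ _)) ?mem_porbit //.
rewrite (ppK ppA); congr (A' _); rewrite -(transportE i e) /transport.
by rewrite mem_porbit.
Qed.

Lemma transport_base x y : #|loop A B x| = #|loop A' B' y| -> transport x y x = y.
Proof. by move=> /(transportE 0); rewrite !expg0 !perm1. Qed.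

Lemma transport_equivariant x y z : #|loop A B x| = #|loop A' B' y| ->
  z \in loop A B x -> equivariant_at (transport x y) z.
Proof.
move=> e; rewrite in_loop // => /orP[] /porbitP[i ei]; apply/andP.
  rewrite ei transportAE // transportE //; split=> //.
  have [j ej] : exists j, A (B z) = (q ^+ j)%g x.
    by apply/porbitP; rewrite -(porbitq A B) permM (ppK ppA) (ppK ppB) ei mem_porbit.
  rewrite -ei -(ppK ppA (B z)) ej transportAE //.
  have : (q ^+ j.+1)%g x == (q ^+ i)%g x.
    by rewrite expgSr permM -ej permM (ppK ppA) (ppK ppB) ei.
  rewrite perm_iter_eq_mod; move: (e); rewrite !card_loop // => /double_inj ->.
  rewrite -perm_iter_eq_mod => /eqP <-.
  by rewrite expgSr !permM (ppK ppB').
have -> : z = A ((q ^+ i)%g x) by rewrite -ei (ppK ppA).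
rewrite (ppK ppA) transportE // transportAE // (ppK ppA').
have -> : B (A ((q ^+ i)%g x)) = (q ^+ i.+1)%g x by rewrite expgSr !permM.
by rewrite transportE // expgSr !permM.
Qed.

Lemma transport_image x y : #|loop A B x| = #|loop A' B' y| ->
  transport x y @: loop A B x = loop A' B' y.
Proof.
move=> e; have eqv := transport_equivariant e.
have sub : {subset loop A' B' y <= transport x y @: loop A B x}.
  apply: loop_ind => [w /imsetP[z zx ->]|w /imsetP[z zx ->]|].
  - by have /andP[/eqP<- _] := eqv z zx; rewrite imset_f // loopA.
  - by have /andP[_ /eqP<-] := eqv z zx; rewrite imset_f // loopB.
  - by rewrite -{1}(transport_base e) imset_f // loop_refl.
apply/esym/eqP; rewrite eqEcard; apply/andP; split; first exact/subsetP.
by rewrite -e leq_imset_card.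
Qed.

Lemma transport_inj x y : #|loop A B x| = #|loop A' B' y| ->
  {in loop A B x &, injective (transport x y)}.
Proof. by move=> e; apply/imset_injP; rewrite transport_image // e. Qed.

Definition embeddings : {set {ffun T -> X}} :=
  [set f : {ffun T -> X} | injectiveb f && [forall z, equivariant_at f z]].

Lemma embeddingsP (f : {ffun T -> X}) :
  reflect [/\ injective f, forall z, f (A z) = A' (f z) & forall z, f (B z) = B' (f z)]
          (f \in embeddings).
Proof.
rewrite inE; apply: (iffP andP).
  by case=> /injectiveP fi /forallP h; split=> // z; case/andP: (h z) => /eqP ? /eqP.
case=> fi fA fB; split; first exact/injectiveP.
by apply/forallP => z; rewrite /equivariant_at fA fB !eqxx.
Qed.

Lemma embedding_loop (f : {ffun T -> X}) x :
  f \in embeddings -> loop A' B' (f x) = f @: loop A B x.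
Proof.
case/embeddingsP => _ fA fB; apply/setP => w; apply/idP/idP.
  apply: loop_ind => {w} [w /imsetP[z zx ->]|w /imsetP[z zx ->]|].
  - by rewrite -fA; apply: imset_f; rewrite loopA.
  - by rewrite -fB; apply: imset_f; rewrite loopB.
  - by apply: imset_f; rewrite loop_refl.
case/imsetP => z zx ->.
apply: (loop_ind (P := fun z => f z \in loop A' B' (f x)) _ _ _ zx) => [v|v|].
- by rewrite fA loopA.
- by rewrite fB loopB.
- by rewrite loop_refl.
Qed.

Lemma embedding_ext (f g : {ffun T -> X}) x y :
  f \in embeddings -> g \in embeddings -> f x = g x -> y \in loop A B x -> f y = g y.
Proof.
case/embeddingsP => _ fA fB /embeddingsP[_ gA gB] e yx; apply/eqP.
apply: (loop_ind (P := fun z => f z == g z) _ _ _ yx) => [v|v|].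
- by rewrite fA gA => /eqP ->.
- by rewrite fB gB => /eqP ->.
- by rewrite e.
Qed.

Let sz y := (#|loop A' B' y| %/ 2)%N.

(* The possible images of representatives of distinct loops of half-lengths [s]: they lie
   in distinct loops of the same half-lengths, none of them in [avoid]. *)
Fixpoint targets (s : seq nat) (avoid : seq {set X}) : seq (seq X) :=
  if s is a :: s' then
    flatten [seq [seq y :: ys | ys <- targets s' (loop A' B' y :: avoid)]
      | y <- enum X & (sz y == a) && (loop A' B' y \notin avoid)]
  else [:: [::]].

Lemma mem_targets s avoid ys :
  (ys \in targets s avoid) =
  [&& map sz ys == s, all (fun y => loop A' B' y \notin avoid) ys
    & uniq (map (loop A' B') ys)].
Proof.
elim: s avoid ys => [|a s IHs] avoid [|y ys] //=.
  by apply/flatten_mapP => -[y _ /mapP[]].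
rewrite eqseq_cons; apply/flatten_mapP/idP => [[z]|].
  rewrite mem_filter => /andP[/andP[sza zav] _] /mapP[zs]; rewrite IHs.
  case/and3P => e1 /allP e2 e3 [-> ->]; rewrite sza zav e1 e3 /= andbT.
  apply/andP; split; first by apply/allP => w /e2; rewrite inE negb_or => /andP[].
  by apply/negP => /mapP[w /e2]; rewrite inE negb_or => /andP[/eqP h _] /esym.
case/and3P => /andP[e1 e2] /andP[e3 /allP e4] /andP[e5 e6].
exists y; first by rewrite mem_filter e1 e3 mem_enum.
apply/mapP; exists ys => //; rewrite IHs e2 e6 andbT /=.
apply/allP => w wy; rewrite inE negb_or e4 // andbT.
by apply: contraNneq e5 => <-; apply/mapP; exists w.
Qed.

Lemma uniq_targets s avoid : uniq (targets s avoid).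
Proof.
elim: s avoid => [|a s IHs] avoid //=.
elim: (filter _ _) (filter_uniq (fun y => (sz y == a) && (loop A' B' y \notin avoid))
  (enum_uniq X)) => //= y l IHl /andP[yl ul].
rewrite cat_uniq IHl // map_inj_uniq ?IHs; last by move=> ? ? [].
rewrite andbT /=; apply/hasPn => zs /flatten_mapP[z zl /mapP[ws _ ->]].
by apply/negP => /mapP[ys _ [e _]]; rewrite -e zl in yl.
Qed.

(** Loops of half-lengths [s] are embedded one after another, [m i] loops of half-length [i] being
    available: there are [m a] choices of a target loop and [2 * a] of a base point in it. *)
Fixpoint emb_count (s : seq nat) (m : nat -> nat) : nat :=
  if s is a :: s' then (2 * a * m a * emb_count s' (fun i => m i - (i == a)))%N else 1%N.

Lemma eq_emb_count s m m' : m =1 m' -> emb_count s m = emb_count s m'.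
Proof.
elim: s m m' => //= a s IHs m m' e; rewrite e; congr (_ * _)%N.
by apply: IHs => i; rewrite e.
Qed.

Let avail (avoid : seq {set X}) (i : nat) := #|[set C in gloops A' B' | (C \notin avoid) && (#|C| %/ 2 == i)%N]|.

Lemma size_targets s (avoid : seq {set X}) :
  size (targets s avoid) = emb_count s (avail avoid).
Proof.
elim: s avoid => [|a s IHs] avoid //=.
rewrite size_flatten /shape -map_comp sumnE big_map big_filter.
have e1 y : (sz y == a) && (loop A' B' y \notin avoid) ->
   size (targets s (loop A' B' y :: avoid)) = emb_count s (fun i => avail avoid i - (i == a))%N.
  move=> /andP[/eqP sy ya]; rewrite IHs; apply: eq_emb_count => i; rewrite /avail.
  set S := [set C in _ | (C \notin avoid) && _].
  have -> : [set C in gloops A' B' | (C \notin loop A' B' y :: avoid) && (#|C| %/ 2 == i)%N]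
     = S :\ loop A' B' y.
    apply/setP => C; rewrite !inE negb_or.
    by case: (C \in gloops _ _); case: (C == _); case: (C \in avoid).
  rewrite [in RHS](cardsD1 (loop A' B' y) S).
  have -> : (loop A' B' y \in S) = (i == a).
    by rewrite inE mem_gloops ya /= -/(sz y) sy eq_sym.
  by rewrite addnC addnK.
under eq_bigr => y yP do rewrite /= size_map e1 //.
rewrite big_enum_cond /= sum_nat_const; congr (_ * _)%N.
set P := [set C in gloops A' B' | (C \notin avoid) && (#|C| %/ 2 == a)%N].
have -> : avail avoid a = #|P| by [].
rewrite -sum1_card (partition_big (loop A' B') (mem P)); last first.
  by move=> y /andP[/eqP sy ya]; rewrite inE /P inE mem_gloops ya -/(sz y) sy eqxx.
transitivity (\sum_(C in P) (2 * a))%N; last by rewrite sum_nat_const mulnC.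
apply: eq_bigr => C hC; have {hC} : C \in P by []. rewrite /P inE => /and3P[CL Cav /eqP Ca].
rewrite sum1dep_card.
have -> : [set y | (y \in (fun y => (sz y == a) && (loop A' B' y \notin avoid)))
    && (loop A' B' y == C)] = C.
  apply/setP => y; rewrite inE [X in X && _]unfold_in; apply/idP/idP.
    by case/andP => _ /eqP <-; exact: loop_refl.
  move=> yC; rewrite /sz -(mem_loop_eq ppA' ppB' CL yC) Ca Cav.
  by rewrite !eqxx.
by case/gloopsP: CL Ca => y -> <-; rewrite card_loop_half // card_loop // mul2n.
Qed.

End Transport.

(** Each embedded loop leaves one target fewer of its length, whence a falling factorial; [K] is any
    strict bound on the lengths. *)
Lemma emb_countE s m K : all (fun i => i < K)%N s ->
  emb_count s m =
  (\prod_(i < K) ((2 * i) ^ count_mem (i : nat) s * (m i) ^_ (count_mem (i : nat) s)))%N.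
Proof.
elim: s m => [|a s IHs] m /=; first by rewrite big1.
case/andP => aK sK; rewrite IHs // [RHS](bigD1 (Ordinal aK)) //=.
rewrite [X in (_ * X)%N = _](bigD1 (Ordinal aK)) //= eqxx add1n ffactnS expnS subn1.
rewrite -!mulnA; congr (_ * (_ * _))%N; rewrite !mulnA; congr (_ * _)%N.
  by rewrite -!mulnA mulnCA.
apply: eq_bigr => i ia; have /negbTE ne : (i : nat) != a.
  by apply: contraNneq ia => e; apply/eqP/val_inj.
by rewrite ne subn0 eq_sym ne add0n.
Qed.

Lemma perm_emb_count s s' m : perm_eq s s' -> emb_count s m = emb_count s' m.
Proof.
move=> ss'; have [K sK] : exists K, all (fun i => i < K)%N s.
  exists (sumn s).+1; apply/allP => i; rewrite ltnS.
  by elim: (s) => //= a l IHl; rewrite inE => /orP[/eqP->|/IHl h]; rewrite ?leq_addr // (leq_trans h) ?leq_addl.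
rewrite (emb_countE m sK) (emb_countE m (K := K)) -?(perm_all _ ss') //.
by apply: eq_bigr => i _; rewrite (seq.permP ss').
Qed.

(** Only half-length 1 has spare loops: with [m = mult 1 s] its falling factorial is
    ['C(d + m, m) * m!], the origin of the binomial in [Sigma]. The other lengths give plain
    factorials. *)
Lemma emb_count_zee s d : all (fun i => 0 < i)%N s ->
  emb_count s (fun i => count_mem i (s ++ nseq d 1%N)) =
  (2 ^ size s * zee s * 'C(d + mult 1 s, mult 1 s))%N.
Proof.
move=> s0; pose K := (sumn s).+2.
have sK : all (fun i => i < K)%N s.
  apply/allP => i; rewrite /K => h; apply: leqW; move: h; rewrite ltnS.
  by elim: (s) => //= a l IHl; rewrite inE => /orP[/eqP->|/IHl h]; rewrite ?leq_addr // (leq_trans h) ?leq_addl.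
have K1 : (1 < K)%N by [].
rewrite (emb_countE _ sK).
have -> : (2 ^ size s = \prod_(i < K) 2 ^ count_mem (i : nat) s)%N.
  rewrite -expn_sum; congr (2 ^ _)%N.
  elim: (s) sK => [|a l IHl] /=; first by rewrite big1.
  case/andP => aK lK; rewrite big_split /= -IHl // (bigD1 (Ordinal aK)) //= eqxx big1 ?addn0 //.
  by move=> i ia; apply/eqP; rewrite eqb0 eq_sym; apply: contraNneq ia => e; apply/eqP/val_inj.
have -> : zee s = (\prod_(i < K) (i ^ count_mem (i : nat) s * (count_mem (i : nat) s)`!))%N.
  rewrite -(big_mkord xpredT (fun i => i ^ count_mem i s * (count_mem i s)`!)%N).
  rewrite (bigID (fun i => i \in s)) /= [X in (_ * X)%N]big1 ?muln1; last first.
    by move=> i /count_memPn ->.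
  rewrite -[RHS]big_filter; apply: perm_big; apply: uniq_perm.
  - exact: undup_uniq.
  - by rewrite filter_uniq // iota_uniq.
  - move=> i; rewrite mem_undup mem_filter mem_index_iota /=.
    by case h: (i \in s) => //=; move/allP: sK => /(_ i h) ->.
rewrite -big_split /=.
rewrite (bigD1 (Ordinal K1)) //= [X in _ = (X * _)%N](bigD1 (Ordinal K1)) //=.
rewrite -[RHS]mulnAC; congr (_ * _)%N.
  rewrite muln1 exp1n mul1n -[RHS]mulnA; congr (_ * _)%N.
  by rewrite [RHS]mulnC bin_ffact count_cat count_nseq /= mul1n addnC.
apply: eq_bigr => i i1; rewrite expnMn -mulnA; congr (_ * (_ * _))%N.
rewrite count_cat count_nseq /=.
have /negbTE -> : 1%N != i by apply: contraNneq i1 => e; apply/eqP/val_inj.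
by rewrite mul0n addn0 ffactnn.
Qed.

(** An embedding is determined on a loop by the image of one representative; conversely [transport]
    extends any choice of images in distinct loops of the right lengths. *)
Lemma card_embeddings (T X : finType) (A B : {perm T}) (A' B' : {perm X}) :
  pp A -> pp B -> pp A' -> pp B' ->
  #|embeddings A B A' B'| =
  emb_count (gltype A B) (fun i => count_mem i (gltype A' B')).
Proof.
move=> ppA ppB ppA' ppB'.
pose r := fingraph.root (lrel A B).
pose reps := [seq x <- enum T | r x == x].
have cs := loop_csym ppA ppB.
have r_in x : r x \in reps.
  by rewrite mem_filter mem_enum andbT /r root_root.
have r_loop x : x \in loop A B (r x) by rewrite loop_memC // inE connect_root.
have r_eq x y : y \in loop A B x -> r y = r x.
  by rewrite inE => xy; apply/esym/(fingraph.rootP cs).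
have repsE x : x \in reps -> r x = x by rewrite mem_filter => /andP[/eqP].
have perm_reps : perm_eq (map (loop A B) reps) (enum (mem (gloops A B))).
  apply: uniq_perm; rewrite ?enum_uniq //.
    rewrite map_inj_in_uniq ?(filter_uniq _ (enum_uniq T)) // => x y xr yr /eqP.
    by rewrite loop_eq // => /r_eq; rewrite !repsE.
  move=> C; rewrite mem_enum; apply/mapP/idP => [[x _ ->]|].
    exact: mem_gloops.
  move=> hC; case/gloopsP: (hC) => x e; exists (r x) => //.
  by rewrite e; apply/eqP; rewrite loop_eq // loop_memC.
pose szT x := (#|loop A B x| %/ 2)%N.
have perm_s : perm_eq (gltype A B) (map szT reps).
  rewrite /gltype perm_sort perm_sym.
  by have := perm_map (fun C : {set T} => #|C| %/ 2)%N perm_reps; rewrite -map_comp.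
rewrite (perm_emb_count _ perm_s).
rewrite (@eq_emb_count _ _
  (fun i => #|[set C in gloops A' B' | (C \notin [::]) && (#|C| %/ 2 == i)%N]|)); last first.
  move=> i; rewrite /gltype (seq.permP (permEl (perm_sort _ _))) count_map.
  rewrite -size_filter -(size_map id) map_id cardE; apply: perm_size; apply: uniq_perm.
  - exact: (filter_uniq _ (enum_uniq _)).
  - exact: enum_uniq.
  - by move=> C; rewrite mem_filter !mem_enum !inE /= andbC.
rewrite -(size_targets ppA' ppB') cardE.
pose pr (f : {ffun T -> X}) := map f reps.
rewrite -(size_map pr).
apply: perm_size; apply: uniq_perm.
- rewrite map_inj_in_uniq ?enum_uniq // => f g; rewrite !mem_enum => hf hg e.
  apply/ffunP => x.
  apply: (embedding_ext hf hg _ (r_loop x)).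
  move/eq_in_map: e; exact.
- exact: uniq_targets.
move=> ys; rewrite mem_targets //; apply/mapP/idP => [[f]|].
  rewrite mem_enum => hf ->.
  have sizes x : #|loop A' B' (f x)| = #|loop A B x|.
    rewrite (embedding_loop ppA ppB ppA' ppB') // card_imset //.
    by case/embeddingsP: hf.
  apply/and3P; split.
  - by rewrite -map_comp; apply/eqP/eq_map => x; rewrite /= sizes.
  - by apply/allP.
  - rewrite -map_comp map_inj_in_uniq ?(filter_uniq _ (enum_uniq T)) // => x y xr yr /= /eqP.
    rewrite !(embedding_loop ppA ppB ppA' ppB') // => /eqP e.
    case/embeddingsP: (hf) => fi _ _.
    have := loop_refl A B x; rewrite -(mem_imset _ _ fi) e mem_imset // => /r_eq.
    by rewrite !repsE.
case/and3P => /eqP e1 _ e2.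
have sz_ys : size ys = size reps by rewrite -(size_map szT) -e1 size_map.
(* The default value [y0] of [nth] needs an element of [X]; when [X] is empty, so is [T]. *)
case: (pickP (mem X)) => [y0 _|X0]; last first.
  have T0 : #|T| = 0%N.
    apply: eq_card0 => x; apply/negP => _; have := r_in x.
    rewrite -index_mem -sz_ys; case: (ys) => //= y.
    by have := X0 y.
  have noT (x : T) : False by have := card0_eq T0 x.
  pose f := [ffun x : T => False_rect X (noT x)].
  exists f.
    by rewrite mem_enum; apply/embeddingsP; split => [x|x|x]; case: (noT x).
  have reps0 : reps = [::] by case: (reps) => // x; case: (noT x).
  by rewrite /pr reps0; apply: size0nil; rewrite sz_ys reps0.
pose yv z := nth y0 ys (index (r z) reps).
pose f := [ffun z => transport A B A' B' (r z) (yv z) z].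
have cards z : #|loop A B (r z)| = #|loop A' B' (yv z)|.
  have h : (index (r z) reps < size reps)%N by rewrite index_mem.
  move/(congr1 (nth 0%N ^~ (index (r z) reps))): e1.
  rewrite (nth_map y0) ?sz_ys // (nth_map z) // nth_index // /szT.
  rewrite !card_loop_half // => e.
  by rewrite !card_loop // e.
have eqv z : equivariant_at A B A' B' f z.
  have := transport_equivariant ppA ppB ppA' ppB' (cards z) (r_loop z).
  have rA : r (A z) = r z by apply: r_eq; rewrite loopA // loop_refl.
  have rB : r (B z) = r z by apply: r_eq; rewrite loopB // loop_refl.
  by rewrite /equivariant_at !ffunE /yv rA rB.
have f_loop z : f z \in loop A' B' (yv z).
  by rewrite ffunE -(transport_image ppA ppB ppA' ppB' (cards z)) imset_f.
have fi : injective f.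
  move=> x z exz.
  have e : r x = r z.
    have hx : (index (r x) reps < size ys)%N by rewrite sz_ys index_mem.
    have hz : (index (r z) reps < size ys)%N by rewrite sz_ys index_mem.
    have : loop A' B' (yv x) == loop A' B' (yv z).
      have h w : loop A' B' (yv w) == loop A' B' (f w) by rewrite loop_eq.
      by rewrite (eqP (h x)) exz -(eqP (h z)).
    rewrite /yv -!(nth_map y0 set0 (loop A' B')) // nth_uniq ?size_map // => /eqP e.
    by rewrite -[r x](nth_index x (r_in x)) e nth_index.
  apply: (transport_inj ppA ppB ppA' ppB' (cards x)) => //; first by rewrite e.
  by move: exz; rewrite !ffunE /yv e.
exists f.
  by rewrite mem_enum inE; apply/andP; split; [apply/injectiveP | apply/forallP].
apply: (@eq_from_nth _ y0); first by rewrite sz_ys size_map.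
move=> i; rewrite sz_ys => hi.
have [x0 ex0] : exists x0, x0 = nth x0 reps i.
  case: (reps) hi => // x0 l hi; exists (nth x0 (x0 :: l) i); exact: set_nth_default.
have hx0 : x0 \in reps by rewrite ex0 mem_nth.
rewrite (nth_map x0) // -ex0 ffunE /yv repsE //.
have ei : index x0 reps = i by rewrite ex0 index_uniq ?(filter_uniq _ (enum_uniq T)).
rewrite transport_base ?ei //; have := cards x0; rewrite /yv repsE // ei; exact.
Qed.

(** * The doubled diagram *)

Section GlType.
Variables (T : finType) (A B : {perm T}).
Hypotheses (ppA : pp A) (ppB : pp B).

Lemma gloopsC : gloops A B = gloops B A.
Proof.
apply: eq_imset => x; apply/setP => y; rewrite !inE.
by apply: eq_connect => u v; rewrite /lrel orbC.
Qed.

Lemma gltypeC : gltype A B = gltype B A.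
Proof. by rewrite /gltype gloopsC. Qed.

Lemma gltype_gt0 : all (fun i => 0 < i)%N (gltype A B).
Proof.
rewrite all_sort; apply/allP => i /mapP[C]; rewrite mem_enum => /gloopsP[x ->] ->.
by rewrite card_loop_half // lt0n card_porbit_neq0.
Qed.

Lemma is_part_gltype : is_part (gltype A B).
Proof.
rewrite /is_part gltype_gt0 andbT; apply: sort_sorted => x y; exact: leq_total.
Qed.

Lemma sumn_gltype : (2 * sumn (gltype A B))%N = #|T|.
Proof.
have -> : sumn (gltype A B) = sumn [seq (#|C| %/ 2)%N | C : {set T} <- enum (mem (gloops A B))].
  by apply: perm_sumn; rewrite perm_sort.
rewrite -cardsT (card_partition (gloops_partition ppA ppB)) sumnE big_map big_distrr /=.
rewrite big_enum /=; apply: eq_bigr => C /gloopsP[x ->].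
by rewrite card_loop_half // card_loop // mul2n.
Qed.

End GlType.

(** The image of a loop is a loop of the same length, and a loop of the target that meets the image
    of [f] is one of these. *)
Lemma embedding_gltype (T X : finType) (A B : {perm T}) (A' B' : {perm X}) f :
  pp A -> pp B -> pp A' -> pp B' -> f \in embeddings A B A' B' ->
  perm_eq (gltype A' B')
    (gltype A B ++ [seq (#|C| %/ 2)%N | C : {set X} <-
      enum [set C in gloops A' B' | [disjoint C & codom f]]]).
Proof.
move=> ppA ppB ppA' ppB' hf; case/embeddingsP: (hf) => fi fA fB.
rewrite /gltype perm_sort.
have /permPr -> : perm_eq
    (sort geq [seq (#|C| %/ 2)%N | C : {set T} <- enum (mem (gloops A B))] ++
      [seq (#|C| %/ 2)%N | C : {set X} <-
        enum [set C in gloops A' B' | [disjoint C & codom f]]])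
    ([seq (#|C| %/ 2)%N | C : {set X} <- map (fun C : {set T} => f @: C) (enum (mem (gloops A B)))] ++
    [seq (#|C| %/ 2)%N | C : {set X} <- enum [set C in gloops A' B' | [disjoint C & codom f]]]).
  rewrite perm_cat2r perm_sort -map_comp.
  by under [X in perm_eq _ X]eq_map => C do rewrite /= card_imset //.
rewrite -map_cat; apply: perm_map; apply: uniq_perm.
- exact: enum_uniq.
- rewrite cat_uniq enum_uniq map_inj_uniq ?enum_uniq ?andbT /=; last exact: imset_inj.
  apply/hasPn => C; rewrite mem_enum inE => /andP[_ dC]; apply/negP => /mapP[D].
  rewrite mem_enum => /gloopsP[x ->] e.
  move: dC; rewrite e => /pred0P/(_ (f x)) /=.
  by rewrite codom_f andbT => /negP; apply; apply: imset_f; rewrite loop_refl.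
- move=> C; rewrite mem_cat !mem_enum inE.
  apply/idP/orP => [hC|[/mapP[D]|/andP[] //]].
    case: (boolP [disjoint C & codom f]) => d; [right; by rewrite hC|left].
    case/pred0Pn: d => z /= /andP[zC /codomP[x ez]].
    apply/mapP; exists (loop A B x); first by rewrite mem_enum mem_gloops.
    by rewrite (mem_loop_eq ppA' ppB' hC zC) ez (embedding_loop ppA ppB ppA' ppB').
  rewrite mem_enum => /gloopsP[x ->] ->.
  by rewrite -(embedding_loop ppA ppB ppA' ppB') // mem_gloops.
Qed.

Lemma sumn_take_nth (s : seq nat) i : sumn (take i s) = (\sum_(j < i) nth 0 s j)%N.
Proof.
elim: s i => [|a s IHs] [|i] //=; rewrite ?big_ord0 //.
  by rewrite big1 // => j _; rewrite nth_nil.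
by rewrite big_ord_recl /= IHs.
Qed.

Lemma nth_leq_sumn (s : seq nat) i : (nth 0 s i <= sumn s)%N.
Proof.
by elim: s i => [|a s IHs] [|i] //=; rewrite ?leq_addr // (leq_trans (IHs i)) ?leq_addl.
Qed.

Lemma size_leq_sumn (s : seq nat) : all (fun i => 0 < i)%N s -> (size s <= sumn s)%N.
Proof.
elim: s => //= a s IHs /andP[a0 s0]; rewrite -add1n; apply: leq_add => //; exact: IHs.
Qed.

(** A partition of [n] has at most [n] parts, each at most [n], so padding it with zeros gives one
    of the tuples filtered by [parts_of]. *)
Lemma mem_parts_of n s : (s \in parts_of n) = is_part s && (sumn s == n).
Proof.
rewrite mem_undup; apply/mapP/andP => [[t]|[/andP[so s0] /eqP sn]].
  rewrite mem_filter => /andP[/andP[so /eqP sn] _] ->.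
  rewrite /is_part filter_all andbT sorted_filter //; last by move=> a b c /= ab bc; exact: leq_trans bc ab.
  split=> //; apply/eqP; rewrite -[RHS]sn.
  by elim: [seq _ | _ <- _] => //= a l IHl; case: a => //= a; rewrite IHl.
have szs : (size s <= n)%N.
  by rewrite -sn size_leq_sumn.
pose t := [tuple inord (nth 0%N s i) | i < n] : n.-tuple 'I_n.+1.
have et : [seq val i | i <- val t] = s ++ nseq (n - size s) 0%N.
  apply: (@eq_from_nth _ 0%N).
    by rewrite size_map size_tuple size_cat size_nseq subnKC.
  move=> i; rewrite size_map size_tuple => hi.
  rewrite (nth_map ord0) ?size_tuple // -[i]/(val (Ordinal hi)) -tnth_nth tnth_mktuple.
  have hle : (nth 0%N s i < n.+1)%N by rewrite ltnS -[X in (_ <= X)%N]sn nth_leq_sumn.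
  rewrite /= inordK // nth_cat; case: ltnP => // h.
  by rewrite nth_nseq if_same nth_default.
exists t.
  rewrite mem_filter mem_enum andbT et sumn_cat sumn_nseq addn0 sn eqxx andbT.
  case: (s) so => [|a l] /= so.
    by case: (n - 0)%N => //= m; elim: m.
  rewrite cat_path so /=; case: (n - _)%N => //= m.
  by elim: m.
rewrite et filter_cat.
have -> : [seq a <- nseq (n - size s) 0%N | (0 < a)%N] = [::] by elim: (n - _)%N.
by rewrite cats0; apply/esym/all_filterP.
Qed.

(* The cells of the diagram with rows doubled in length: [((i, j), h)] is the half [h] of the
   box in row [i] and column [j].  For [sumn lam = n] the bound [n] on [i] and [j] is harmless. *)
Definition dcell n lam := {b : 'I_n * 'I_n * bool | in_diag lam (val b.1.1, val b.1.2)}.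

Section Cells.
Variables (n : nat) (lam : seq nat).
Local Notation cell := (dcell n lam).

Definition row (x : cell) : 'I_n := (val x).1.1.
Definition col (x : cell) : 'I_n := (val x).1.2.
Definition half (x : cell) : bool := (val x).2.

Lemma cell_eq (x y : cell) : row x = row y -> col x = col y -> half x = half y -> x = y.
Proof.
case: x y => -[[i j] h] p [[[i' j'] h'] p']; rewrite /row /col /half /= => e1 e2 e3.
by apply: val_inj; rewrite /= e1 e2 e3.
Qed.

Definition flipc (x : cell) : cell := exist _ ((val x).1, ~~ half x) (valP x).

Lemma flipcK : involutive flipc.
Proof. by move=> x; apply: cell_eq; rewrite // /half /= negbK. Qed.

Definition flip : {perm cell} := perm (inv_inj flipcK).

Lemma flipE x : flip x = flipc x. Proof. exact: permE. Qed.
Lemma row_flip x : row (flip x) = row x. Proof. by rewrite flipE. Qed.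
Lemma col_flip x : col (flip x) = col x. Proof. by rewrite flipE. Qed.
Lemma half_flip x : half (flip x) = ~~ half x. Proof. by rewrite flipE. Qed.

Lemma pp_flip : pp flip.
Proof.
apply/forallP => x; rewrite {1}flipE flipE flipcK eqxx /=; apply/eqP => e.
by have := half_flip x; rewrite flipE e; case: (half x).
Qed.

Definition col_adm (S : {perm cell}) :=
  pp S && [forall x, (col (S x) == col x) && (half (S x) == ~~ half x)].
Definition row_adm (S : {perm cell}) := pp S && [forall x, row (S x) == row x].

Lemma col_admP S : reflect [/\ pp S, forall x, col (S x) = col x & forall x, half (S x) = ~~ half x]
  (col_adm S).
Proof.
apply: (iffP andP) => [[ppS /forallP h]|[ppS h1 h2]].
  by split=> // x; case/andP: (h x) => /eqP ? /eqP.
by split; [exact: ppS|apply/forallP => x; rewrite h1 h2 !eqxx].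
Qed.

Lemma row_admP S : reflect (pp S /\ forall x, row (S x) = row x) (row_adm S).
Proof.
apply: (iffP andP) => [[ppS /forallP h]|[ppS h1]].
  by split=> // x; exact/eqP.
by split; [exact: ppS|apply/forallP => x; rewrite h1].
Qed.

Definition sg (S : {perm cell}) : rat := (-1) ^+ (n - #|gloops flip S|).

(* The candidate for the coefficient of [p_rho] in the zonal polynomial of [lam]. *)
Definition ycoef (rho : seq nat) : rat :=
  \sum_(S1 | col_adm S1) \sum_(S2 | row_adm S2) sg S1 * (gltype S1 S2 == rho)%:R.

Hypotheses (lam_part : is_part lam) (lam_sum : sumn lam = n).

Lemma card_row r : #|[set x : cell | row x == r]| = (2 * nth 0 lam r)%N.
Proof.
have hle : (nth 0 lam r <= n)%N by rewrite -[X in (_ <= X)%N]lam_sum nth_leq_sumn.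
pose g (p : 'I_(nth 0%N lam r) * bool) : cell :=
  exist _ ((r, widen_ord hle p.1), p.2) (ltn_ord p.1).
have gi : injective g.
  by move=> [a b] [c d] /(congr1 val) [] /= e ->; congr (_, _); apply: val_inj.
have -> : [set x : cell | row x == r] = g @: setT.
  apply/setP => x; rewrite inE; apply/eqP/imsetP => [e|[p _ ->]] //.
  have hx : (col x < nth 0 lam r)%N by rewrite -e; have := valP x.
  exists (Ordinal hx, half x) => //; apply: cell_eq => //.
  by apply: val_inj.
by rewrite card_imset // cardsT card_prod card_ord card_bool mulnC.
Qed.

Lemma card_rows_lt i : #|[set x : cell | row x < i]%N| = (2 * sumn (take i lam))%N.
Proof.
rewrite sumn_take_nth big_distrr /=.
rewrite -sum1_card (partition_big row (fun r : 'I_n => (r < i)%N)) /=; last first.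
  by move=> x; rewrite inE.
transitivity (\sum_(r < n | (r < i)%N) 2 * nth 0 lam r)%N.
  apply: eq_bigr => r ri; rewrite -card_row -sum1_card; apply: eq_bigl => x; rewrite !inE.
  by apply/andP/eqP => [[_ /eqP]|->].
rewrite -(big_mkord (fun j => j < i)%N (fun j => 2 * nth 0 lam j)%N).
rewrite -(big_mkord xpredT (fun j => 2 * nth 0 lam j)%N).
have szn : (size lam <= n)%N.
  by rewrite -lam_sum; case/andP: lam_part => _; exact: size_leq_sumn.
(* Parts beyond the length of [lam] are 0, so the range can be enlarged until it contains both
   bounds. *)
have ext m : (n <= m)%N -> (\sum_(0 <= j < n | j < i) 2 * nth 0 lam j =
                 \sum_(0 <= j < m | j < i) 2 * nth 0 lam j)%N.
  move=> nm; rewrite [RHS](big_cat_nat _ nm) //= [X in (_ + X)%N]big_nat_cond [X in (_ + X)%N]big1 ?addn0 //.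
  by move=> j /andP[/andP[nj _] _]; rewrite nth_default ?muln0 // (leq_trans szn).
rewrite (ext (n + i)%N) ?leq_addr // (big_cat_nat _ (leq_addl n i)) //=.
rewrite [X in (_ + X)%N]big_nat_cond [X in (_ + X)%N]big1 ?addn0; last by move=> j; lia.
by rewrite big_nat_cond [RHS]big_nat; apply: eq_bigl => j; lia.
Qed.

Lemma card_cell : #|{: cell}| = (2 * n)%N.
Proof.
have := card_rows_lt n; rewrite take_oversize ?lam_sum.
  by move=> <-; rewrite -cardsT; apply: eq_card => x; rewrite !inE ltn_ord.
by rewrite -lam_sum; case/andP: lam_part => _; exact: size_leq_sumn.
Qed.

Lemma column_initial (x : cell) (i : 'I_n) : (i <= row x)%N ->
  in_diag lam (val i, val (col x)).
Proof.
move=> ix; have := valP x; rewrite /in_diag /= => h; apply: (leq_trans h).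
case/andP: lam_part => so _.
case: (ltnP (row x) (size lam)) => hs; last first.
  by have := valP x; rewrite /in_diag /= (nth_default 0%N hs).
have tr : transitive geq by move=> a b c /= ab bc; exact: leq_trans bc ab.
by apply: (sorted_leq_nth tr (fun a => leqnn a) 0%N so) => //; exact: (leq_ltn_trans ix).
Qed.

Definition column (A : {set cell}) j h := [set x in A | (col x == j) && (half x == h)].

(** Either the half-column continues to row [i] or further, and then its first [i] rows already
    provide [i] cells, or it lies entirely within these rows. *)
Lemma card_column_rows_lt (A : {set cell}) i j h : (#|column A j h| <= i)%N ->
  (#|column A j h| <= #|column [set x | row x < i]%N j h|)%N.
Proof.
move=> hA.
case: (boolP [exists x : cell, [&& col x == j, half x == h & (i <= row x)%N]]).
  case/existsP => x /and3P[/eqP xj /eqP xh ix]; apply: (leq_trans hA).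
  have hi (k : 'I_i) : (k < n)%N by rewrite (ltn_trans (ltn_ord k)) // (leq_ltn_trans ix).
  have hd (k : 'I_i) : in_diag lam (val (Ordinal (hi k)), val (col x)).
    by apply: column_initial; rewrite /= ltnW // (leq_trans (ltn_ord k)).
  pose g (k : 'I_i) : cell := exist _ ((Ordinal (hi k), col x), h) (hd k).
  have gi : injective g by move=> a b /(congr1 val) [] e; apply: val_inj.
  rewrite -{1}(card_ord i) -cardsT -(card_imset _ gi); apply: subset_leq_card.
  by apply/subsetP => y /imsetP[k _ ->]; rewrite !inE /= /col /half /= -/(col x) xj !eqxx ltn_ord.
rewrite negb_exists => /forallP nx; apply: subset_leq_card; apply/subsetP => x.
rewrite !inE => /and3P[_ xj xh]; rewrite xj xh !andbT.
by have := nx x; rewrite xj xh /= -ltnNge.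
Qed.

Lemma card_columns (A : {set cell}) : #|A| = (\sum_(p : 'I_n * bool) #|column A p.1 p.2|)%N.
Proof.
rewrite -sum1_card (partition_big (fun x => (col x, half x)) xpredT) //=.
apply: eq_bigr => -[j h] _; rewrite sum1dep_card.
by apply: eq_card => x; rewrite !inE.
Qed.

(** The combinatorial source of dominance, for orthogonality as well as for triangularity. *)
Lemma card_col_bounded (A : {set cell}) i :
  (forall j h, #|column A j h| <= i)%N -> (#|A| <= 2 * sumn (take i lam))%N.
Proof.
move=> hA; rewrite -card_rows_lt !card_columns.
by apply: leq_sum => -[j h] _; exact: card_column_rows_lt.
Qed.

End Cells.

(** * Dominance order and orthogonality *)

Lemma dominatedP mu lam :
  reflect (sumn mu = sumn lam /\ forall i, (sumn (take i mu) <= sumn (take i lam))%N)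
          (dominated mu lam).
Proof.
apply: (iffP andP) => [[/eqP e /allP h]|[-> h]]; last by rewrite eqxx; split=> //; apply/allP.
split=> // i; case: (ltnP i (size mu + size lam).+1) => hi.
  by apply: h; rewrite mem_iota add0n.
have [h1 h2] : (size mu <= i)%N /\ (size lam <= i)%N.
  split; apply: ltnW; apply: (leq_trans _ hi); by rewrite ltnS ?leq_addr ?leq_addl.
by rewrite !take_oversize // e.
Qed.

Lemma dominated_trans mu nu lam : dominated mu nu -> dominated nu lam -> dominated mu lam.
Proof.
move=> /dominatedP[e1 h1] /dominatedP[e2 h2]; apply/dominatedP; rewrite e1 e2.
by split=> // i; exact: leq_trans (h1 i) (h2 i).
Qed.

Lemma dominated_anti mu lam : is_part mu -> is_part lam ->
  dominated mu lam -> dominated lam mu -> mu = lam.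
Proof.
move=> /andP[_ m0] /andP[_ l0] /dominatedP[_ h1] /dominatedP[_ h2].
have h i : sumn (take i mu) = sumn (take i lam) by apply/eqP; rewrite eqn_leq h1 h2.
have nthE i : nth 0%N mu i = nth 0%N lam i.
  apply/eqP; rewrite -(eqn_add2l (sumn (take i mu))) {2}h.
  by have := h i.+1; rewrite !sumn_take_nth !big_ord_recr /= => ->.
have sz s t : all (fun i => 0 < i)%N s -> all (fun i => 0 < i)%N t ->
    (forall i, nth 0%N s i = nth 0%N t i) -> (size s <= size t)%N.
  move=> s0 t0 e; rewrite leqNgt; apply/negP => lt.
  have := all_nthP 0%N s0 _ lt; by rewrite e nth_default.
apply: (@eq_from_nth _ 0%N) => // ; apply/eqP; rewrite eqn_leq; apply/andP; split; exact: sz.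
Qed.

Lemma dominated_refl lam : dominated lam lam.
Proof. by apply/dominatedP. Qed.

(** * Conjugation by a transposition *)

Lemma conj_pp (T : finType) (S t : {perm T}) : pp S -> pp (S ^ t).
Proof.
move=> ppS; apply/forallP => z; rewrite -[z](permKV t) !permJ (ppK ppS) eqxx /=.
by rewrite (inj_eq perm_inj) pp_neq.
Qed.

Section TpermConj.
Variables (n : nat) (lam : seq nat).
Hypotheses (lam_part : is_part lam) (lam_sum : sumn lam = n).
Local Notation cell := (dcell n lam).

Lemma conj_tperm_invar (T : finType) (V : eqType) (g : T -> V) (x y : T) (S : {perm T}) :
  g x = g y -> (forall z, g (S z) = g z) -> forall z, g ((S ^ tperm x y)%g z) = g z.
Proof.
move=> e h z; have gt w : g (tperm x y w) = g w by case: tpermP => // ->.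
by rewrite conjgE !permM gt h tpermV gt.
Qed.

Lemma conj_tperm_neg (T : finType) (g : T -> bool) (x y : T) (S : {perm T}) :
  g x = g y -> (forall z, g (S z) = ~~ g z) -> forall z, g ((S ^ tperm x y)%g z) = ~~ g z.
Proof.
move=> e h z; have gt w : g (tperm x y w) = g w by case: tpermP => // ->.
by rewrite conjgE !permM gt h tpermV gt.
Qed.

Lemma conj_tpermK (T : finType) (x y : T) : involutive (fun S : {perm T} => (S ^ tperm x y)%g).
Proof. by move=> S; rewrite -conjgM tperm2 conjg1. Qed.

Lemma conj_tpermE (T : finType) (x y : T) (S : {perm T}) z :
  (S ^ tperm x y)%g (tperm x y z) = tperm x y (S z).
Proof. exact: permJ. Qed.

Lemma col_adm_conj (x y : cell) S : col x = col y -> half x = half y ->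
  col_adm (S ^ tperm x y) = col_adm S.
Proof.
move=> ec eh.
have imp S' : col_adm S' -> col_adm (S' ^ tperm x y).
  move=> /col_admP[ppS h1 h2]; apply/col_admP; split.
  - exact: conj_pp.
  - exact: conj_tperm_invar.
  - exact: conj_tperm_neg.
by apply/idP/idP => [/imp|/imp //]; rewrite conj_tpermK.
Qed.

Lemma row_adm_conj (x y : cell) S : row x = row y ->
  row_adm (S ^ tperm x y) = row_adm S.
Proof.
move=> er.
have imp S' : row_adm S' -> row_adm (S' ^ tperm x y).
  move=> /row_admP[ppS h1]; apply/row_admP; split; first exact: conj_pp.
  exact: conj_tperm_invar.
by apply/idP/idP => [/imp|/imp //]; rewrite conj_tpermK.
Qed.

Lemma sg_conj (x y : cell) S : x != y -> half x = half y -> col_adm S ->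
  sg (S ^ tperm x y) = - sg S.
Proof.
move=> nxy eh /col_admP[ppS _ hS].
exact: (loop_sign_flip (pp_flip n lam) ppS (card_cell lam_part lam_sum)
  (@half_flip n lam) hS nxy eh).
Qed.

End TpermConj.

Section Orthogonality.
Variables (n : nat).

(** The scalar product of [ycoef n lam] and [ycoef n mu] splits into a sum over bijections [f] of a
    product of two such factors, one for [f] and one for its inverse. *)
Definition mixed_sum lam mu (f : {ffun dcell n lam -> dcell n mu}) : rat :=
  \sum_(S | col_adm S) \sum_(S' | row_adm S') sg S * [forall z, f (S z) == S' (f z)]%:R.

Lemma rat_opp_eq0 (x : rat) : x = - x -> x = 0.
Proof.
by move/eqP; rewrite -subr_eq0 opprK -mulr2n Num.Theory.mulrn_eq0 /= => /eqP.
Qed.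

(* Conjugating [S] by [tperm x y] and [S'] by [tperm (f x) (f y)] only changes the sign. *)
Lemma mixed_sum_eq0 lam mu (f : {ffun dcell n lam -> dcell n mu}) x y :
  is_part lam -> sumn lam = n ->
  injective f -> x != y -> col x = col y -> half x = half y -> row (f x) = row (f y) ->
  mixed_sum f = 0.
Proof.
move=> lp ls fi nxy ec eh er; apply: rat_opp_eq0.
rewrite /mixed_sum [LHS](reindex_inj (can_inj (@conj_tpermK _ x y))) /= -[RHS]sumrN.
apply: eq_big => [S|S hS]; first exact: col_adm_conj.
rewrite [LHS](reindex_inj (can_inj (@conj_tpermK _ (f x) (f y)))) /= -[RHS]sumrN.
apply: eq_big => [S'|S' _]; first exact: row_adm_conj.
have hS' : col_adm S by rewrite -(col_adm_conj S ec eh).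
have E : [forall z, f ((S ^ tperm x y)%g z) == (S' ^ tperm (f x) (f y))%g (f z)] =
   [forall z, f (S z) == S' (f z)].
  apply/idP/idP => /forallP h; apply/forallP => z; apply/eqP.
    have /eqP := h (tperm x y z).
    by rewrite conj_tpermE !(inj_tperm _ _ _ fi) conj_tpermE => /perm_inj.
  have /eqP e := h (tperm x y z); rewrite (inj_tperm _ _ _ fi) in e.
  by rewrite -[z](tpermK x y) conj_tpermE !(inj_tperm _ _ _ fi) conj_tpermE e.
by rewrite (sg_conj lp ls nxy eh hS') E mulNr.
Qed.

(** When the sum is nonzero, [f] sends the cells of a half-column to distinct rows, so the preimage
    of the first [i] rows of [mu] has at most [i] cells in each half-column of [lam]. *)
Lemma mixed_sum_dominated lam mu (f : {ffun dcell n lam -> dcell n mu}) :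
  is_part lam -> sumn lam = n -> is_part mu -> sumn mu = n ->
  bijective f -> mixed_sum f != 0 -> dominated mu lam.
Proof.
move=> lp ls mp ms fb nz; apply/dominatedP; rewrite ls ms; split=> // i.
have fi := bij_inj fb.
rewrite -(leq_pmul2l (isT : (0 < 2)%N)) -(card_rows_lt mp ms i).
have -> : #|[set x : dcell n mu | row x < i]%N| = #|[set x : dcell n lam | row (f x) < i]%N|.
  rewrite -(card_imset _ fi); apply: eq_card => y; case: fb => g fK gK.
  by rewrite -[y]gK mem_imset // !inE.
apply: card_col_bounded => // j h.
have inj : {in column [set x : dcell n lam | (row (f x) < i)%N] j h &,
   injective (fun x => row (f x))}.
  move=> x y; rewrite !inE => /and3P[_ /eqP cx /eqP hx] /and3P[_ /eqP cy /eqP hy] e.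
  apply/eqP; apply: contraNT nz => nxy; apply/eqP.
  by apply: (mixed_sum_eq0 lp ls fi nxy) => //; rewrite ?cx ?hx.
rewrite -(card_in_imset inj).
apply: (@leq_trans #|[set r : 'I_n | (r < i)%N]|).
  apply: subset_leq_card; apply/subsetP => r /imsetP[x]; rewrite !inE => /and3P[h1 _ _] ->.
  by rewrite h1.
case: (leqP n i) => ni.
  by apply: leq_trans (max_card _) _; rewrite card_ord.
apply: (@leq_trans #|widen_ord (ltnW ni) @: [set: 'I_i]|); last first.
  by rewrite (leq_trans (leq_imset_card _ _)) // cardsT card_ord.
apply: subset_leq_card; apply/subsetP => r; rewrite inE => ri.
by apply/imsetP; exists (Ordinal ri) => //; apply: val_inj.
Qed.

(* [z_rho 2^l(rho)] counts the bijections carrying [(S1, S2)] to [(S2', S1')]; exchanging the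
   roles of the two pair-partitions makes both factors pair columns of one diagram with rows
   of the other, so a nonzero term forces [lam] and [mu] to dominate each other. *)
Lemma ycoef_orthogonal lam mu :
  is_part lam -> sumn lam = n -> is_part mu -> sumn mu = n -> lam != mu ->
  \sum_(rho <- parts_of n) ycoef n lam rho * ycoef n mu rho * (zee rho)%:R * 2 ^+ size rho = 0.
Proof.
move=> lp ls mp ms nlm.
pose G S1 S2 S1' S2' : rat := @sg n lam S1 * @sg n mu S1' * #|embeddings S1 S2 S2' S1'|%:R.
have Esum : \sum_(rho <- parts_of n) ycoef n lam rho * ycoef n mu rho * (zee rho)%:R * 2 ^+ size rho
  = \sum_(S1 | col_adm S1) \sum_(S2 | row_adm S2) \sum_(S1' | col_adm S1') \sum_(S2' | row_adm S2')
     G S1 S2 S1' S2'.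
  transitivity (\sum_(rho <- parts_of n) \sum_(S1 | @col_adm n lam S1) \sum_(S2 | @row_adm n lam S2) \sum_(S1' | @col_adm n mu S1') \sum_(S2' | @row_adm n mu S2')
    (sg S1 * sg S1' * (gltype S1 S2 == rho)%:R * (gltype S1' S2' == rho)%:R * ((zee rho)%:R * 2 ^+ size rho))).
    apply: eq_bigr => rho _; rewrite -mulrA /ycoef !big_distrl /=; apply: eq_bigr => S1 _.
    rewrite !big_distrl /=; apply: eq_bigr => S2 _.
    rewrite big_distrr big_distrl /=; apply: eq_bigr => S1' _.
    rewrite big_distrr big_distrl /=; apply: eq_bigr => S2' _.
    by rewrite !mulrA; congr (_ * _ * _); rewrite -!mulrA; congr (_ * _); rewrite mulrCA.
  rewrite exchange_big; apply: eq_bigr => S1 /col_admP[pp1 _ _] /=.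
  rewrite exchange_big; apply: eq_bigr => S2 /row_admP[pp2 _] /=.
  rewrite exchange_big; apply: eq_bigr => S1' /col_admP[pp1' _ _] /=.
  rewrite exchange_big; apply: eq_bigr => S2' /row_admP[pp2' _] /=.
  have inP : gltype S1 S2 \in parts_of n.
    rewrite mem_parts_of (is_part_gltype pp1 pp2) -(eqn_pmul2l (isT : (0 < 2)%N)).
    by rewrite (sumn_gltype pp1 pp2) (card_cell lp ls) eqxx.
  rewrite (bigD1_seq (gltype S1 S2) inP (undup_uniq _)) /= eqxx mulr1 big1 ?addr0; last first.
    by move=> rho /negbTE ne; rewrite eq_sym ne mulr0 !mul0r.
  rewrite /G; case: eqP => [e|ne].
    rewrite mulr1; congr (_ * _); rewrite (card_embeddings pp1 pp2 pp2' pp1').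
    rewrite (gltypeC S2') e.
    have := @emb_count_zee (gltype S1 S2) 0 (gltype_gt0 pp1 pp2).
    rewrite /= cats0 => ->; rewrite binn muln1 mulnC natrM natrX; exact: erefl.
  rewrite mulr0 mul0r.
  (* The two diagrams have equally many cells, so an embedding would be bijective, would leave no
     loop uncovered and would force equal types. *)
  suff -> : #|embeddings S1 S2 S2' S1'| = 0%N by rewrite mulr0.
  apply: eq_card0 => f; apply/negP => hf; case: ne.
  have := embedding_gltype pp1 pp2 pp2' pp1' hf.
  have fb : bijective f.
    by case/embeddingsP: hf => fi _ _; apply: inj_card_bij fi _; rewrite (card_cell lp ls) (card_cell mp ms).
  set E := enum _; have -> : E = [::].
    rewrite /E; apply/nilP; rewrite /nilp -cardE; apply/eqP/eq_card0 => C; rewrite inE.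
    apply/negP => /andP[/gloopsP[x ->] /pred0P/(_ x)] /=; rewrite loop_refl /=.
    by case: fb => g fK gK; rewrite -[x]gK codom_f.
  rewrite cats0 (gltypeC S2') => pe.
  apply: (sorted_eq (leT := geq)) => //.
  - by move=> a b c /= ab bc; exact: leq_trans bc ab.
  - by move=> a b /= /anti_leq ->.
  - by case/andP: (is_part_gltype pp1' pp2').
  - by case/andP: (is_part_gltype pp1 pp2).
rewrite Esum.
transitivity (\sum_(f : {ffun dcell n lam -> dcell n mu} | injectiveb f) mixed_sum f *
   \sum_(S2 | @row_adm n lam S2) \sum_(S1' | @col_adm n mu S1') sg S1' * [forall z, f (S2 z) == S1' (f z)]%:R).
  rewrite /G.
  transitivity (\sum_(S1 | @col_adm n lam S1) \sum_(S2 | @row_adm n lam S2) \sum_(S1' | @col_adm n mu S1') \sum_(S2' | @row_adm n mu S2') \sum_(f : {ffun dcell n lam -> dcell n mu} | injectiveb f)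
    ((sg S1 * [forall z, f (S1 z) == S2' (f z)]%:R) * (sg S1' * [forall z, f (S2 z) == S1' (f z)]%:R))).
    apply: eq_bigr => S1 _; apply: eq_bigr => S2 _; apply: eq_bigr => S1' _; apply: eq_bigr => S2' _.
    rewrite -sum1_card natr_sum big_distrr /= [RHS]big_mkcond [LHS]big_mkcond; apply: eq_bigr => f _.
    rewrite inE; case: (injectiveb f) => //=.
    rewrite mulr1 mulrACA -natrM mulnb.
    have -> : [forall z, equivariant_at S1 S2 S2' S1' f z] =
       [forall z, f (S1 z) == S2' (f z)] && [forall z, f (S2 z) == S1' (f z)].
      apply/forallP/andP => [h|[/forallP h1 /forallP h2] z].
        by split; apply/forallP => z; case/andP: (h z).
      by rewrite /equivariant_at h1 h2.
    by case: (_ && _); rewrite ?mulr1 ?mulr0.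
  rewrite [LHS](eq_bigr (fun S1 => \sum_(f : {ffun dcell n lam -> dcell n mu} | injectiveb f)
    \sum_(S2 | @row_adm n lam S2) \sum_(S1' | @col_adm n mu S1') \sum_(S2' | @row_adm n mu S2')
    ((sg S1 * [forall z, f (S1 z) == S2' (f z)]%:R) * (sg S1' * [forall z, f (S2 z) == S1' (f z)]%:R)))); last first.
    move=> S1 _.
    under eq_bigr => S2 _ do under eq_bigr => S1' _ do rewrite exchange_big.
    under eq_bigr => S2 _ do rewrite exchange_big.
    by rewrite exchange_big.
  rewrite exchange_big; apply: eq_bigr => f _ /=.
  rewrite /mixed_sum big_distrl /=; apply: eq_bigr => S1 _.
  rewrite big_distrr /=; apply: eq_bigr => S2 _.
  rewrite big_distrr /=; apply: eq_bigr => S1' _.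
  by rewrite big_distrl.
apply: big1 => f /injectiveP fi.
have fb : bijective f by apply: inj_card_bij fi _; rewrite (card_cell lp ls) (card_cell mp ms).
have [g0 fK gK] := fb.
pose g := [ffun z => g0 z].
(* Read along the inverse [g] of [f], the second factor is a mixed sum from [mu] to [lam]. *)
have -> : \sum_(S2 | @row_adm n lam S2) \sum_(S1' | @col_adm n mu S1') sg S1' * [forall z, f (S2 z) == S1' (f z)]%:R = mixed_sum g.
  rewrite exchange_big; apply: eq_bigr => S1' _; apply: eq_bigr => S2 _.
  have -> : [forall z, f (S2 z) == S1' (f z)] = [forall z, g (S1' z) == S2 (g z)].
    apply/idP/idP => /forallP h; apply/forallP => z; rewrite ?ffunE.
      by have /eqP := h (g0 z); rewrite gK => <-; rewrite fK.
    by have := h (f z); rewrite !ffunE fK => /eqP <-; rewrite gK.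
  by [].
have gb : bijective g by exists f => z; rewrite ?ffunE.
apply/eqP; rewrite mulf_eq0; apply: contraT => /norP[h1 h2].
case/eqP: nlm; apply: dominated_anti => //.
  exact: mixed_sum_dominated h2.
exact: mixed_sum_dominated h1.
Qed.

End Orthogonality.

(** * Monomial expansion of symmetric polynomials *)

Lemma geq_trans : transitive geq.
Proof. by move=> a b c /= ab bc; exact: leq_trans bc ab. Qed.

Lemma sort_geq_eq (s t : seq nat) : sorted geq t -> (sort geq s == t) = perm_eq s t.
Proof.
move=> st; apply/eqP/idP => [<-|st']; first by rewrite perm_sym perm_sort.
apply: (sorted_eq (leT := geq)) => //.
- exact: geq_trans.
- by move=> a b /= /anti_leq ->.
- by apply: sort_sorted => a b; exact: leq_total.
- by rewrite perm_sort.
Qed.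

Section Monomials.
Variable n : nat.
Implicit Types (m : 'X_{1..n}) (nu : seq nat).

Definition sortm m := sort geq (filter (fun a => 0 < a)%N [seq m i | i <- enum 'I_n]).
Definition mono nu : 'X_{1..n} := [multinom nth 0%N nu i | i < n].

Lemma sumn_sortm m : sumn (sortm m) = mdeg m.
Proof.
have -> : sumn (sortm m) = sumn (filter (fun a => 0 < a)%N [seq m i | i <- enum 'I_n]).
  by apply: perm_sumn; rewrite perm_sort.
rewrite mdegE -[RHS]big_enum /= -(big_map m xpredT id) -sumnE.
by elim: [seq _ | _ <- _] => //= -[|a] l IHl //=; rewrite IHl.
Qed.

Lemma is_part_sortm m : is_part (sortm m).
Proof.
rewrite /is_part all_sort filter_all andbT.
by apply: sort_sorted => a b; exact: leq_total.
Qed.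

Lemma sortm_parts m : (sortm m \in parts_of n) = (mdeg m == n).
Proof. by rewrite mem_parts_of is_part_sortm sumn_sortm. Qed.

Lemma mono_val nu : is_part nu -> sumn nu = n ->
  [seq mono nu i | i <- enum 'I_n] = nu ++ nseq (n - size nu) 0%N.
Proof.
move=> /andP[_ nu0] nun.
have szn : (size nu <= n)%N by rewrite -[X in (_ <= X)%N]nun size_leq_sumn.
apply: (@eq_from_nth _ 0%N).
  by rewrite size_map size_enum_ord size_cat size_nseq subnKC.
move=> i; rewrite size_map size_enum_ord => hi.
rewrite (nth_map (Ordinal hi)) ?size_enum_ord // mnmE nth_enum_ord // nth_cat.
by case: ltnP => // h; rewrite nth_nseq if_same nth_default.
Qed.

Lemma filter_nseq0 d : [seq a <- nseq d 0%N | (0 < a)%N] = [::].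
Proof. by elim: d. Qed.

Lemma sortm_mono nu : is_part nu -> sumn nu = n -> sortm (mono nu) = nu.
Proof.
move=> np ns; apply/eqP; rewrite /sortm mono_val //.
case/andP: (np) => nso nu0; rewrite sort_geq_eq // filter_cat filter_nseq0 cats0.
by rewrite (all_filterP nu0).
Qed.

Lemma sortm_perm m : mdeg m = n -> exists s : 'S_n, m = [multinom mono (sortm m) (s i) | i < n].
Proof.
move=> dm; have np := is_part_sortm m; have ns : sumn (sortm m) = n by rewrite sumn_sortm.
pose t := [tuple mono (sortm m) i | i < n].
have tE : t = [seq mono (sortm m) i | i <- enum 'I_n] :> seq nat by [].
have : perm_eq [seq m i | i <- enum 'I_n] t.
  rewrite tE mono_val //.
  apply: (@perm_trans _ ([seq a <- [seq m i | i <- enum 'I_n] | (0 < a)%N] ++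
    [seq a <- [seq m i | i <- enum 'I_n] | ~~ (0 < a)%N])).
    by rewrite perm_sym perm_filterC.
  have sz : size [seq a <- [seq m i | i <- enum 'I_n] | ~~ (0 < a)%N] = (n - size (sortm m))%N.
    rewrite size_sort !size_filter -[X in (X - _)%N](size_enum_ord n) -(size_map m).
    by rewrite -(count_predC (fun a => 0 < a)%N) addKn.
  apply: perm_cat; first by rewrite perm_sym perm_sort.
  rewrite -sz; set l := filter _ _.
  suff {1}-> : l = nseq (size l) 0%N by exact: perm_refl.
  apply/all_pred1P; rewrite /l; apply/allP => a; rewrite mem_filter -eqn0Ngt.
  by case/andP => /eqP ->.
case/tuple_permP => s e; exists s; apply/mnmP => i; rewrite mnmE.
have := congr1 (fun l => nth 0%N l i) e.
rewrite (nth_map i) ?size_enum_ord // nth_ord_enum => ->.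
by rewrite -[X in nth _ X _]/(tval [tuple tnth t (s i) | i < n]) -tnth_nth !tnth_mktuple.
Qed.

Lemma mcoeff_msymm nu m : (msymm n nu)@_m = (sortm m == nu)%:R.
Proof.
rewrite /msymm raddf_sum /=.
have mE (e : {ffun 'I_n -> 'I_(sumn nu).+1}) :
    (\prod_(i < n) 'X_i ^+ e i : {mpoly rat[n]})@_m = ([multinom val (e i) | i < n] == m)%:R.
  have -> : \prod_(i < n) 'X_i ^+ e i = 'X_[ [multinom val (e i) | i < n] ] :> {mpoly rat[n]}.
    by rewrite [RHS]mpolyXE_id; apply: eq_bigr => i _; rewrite mnmE.
  by rewrite mcoeffX.
under eq_bigr => e _ do rewrite mE.
case: eqP => [sm|sm].
  have le i : (m i < (sumn nu).+1)%N.
    rewrite ltnS -sm sumn_sortm mdegE (bigD1 i) //=; exact: leq_addr.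
  pose e0 := [ffun i => Ordinal (le i)].
  have e0E : [multinom val (e0 i) | i < n] = m by apply/mnmP => i; rewrite mnmE ffunE.
  rewrite (bigD1 e0) /=.
    rewrite e0E eqxx big1 ?addr0 // => e /andP[_ ne].
    case: eqP => // ee; case/eqP: ne; apply/ffunP => i; rewrite ffunE; apply: val_inj.
    by rewrite /= -ee mnmE.
  apply/eqP; rewrite -[RHS]sm /sortm; congr (sort _ (filter _ _)).
  by apply: eq_map => i; rewrite ffunE.
rewrite big1 // => e /eqP he; case: eqP => // em; case: sm; rewrite -em -[RHS]he /sortm.
by congr (sort _ (filter _ _)); apply: eq_map => i; rewrite mnmE.
Qed.

(** [n] variables have room for every partition of [n], so each monomial of degree [n] is a
    rearrangement of exactly one [mono nu]. *)
Lemma symmetric_expansion (p : {mpoly rat[n]}) :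
  p \is symmetric -> p \is n.-homog ->
  p = \sum_(nu <- parts_of n) p@_(mono nu) *: msymm n nu.
Proof.
move=> ps ph; apply/mpolyP => m; rewrite raddf_sum /=.
under eq_bigr => nu _ do rewrite mcoeffZ mcoeff_msymm.
case: (eqVneq (mdeg m) n) => [dm|dm].
  rewrite (bigD1_seq (sortm m)) ?undup_uniq ?sortm_parts ?dm //= eqxx mulr1.
  rewrite big1 ?addr0; last by move=> nu /negbTE ne; rewrite eq_sym ne mulr0.
  have [s {1}->] := sortm_perm dm; exact: msym_coeff.
rewrite (dhomog_nemf_coeff ph dm) big_seq big1 // => nu hnu.
case: eqP => [e|_]; last by rewrite mulr0.
by move: hnu; rewrite -e sortm_parts (negbTE dm).
Qed.

Lemma psum_sym r : psum n r \is symmetric.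
Proof.
apply/issymP => s; rewrite rmorph_sum /= (reindex_inj (perm_inj (s := s^-1))) /=.
by apply: eq_bigr => i _; rewrite rmorphXn /= /msym mmapX mmap1U permKV.
Qed.

Lemma ppow_sym rho : ppow n rho \is symmetric.
Proof. by apply: rpred_prod => r _; exact: psum_sym. Qed.

Lemma ppow_homog rho : ppow n rho \is (sumn rho).-homog.
Proof.
elim: rho => [|r rho IHrho]; first by rewrite /ppow big_nil dhomog1.
rewrite /ppow big_cons; apply: dhomogM => //.
apply: rpred_sum => i _.
have X1 : ('X_i : {mpoly rat[n]}) \is 1.-homog by rewrite dhomogX; apply/eqP; exact: mdeg1.
by have := dhomogMn r X1; rewrite mul1n.
Qed.

Lemma perm_ppow rho rho' : perm_eq rho rho' -> ppow n rho = ppow n rho'.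
Proof. exact: perm_big. Qed.

End Monomials.

(** * The zonal polynomial as a sum over fillings *)

Lemma card_half_loop (T : finType) (A B : {perm T}) (h : T -> bool) C :
  pp A -> pp B -> (forall x, h (A x) = ~~ h x) -> C \in gloops A B ->
  #|[set x in C | ~~ h x]| = (#|C| %/ 2)%N.
Proof.
move=> ppA ppB hA /gloopsP[x0 ->].
have := @loopA _ A B ppA x0; move: (loop A B x0) => C' closedA.
have <- : (#|[set x in C' | ~~ h x]| + #|[set x in C' | h x]| = #|C'|)%N.
  rewrite -cardsUI addnC.
  have -> : [set x in C' | ~~ h x] :&: [set x in C' | h x] = set0.
    by apply/setP => x; rewrite !in_setI !in_set; case: (h x); rewrite ?andbF.
  rewrite cards0 add0n; apply: eq_card => x; rewrite in_setU !in_set.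
  by case: (h x); rewrite ?andbF ?andbT ?orbF.
have -> : [set x in C' | h x] = A @: [set x in C' | ~~ h x].
  apply/setP => x; rewrite -[x in RHS](ppK ppA) mem_imset; last exact: perm_inj.
  by rewrite !in_set hA negbK closedA.
by rewrite card_imset ?addnn -?muln2 ?mulnK //; exact: perm_inj.
Qed.

(** A loop of half-length [l] contributes [p_l]: its common value [v] ranges over the variables, and
    exactly [l] of its elements lie in the class [~~ h], which gives [X_v^l]. *)
Lemma ppow_gltype n (T : finType) (A B : {perm T}) (h : T -> bool) :
  pp A -> pp B -> (forall x, h (A x) = ~~ h x) ->
  ppow n (gltype A B) =
  \sum_(c : {ffun T -> 'I_n} | [forall x, (c (A x) == c x) && (c (B x) == c x)])
     \prod_(x | ~~ h x) 'X_(c x).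
Proof.
move=> ppA ppB hA.
pose w (x : T) (v : 'I_n) : {mpoly rat[n]} := if h x then 1 else 'X_v.
transitivity (\sum_(c : {ffun T -> 'I_n} | [forall x, (c (A x) == c x) && (c (B x) == c x)])
     \prod_x w x (c x)); last first.
  apply: eq_bigr => c _; rewrite [RHS]big_mkcond; apply: eq_bigr => x _.
  by rewrite /w; case: (h x).
rewrite (sum_const_on_loops ppA ppB) /gltype.
rewrite (perm_ppow n (permEl (perm_sort geq _))) /ppow big_map big_enum /=.
apply: eq_bigr => C hC; apply: eq_bigr => v _.
rewrite -(card_half_loop ppA ppB hA hC) /w.
apply: esym; rewrite -[RHS]prodr_const.
transitivity (\prod_(x in C | ~~ h x) ('X_v : {mpoly rat[n]})); last first.
  by apply: eq_bigl => x; rewrite in_set.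
by rewrite [RHS]big_mkcondr /=; apply: eq_bigr => x _; case: (h x).
Qed.

Section Ypoly.
Variables (n : nat) (lam : seq nat).
Hypotheses (lam_part : is_part lam) (lam_sum : sumn lam = n).
Local Notation cell := (dcell n lam).
Implicit Types (c : {ffun cell -> 'I_n}).

Definition Dsum c : rat := \sum_(S1 | col_adm S1 && [forall x, c (S1 x) == c x]) sg S1.
Definition Rcount c : nat := #|[set S2 : {perm cell} | row_adm S2 && [forall x, c (S2 x) == c x]]|.
Definition content c : 'X_{1..n} := (\sum_(x | ~~ half x) U_(c x))%MM.

(* Since [p_rho] is a product over loops, [ypoly] becomes a sum over fillings [c] of the
   cells by variables, those constant on the pairs of [S1] and [S2]; reading [c] on one half
   extracts the monomial. *)
Definition ypoly : {mpoly rat[n]} := \sum_(rho <- parts_of n) ycoef n lam rho *: ppow n rho.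

Lemma gltype_parts S1 S2 : @col_adm n lam S1 -> row_adm S2 -> gltype S1 S2 \in parts_of n.
Proof.
case/col_admP => pp1 _ _ /row_admP[pp2 _].
rewrite mem_parts_of (is_part_gltype pp1 pp2) -(eqn_pmul2l (isT : (0 < 2)%N)).
by rewrite (sumn_gltype pp1 pp2) (card_cell lam_part lam_sum) eqxx.
Qed.

Lemma ypolyE : ypoly = \sum_c (Dsum c * (Rcount c)%:R) *: 'X_[content c].
Proof.
transitivity (\sum_(S1 | @col_adm n lam S1) \sum_(S2 | @row_adm n lam S2)
   sg S1 *: ppow n (gltype S1 S2)).
  rewrite /ypoly /ycoef.
  transitivity (\sum_(rho <- parts_of n) \sum_(S1 | @col_adm n lam S1)
    \sum_(S2 | @row_adm n lam S2) (sg S1 * (gltype S1 S2 == rho)%:R) *: ppow n rho).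
    apply: eq_bigr => rho _; rewrite scaler_suml; apply: eq_bigr => S1 _.
    by rewrite scaler_suml.
  rewrite exchange_big; apply: eq_bigr => S1 h1 /=.
  rewrite exchange_big; apply: eq_bigr => S2 h2 /=.
  rewrite (bigD1_seq (gltype S1 S2) (gltype_parts h1 h2) (undup_uniq _)) /=.
  rewrite eqxx mulr1 big1 ?addr0 // => rho /negbTE ne.
  by rewrite eq_sym ne mulr0 scale0r.
transitivity (\sum_(S1 | @col_adm n lam S1) \sum_(S2 | @row_adm n lam S2) \sum_(c : {ffun cell -> 'I_n})
   (sg S1 * [forall x, c (S1 x) == c x]%:R * [forall x, c (S2 x) == c x]%:R) *: 'X_[content c]).
  apply: eq_bigr => S1 /col_admP[pp1 _ hS1]; apply: eq_bigr => S2 /row_admP[pp2 _].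
  rewrite (ppow_gltype n pp1 pp2 hS1) scaler_sumr big_mkcond; apply: eq_bigr => c _.
  have -> : [forall x, (c (S1 x) == c x) && (c (S2 x) == c x)] =
       [forall x, c (S1 x) == c x] && [forall x, c (S2 x) == c x].
    apply/idP/idP => [/forallP h|/andP[/forallP h1 /forallP h2]].
      by apply/andP; split; apply/forallP => x; case/andP: (h x).
    by apply/forallP => x; rewrite h1 h2.
  rewrite -mulrA -natrM mulnb; case: (_ && _); last by rewrite mulr0 scale0r.
  by rewrite mulr1 mprodXE.
transitivity (\sum_(S1 | @col_adm n lam S1) \sum_(c : {ffun cell -> 'I_n}) \sum_(S2 | @row_adm n lam S2)
   (sg S1 * [forall x, c (S1 x) == c x]%:R * [forall x, c (S2 x) == c x]%:R) *: ('X_[content c] : {mpoly rat[n]})).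
  by apply: eq_bigr => S1 _; rewrite exchange_big.
rewrite exchange_big; apply: eq_bigr => c _ /=.
under eq_bigr => S1 _ do rewrite -scaler_suml -mulr_sumr.
rewrite -scaler_suml -mulr_suml; congr ((_ * _) *: _).
  rewrite /Dsum [RHS]big_mkcondr /=; apply: eq_bigr => S1 _.
  by case: [forall _, _]; rewrite ?mulr1 ?mulr0.
rewrite /Rcount -sum1_card natr_sum big_mkcond [RHS]big_mkcond /=; apply: eq_bigr => S2 _.
rewrite in_set; case: (row_adm S2) => //=.
by case: [forall _, _].
Qed.

Lemma mcoeff_ypoly m : ypoly@_m = \sum_(c | content c == m) Dsum c * (Rcount c)%:R.
Proof.
rewrite ypolyE raddf_sum [RHS]big_mkcond /=; apply: eq_bigr => c _.
by rewrite mcoeffZ mcoeffX; case: eqP; rewrite ?mulr1 ?mulr0.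
Qed.

Lemma ypoly_sym : ypoly \is symmetric.
Proof. by apply: rpred_sum => rho _; apply: rpredZ; exact: ppow_sym. Qed.

Lemma ypoly_homog : ypoly \is n.-homog.
Proof.
rewrite /ypoly big_seq; apply: rpred_sum => rho; rewrite mem_parts_of => /andP[_ /eqP e].
by apply: rpredZ; have := ppow_homog n rho; rewrite e.
Qed.

(** This antisymmetry kills the fillings with a repeated entry in a half-column, and later evaluates
    [Dsum] as a product of signs of column permutations. *)
Lemma Dsum_tperm c x y : x != y -> col x = col y -> half x = half y ->
  Dsum [ffun z => c (tperm x y z)] = - Dsum c.
Proof.
move=> nxy ec eh; rewrite /Dsum.
rewrite [LHS](reindex_inj (can_inj (@conj_tpermK _ x y))) /= -[RHS]sumrN.
apply: eq_big => [S|S /andP[hS _]]; last first.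
  by apply: (sg_conj lam_part lam_sum nxy eh); rewrite -(col_adm_conj S ec eh).
rewrite (col_adm_conj S ec eh); congr (_ && _).
apply/idP/idP => /forallP h; apply/forallP => z.
  by have := h (tperm x y z); rewrite !ffunE conj_tpermE !tpermK.
have Sz : (S ^ tperm x y)%g z = tperm x y (S (tperm x y z)).
  by rewrite -conj_tpermE tpermK.
by have := h (tperm x y z); rewrite !ffunE Sz tpermK.
Qed.

Lemma Dsum_inj c x y : Dsum c != 0 -> col x = col y -> half x = half y -> c x = c y -> x = y.
Proof.
move=> nz ec eh e; apply/eqP; apply: contraNT nz => nxy; apply/eqP.
apply: rat_opp_eq0; rewrite -(Dsum_tperm c nxy ec eh); congr Dsum.
by apply/ffunP => z; rewrite ffunE; case: tpermP => // ->.
Qed.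

Lemma contentE c v : content c v = #|[set x | (c x == v) && ~~ half x]|.
Proof.
rewrite /content mnm_sumE -sum1_card big_mkcond [RHS]big_mkcond /=.
apply: eq_bigr => x _; rewrite in_set andbC; case: (half x) => //=.
by rewrite mnm1E; case: (c x == v).
Qed.

(** A nonzero [Dsum] supplies a column pair-partition preserving [c]; it exchanges the halves, which
    therefore carry the same values with the same multiplicities. *)
Lemma card_value_half c v : Dsum c != 0 ->
  #|[set x | (c x == v) && half x]| = content c v.
Proof.
move=> nz; have [S1 /andP[/col_admP[pp1 _ hS] /forallP hc]] : exists S1, col_adm S1 && [forall x, c (S1 x) == c x].
  apply/existsP; apply: contraNT nz; rewrite negb_exists => /forallP h.
  by rewrite /Dsum big1 // => S; rewrite (negbTE (h S)).
rewrite contentE -(card_imset _ (@perm_inj _ S1)); apply: eq_card => x.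
rewrite -[x](ppK pp1) mem_imset; last exact: perm_inj.
by rewrite !in_set (eqP (hc (S1 x))) [half (S1 (S1 x))]hS negbK.
Qed.

Lemma card_value c v : Dsum c != 0 -> #|[set x | c x == v]| = (2 * content c v)%N.
Proof.
move=> nz; rewrite mul2n -addnn -{1}(card_value_half v nz) contentE -cardsUI addnC.
have -> : [set x | (c x == v) && half x] :&: [set x | (c x == v) && ~~ half x] = set0.
  by apply/setP => x; rewrite in_setI !in_set; case: (half x); rewrite ?andbF.
rewrite cards0 add0n; apply: eq_card => x; rewrite in_setU !in_set.
by case: (half x); rewrite ?andbF ?andbT ?orbF.
Qed.

Lemma card_values_lt c nu i : is_part nu -> sumn nu = n -> Dsum c != 0 -> content c = mono n nu ->
  #|[set x | c x < i]%N| = (2 * sumn (take i nu))%N.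
Proof.
move=> np ns nz ec.
have card_v v : #|[set x | c x == v]| = (2 * nth 0 nu v)%N by rewrite card_value // ec mnmE.
rewrite -sum1_card (partition_big c (fun v : 'I_n => (v < i)%N)) /=; last by move=> x; rewrite in_set.
transitivity (\sum_(v < n | (v < i)%N) 2 * nth 0 nu v)%N.
  apply: eq_bigr => v vi; rewrite -card_v -sum1_card; apply: eq_bigl => x; rewrite !in_set.
  by apply/andP/eqP => [[_ /eqP]|->].
rewrite -(card_rows_lt np ns i).
rewrite -sum1_card (partition_big (@row n nu) (fun v : 'I_n => (v < i)%N)) /=; last by move=> x; rewrite in_set.
apply: eq_bigr => v vi.
have <- : #|[set x : dcell n nu | row x == v]| = (2 * nth 0 nu v)%N.
  exact: card_row.
rewrite -sum1_card; apply: eq_bigl => x; rewrite !in_set.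
by apply/eqP/andP => [->|[_ /eqP]].
Qed.

Lemma card_column_values_lt c i j h : Dsum c != 0 ->
  (#|column [set x | c x < i]%N j h| <= i)%N.
Proof.
move=> nz.
have inj : {in column [set x | (c x < i)%N] j h &, injective c}.
  move=> x y; rewrite !in_set => /and3P[_ /eqP cx /eqP hx] /and3P[_ /eqP cy /eqP hy].
  by apply: Dsum_inj; rewrite ?cx ?hx.
rewrite -(card_in_imset inj).
case: (leqP n i) => ni.
  by apply: leq_trans (max_card _) _; rewrite card_ord.
apply: (@leq_trans #|widen_ord (ltnW ni) @: [set: 'I_i]|); last first.
  by rewrite (leq_trans (leq_imset_card _ _)) // cardsT card_ord.
apply: subset_leq_card; apply/subsetP => r /imsetP[x]; rewrite !in_set => /and3P[ri _ _] ->.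
by apply/imsetP; exists (Ordinal ri) => //; apply: val_inj.
Qed.

(** A contributing filling has distinct entries in each half-column, so its values below [i] occupy
    at most [i] cells of each, and [card_col_bounded] applies. *)
Lemma ypoly_triangular nu : is_part nu -> sumn nu = n -> ypoly@_(mono n nu) != 0 ->
  dominated nu lam.
Proof.
move=> np ns; rewrite mcoeff_ypoly => nz.
have [c ec nzD] : exists2 c, content c = mono n nu & Dsum c != 0.
  case: (pickP [pred c | (content c == mono n nu) && (Dsum c != 0)]) => [c /andP[/eqP e h]|h].
    by exists c.
  case/eqP: nz; apply: big1 => c hc; have := h c; rewrite /= hc /= => /negbFE/eqP ->.
  by rewrite mul0r.
apply/dominatedP; rewrite ns lam_sum; split=> // i.
rewrite -(leq_pmul2l (isT : (0 < 2)%N)) -(card_values_lt i np ns nzD ec).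
by apply: (card_col_bounded lam_part lam_sum) => j h; exact: card_column_values_lt.
Qed.

End Ypoly.

(** * Uniqueness of Jack polynomials *)

Section Uniqueness.
Variables (n : nat).
Local Notation parts := (parts_of n).
Local Notation Y := (ypoly n).

(** Proved later as [ypoly_leading], by Gaussian integration; the rest of this section is linear
    algebra. *)
Hypothesis Y_leading : forall lam, lam \in parts -> (Y lam)@_(mono n lam) = hookc 2 lam.

Definition below lam nu := dominated nu lam && (nu != lam).

Lemma parts_dominated_anti mu lam : mu \in parts -> lam \in parts ->
  dominated mu lam -> dominated lam mu -> mu = lam.
Proof. by rewrite !mem_parts_of => /andP[mp _] /andP[lp _]; exact: dominated_anti. Qed.

(** Dominance is only a partial order, so the induction is on the number of partitions dominated by
    [lam], which drops strictly by antisymmetry. *)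
Lemma parts_dominance_ind (P : seq nat -> Prop) :
  (forall lam, lam \in parts -> (forall nu, nu \in parts -> below lam nu -> P nu) -> P lam) ->
  forall lam, lam \in parts -> P lam.
Proof.
move=> IH lam; move: {2}(count _ _) (erefl (count (dominated^~ lam) parts)) => k.
elim/ltn_ind: k lam => k IHk lam ek hlam; apply: IH => // nu hnu /andP[nl ne].
apply: (IHk (count (dominated^~ nu) parts)) => //; rewrite -ek.
have hsub rho : dominated rho nu -> dominated rho lam by move/dominated_trans; apply.
rewrite -!size_filter.
have sub : {subset [seq rho <- parts | dominated rho nu] <= [seq rho <- parts | dominated rho lam]}.
  by move=> rho; rewrite !mem_filter => /andP[/hsub -> ->].
have u mu : uniq [seq rho <- parts | dominated rho mu] by rewrite filter_uniq ?undup_uniq.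
rewrite ltn_neqAle (uniq_leq_size (u nu) sub) andbT.
apply/negP => /eqP e; have /= := uniq_min_size (u nu) sub.
rewrite e leqnn => /(_ isT)[_] /(_ lam).
rewrite !mem_filter hlam dominated_refl !andbT => /negP h.
by case/eqP: ne; apply: parts_dominated_anti => //; move: h; case: (dominated lam nu).
Qed.

(** The predicate bounds the partitions that may occur, so that triangularity survives linear
    operations. *)
Definition yspan (Q : pred (seq nat)) (p : {mpoly rat[n]}) :=
  exists2 c : seq nat -> rat, p = \sum_(nu <- parts) c nu *: Y nu &
    forall nu, nu \in parts -> c nu != 0 -> Q nu.

Lemma yspan0 Q : yspan Q 0.
Proof.
exists (fun _ => 0); last by move=> nu _; rewrite eqxx.
by rewrite big1 // => nu _; rewrite scale0r.
Qed.

Lemma yspanD Q p r : yspan Q p -> yspan Q r -> yspan Q (p + r).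
Proof.
move=> [c -> hc] [d -> hd]; exists (fun nu => c nu + d nu).
  by rewrite -big_split; apply: eq_bigr => nu _; rewrite scalerDl.
move=> nu hnu; apply: contraNT => nQ.
have -> : c nu = 0 by apply/eqP; apply: contraNT nQ; exact: hc.
by rewrite add0r; apply: contraNT nQ; exact: hd.
Qed.

Lemma yspanZ Q a p : yspan Q p -> yspan Q (a *: p).
Proof.
move=> [c -> hc]; exists (fun nu => a * c nu).
  by rewrite scaler_sumr; apply: eq_bigr => nu _; rewrite scalerA.
by move=> nu hnu; rewrite mulf_eq0 => /norP[_]; exact: hc.
Qed.

Lemma yspan_sum (I : eqType) (s : seq I) (F : I -> {mpoly rat[n]}) Q :
  (forall i, i \in s -> yspan Q (F i)) -> yspan Q (\sum_(i <- s) F i).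
Proof.
move=> h; rewrite big_seq; apply: (big_ind (yspan Q)); first exact: yspan0.
  exact: yspanD.
exact: h.
Qed.

Lemma yspan_sub (Q Q' : pred (seq nat)) p :
  (forall nu, nu \in parts -> Q nu -> Q' nu) -> yspan Q p -> yspan Q' p.
Proof. by move=> h [c -> hc]; exists c => // nu hnu /(hc _ hnu); exact: h. Qed.

Lemma yspan_gen lam : lam \in parts -> yspan (pred1 lam) (Y lam).
Proof.
move=> hl; exists (fun nu => (nu == lam)%:R).
  rewrite (bigD1_seq lam) ?undup_uniq //= eqxx scale1r big1 ?addr0 //.
  by move=> nu /negbTE ->; rewrite scale0r.
by move=> nu _ /=; case: (nu == lam) => //; rewrite eqxx.
Qed.

Lemma hookc_neq0 lam : hookc 2 lam != 0.
Proof.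
apply/prodf_neq0 => i _; apply/prodf_neq0 => j _.
by rewrite -natrM -natrD natr1 Num.Theory.pnatr_eq0.
Qed.

Lemma ypoly_expansion lam : lam \in parts ->
  Y lam = hookc 2 lam *: msymm n lam +
    \sum_(nu <- parts | below lam nu) (Y lam)@_(mono n nu) *: msymm n nu.
Proof.
move=> hl; move: (hl); rewrite mem_parts_of => /andP[lp /eqP ls].
rewrite {1}(symmetric_expansion (ypoly_sym n lam) (ypoly_homog n lam)).
rewrite (bigD1_seq lam) ?undup_uniq //= Y_leading //; congr (_ + _).
rewrite big_seq_cond [RHS]big_seq_cond big_mkcond [RHS]big_mkcond /=.
apply: eq_bigr => nu _; rewrite /below; case hnu: (nu \in parts) => //=.
case: (nu == lam); rewrite ?andbF // andbT.
case d: (dominated nu lam) => //.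
move: hnu; rewrite mem_parts_of => /andP[np /eqP ns].
have -> : (Y lam)@_(mono n nu) = 0.
  by apply/eqP; apply: contraFT d; exact: ypoly_triangular.
by rewrite scale0r.
Qed.

Lemma yspan_msymm lam : lam \in parts -> yspan (dominated^~ lam) (msymm n lam).
Proof.
move: lam; apply: parts_dominance_ind => lam hl IH.
have -> : msymm n lam = (hookc 2 lam)^-1 *:
   (Y lam + (-1) *: \sum_(nu <- parts | below lam nu) (Y lam)@_(mono n nu) *: msymm n nu).
  by rewrite {1}(ypoly_expansion hl) scaleN1r addrK scalerA mulVf ?scale1r ?hookc_neq0.
apply: yspanZ; apply: yspanD.
  by apply: yspan_sub (yspan_gen hl) => nu _ /eqP ->; exact: dominated_refl.
apply: yspanZ; rewrite -big_filter; apply: yspan_sum => nu.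
rewrite mem_filter => /andP[bnu hnu]; apply: yspanZ.
apply: yspan_sub (IH nu hnu bnu) => rho _ h; apply: (dominated_trans h).
by case/andP: bnu.
Qed.

Lemma yspan_ppow Q p : yspan Q p -> exists b : seq nat -> rat, p = \sum_(rho <- parts) b rho *: ppow n rho.
Proof.
case=> c -> _; exists (fun rho => \sum_(nu <- parts) c nu * ycoef n nu rho).
rewrite /ypoly; under eq_bigr => nu _ do rewrite scaler_sumr.
rewrite exchange_big; apply: eq_bigr => rho _ /=.
by rewrite scaler_suml; apply: eq_bigr => nu _; rewrite scalerA.
Qed.

(* The [msymm] span is reached from the [ppow], which gives a left inverse of the (square)
   transition matrix. *)
Lemma ppow_free (d : seq nat -> rat) : \sum_(rho <- parts) d rho *: ppow n rho = 0 ->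
  forall rho, rho \in parts -> d rho = 0.
Proof.
move=> d0; pose N := size parts; pose P (i : 'I_N) := nth [::] parts i.
have PP i : P i \in parts by exact: mem_nth.
have Pinj : injective P.
  by move=> i j /eqP; rewrite nth_uniq ?undup_uniq // => /eqP; exact: val_inj.
have sumP (V : zmodType) (F : seq nat -> V) : \sum_(rho <- parts) F rho = \sum_i F (P i).
  by rewrite (big_nth [::]) big_mkord.
pose M : 'M[rat]_N := \matrix_(i, j) (ppow n (P i))@_(mono n (P j)).
have hb i : exists b : seq nat -> rat, msymm n (P i) = \sum_(rho <- parts) b rho *: ppow n rho.
  exact: yspan_ppow (yspan_msymm (PP i)).
have {hb}[b hb] := fin_all_exists hb.
pose B : 'M[rat]_N := \matrix_(i, j) b i (P j).
have BM : B *m M = 1%:M.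
  apply/matrixP => i j; rewrite !mxE.
  have := congr1 (mcoeff (mono n (P j))) (hb i).
  rewrite mcoeff_msymm sumP raddf_sum /=.
  have /andP[pj /eqP sj] : is_part (P j) && (sumn (P j) == n) by rewrite -mem_parts_of.
  rewrite sortm_mono // (inj_eq Pinj) eq_sym => ->.
  by apply: eq_bigr => k _; rewrite !mxE mcoeffZ.
have MB := mulmx1C BM.
pose D : 'rV[rat]_N := \row_j d (P j).
have DM : D *m M = 0.
  apply/matrixP => i j; rewrite !mxE.
  have := congr1 (mcoeff (mono n (P j))) d0; rewrite sumP raddf_sum mcoeff0 /= => e; rewrite -[RHS]e.
  by apply: eq_bigr => k _; rewrite !mxE mcoeffZ.
have D0 : D = 0 by rewrite -[D]mulmx1 -MB mulmxA DM mul0mx.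
move=> rho hrho; have hi : (index rho parts < N)%N by rewrite index_mem.
have := congr1 (fun A : 'rV_N => A 0 (Ordinal hi)) D0.
by rewrite !mxE /P /= nth_index.
Qed.

Lemma zee_gt0 rho : is_part rho -> (0 < zee rho)%N.
Proof.
case/andP => _ /allP r0; rewrite /zee big_seq; apply: prodn_cond_gt0 => i.
by rewrite mem_undup => /r0 i0; rewrite muln_gt0 expn_gt0 i0 fact_gt0.
Qed.

(** The leading terms of both families cancel, so the difference [d] lies in the span of the [Y nu]
    with [nu] strictly below [lam]. By induction the two families agree on these [nu], so [d] is
    orthogonal to this span, hence to itself, and the weights [w] are positive. *)
Lemma jack_zonal J : jack_J_family 2 J ->
  forall lam, lam \in parts -> forall rho, rho \in parts -> J lam rho = ycoef n lam rho.
Proof.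
move=> /(_ n) [Jtri Jorth].
apply: parts_dominance_ind => lam hl IH.
pose d rho := J lam rho - ycoef n lam rho.
have [c ec hc] : yspan (below lam) (\sum_(rho <- parts) d rho *: ppow n rho).
  have -> : \sum_(rho <- parts) d rho *: ppow n rho =
     (\sum_(rho <- parts) J lam rho *: ppow n rho) + (-1) *: Y lam.
    rewrite scaleN1r /ypoly -sumrB; apply: eq_bigr => rho _; exact: scalerBl.
  have [u ->] := Jtri lam hl; rewrite (ypoly_expansion hl) scalerDr scalerDr addrACA.
  rewrite scaleN1r subrr add0r.
  have sub nu : nu \in parts -> below lam nu -> yspan (below lam) (msymm n nu).
    move=> hnu /andP[dn ne]; apply: yspan_sub (yspan_msymm hnu) => rho hrho dr.
    rewrite /below (dominated_trans dr dn) /=; apply: contraNneq ne => e.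
    by apply/eqP; apply: parts_dominated_anti => //; rewrite -e.
  by apply: yspanD; apply: yspanZ; rewrite -big_filter; apply: yspan_sum => nu;
    rewrite mem_filter => /andP[b h]; apply: yspanZ; exact: sub.
have dE rho : rho \in parts -> d rho = \sum_(nu <- parts) c nu * ycoef n nu rho.
  move=> hrho; apply/eqP; rewrite -subr_eq0; apply/eqP; move: rho hrho.
  apply: ppow_free.
  under eq_bigr => rho _ do rewrite scalerBl.
  rewrite sumrB ec; apply/eqP; rewrite subr_eq0; apply/eqP.
  rewrite /ypoly; under eq_bigr => nu _ do rewrite scaler_sumr.
  rewrite exchange_big; apply: eq_bigr => rho _ /=.
  by rewrite scaler_suml; apply: eq_bigr => nu _; rewrite scalerA.
pose w rho : rat := (zee rho)%:R * 2 ^+ size rho.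
have d_orth nu : nu \in parts -> below lam nu ->
    \sum_(rho <- parts) d rho * ycoef n nu rho * w rho = 0.
  move=> hnu bnu.
  have -> : \sum_(rho <- parts) d rho * ycoef n nu rho * w rho =
    \sum_(rho <- parts) J lam rho * J nu rho * (zee rho)%:R * 2 ^+ size rho -
    \sum_(rho <- parts) ycoef n lam rho * ycoef n nu rho * (zee rho)%:R * 2 ^+ size rho.
    rewrite -sumrB big_seq [RHS]big_seq; apply: eq_bigr => rho hrho.
    by rewrite (IH nu hnu bnu rho hrho) /w /d -!mulrA -mulrBl.
  case/andP: bnu => _ ne; rewrite Jorth //; last by rewrite eq_sym.
  move: hl hnu; rewrite !mem_parts_of => /andP[lp /eqP ls] /andP[np /eqP ns].
  by rewrite ycoef_orthogonal ?subrr // eq_sym.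
have dd : \sum_(rho <- parts) d rho ^+ 2 * w rho = 0.
  transitivity (\sum_(rho <- parts) \sum_(nu <- parts) c nu * (d rho * ycoef n nu rho * w rho)).
    rewrite big_seq [RHS]big_seq; apply: eq_bigr => rho hrho.
    rewrite expr2 {2}(dE rho hrho) mulr_sumr mulr_suml; apply: eq_bigr => nu _.
    by rewrite !mulrA [d rho * c nu]mulrC.
  rewrite exchange_big big_seq big1 // => nu hnu /=.
  rewrite -mulr_sumr; case: (eqVneq (c nu) 0) => [->|cn]; first by rewrite mul0r.
  by rewrite d_orth ?mulr0 //; exact: hc.
have w0 rho : rho \in parts -> 0 < w rho.
  rewrite mem_parts_of => /andP[rp _].
  by rewrite Num.Theory.mulr_gt0 ?Num.Theory.exprn_gt0 // Num.Theory.ltr0n zee_gt0.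
move=> rho hrho; apply/eqP; rewrite -subr_eq0 -/(d rho) -sqrf_eq0.
move: dd; rewrite big_seq => /eqP.
rewrite Num.Theory.psumr_eq0; last first.
  by move=> nu hnu; rewrite Num.Theory.mulr_ge0 ?Num.Theory.sqr_ge0 // Order.POrderTheory.ltW ?w0.
move=> /allP /(_ rho hrho) /implyP /(_ hrho).
by rewrite mulf_eq0 => /orP[//|/eqP e]; have := w0 rho hrho; rewrite e Order.POrderTheory.ltxx.
Qed.

End Uniqueness.

(** * Gaussian moments *)

(** The number of perfect matchings of [k] points, [(k-1)!!] for even [k] and 0 for odd [k]: the
    [k]-th moment of a standard Gaussian. *)
Fixpoint npairings (k : nat) : nat :=
  match k with 0 => 1 | 1 => 0 | k'.+2 => k'.+1 * npairings k' end.

Lemma npairingsS k : npairings k.+1 = (k * npairings k.-1)%N.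
Proof. by case: k. Qed.

Section Gauss.
Variable N : nat.
Implicit Types (p q : {mpoly rat[N]}) (m : 'X_{1..N}).

(* [gauss] is the expectation when the variables are independent standard Gaussians. *)
Definition moment m : rat := (\prod_(i < N) npairings (m i))%:R.
Definition gauss p : rat := \sum_(m <- msupp p) p@_m * moment m.

(** A common list containing several supports makes linearity a termwise identity. *)
Lemma gauss_seq p (s : seq 'X_{1..N}) : uniq s -> {subset msupp p <= s} ->
  gauss p = \sum_(m <- s) p@_m * moment m.
Proof.
move=> us sub; rewrite [RHS](bigID (fun m => m \in msupp p)) /=.
rewrite [X in _ + X]big1 ?addr0; last first.
  by move=> m; rewrite -mcoeff_eq0 => /eqP ->; rewrite mul0r.
rewrite -big_filter; apply: perm_big; apply: uniq_perm.
- exact: msupp_uniq.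
- by rewrite filter_uniq.
- by move=> m; rewrite mem_filter; case h: (m \in msupp p) => //=; rewrite sub.
Qed.

Lemma gaussD p q : gauss (p + q) = gauss p + gauss q.
Proof.
pose s := undup (msupp p ++ msupp q ++ msupp (p + q)).
have us : uniq s by exact: undup_uniq.
rewrite !(@gauss_seq _ s) //; try by move=> m h; rewrite mem_undup !mem_cat h ?orbT.
by rewrite -big_split; apply: eq_bigr => m _; rewrite mcoeffD mulrDl.
Qed.

Lemma gaussZ a p : gauss (a *: p) = a * gauss p.
Proof.
pose s := undup (msupp p ++ msupp (a *: p)).
have us : uniq s by exact: undup_uniq.
rewrite !(@gauss_seq _ s) //; try by move=> m h; rewrite mem_undup !mem_cat h ?orbT.
by rewrite mulr_sumr; apply: eq_bigr => m _; rewrite mcoeffZ mulrA.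
Qed.

Lemma gauss0 : gauss 0 = 0.
Proof. by rewrite /gauss msupp0 big_nil. Qed.

Lemma gauss_sum (I : Type) (s : seq I) (P : pred I) (F : I -> {mpoly rat[N]}) :
  gauss (\sum_(i <- s | P i) F i) = \sum_(i <- s | P i) gauss (F i).
Proof. exact: (big_morph gauss gaussD gauss0). Qed.

Lemma gaussX m : gauss 'X_[m] = moment m.
Proof. by rewrite /gauss msuppX big_seq1 mcoeffX eqxx mul1r. Qed.

Lemma gauss1 : gauss 1 = 1.
Proof. by rewrite -mpolyX0 gaussX /moment big1 // => i _; rewrite mnm0E. Qed.

(** Gaussian integration by parts; on monomials it is the recursion [npairingsS]. *)
Lemma gauss_wick i p : gauss ('X_i * p) = gauss p^`M(i).
Proof.
rewrite [p]mpolyE mulr_sumr raddf_sum /= !gauss_sum; apply: eq_bigr => m _.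
rewrite -scalerAr mderivZ !gaussZ; congr (_ * _).
rewrite mderivX gaussZ -mpolyXD !gaussX /moment.
rewrite (bigD1 i) //= [X in _ = _ * X%:R](bigD1 i) //= !mnmDE mnmBE mnm1E eqxx add1n subn1.
rewrite npairingsS -natrM mulnA; congr (_ * _)%:R.
by apply: eq_bigr => j ji; rewrite mnmDE mnmBE mnm1E eq_sym (negbTE ji) add0n subn0.
Qed.

Lemma mderiv_prod_set (I : finType) (F : I -> {mpoly rat[N]}) (A : {set I}) v :
  (\prod_(y in A) F y)^`M(v) = \sum_(y in A) (F y)^`M(v) * \prod_(z in A :\ y) F z.
Proof.
move: {2}#|A| (erefl #|A|) => k; elim: k A => [|k IHk] A cA.
  have -> : A = set0 by apply/eqP; rewrite -cards_eq0 cA.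
  by rewrite !big_set0 -mpolyC1 mderivC.
have [x xA] : exists x, x \in A by apply/set0Pn; rewrite -card_gt0 cA.
have cAx : #|A :\ x| = k by move: cA; rewrite (cardsD1 x) xA => -[].
rewrite (big_setD1 x xA) /= mderivM (IHk _ cAx) [RHS](big_setD1 x xA) /=; congr (_ + _).
rewrite mulr_sumr; apply: eq_bigr => y /setD1P[yx yA].
have xAy : x \in A :\ y by rewrite in_setD1 eq_sym yx.
rewrite [in RHS](big_setD1 x xAy) /= mulrCA; congr (_ * (_ * _)).
by apply: eq_bigl => z; rewrite !in_setD1 andbCA.
Qed.

(** * Wick's theorem for monomials *)

Section Pairings.
Variables (X : finType) (g : X -> 'I_N).
Implicit Types (A : {set X}) (x y z : X).

(** Matchings of [A] are permutations of the whole type, trivial outside [A], so that removing a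
    pair stays in the same type. *)
Definition pairings (A : {set X}) : {set {perm X}} :=
  [set S : {perm X} | [forall z, [&& S (S z) == z, (S z != z) == (z \in A) & g (S z) == g z]]].

Lemma pairingsP A (S : {perm X}) :
  reflect [/\ forall z, S (S z) = z, forall z, (S z != z) = (z \in A) & forall z, g (S z) = g z]
    (S \in pairings A).
Proof.
rewrite in_set; apply: (iffP forallP) => [h|[h1 h2 h3] z].
  by split=> z; case/and3P: (h z) => /eqP ? /eqP ? /eqP.
by rewrite h1 h2 h3 !eqxx.
Qed.

(** The matchings are classified by the partner [y] of [x]; multiplication by [tperm x y] removes
    this pair. *)
Lemma card_pairings_rec A x : x \in A ->
  #|pairings A| = (\sum_(y in A :\ x | g y == g x) #|pairings (A :\ x :\ y)|)%N.
Proof.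
move=> xA; rewrite -sum1_card (partition_big (fun S : {perm X} => S x)
  (fun y => (y \in A :\ x) && (g y == g x))) /=; last first.
  by move=> S /pairingsP[h1 h2 h3]; rewrite in_setD1 h2 xA -h2 h1 eq_sym h2 xA h3 eqxx.
apply: eq_bigr => y /andP[/setD1P[yx yA] /eqP gyx].
rewrite sum1dep_card -[LHS](card_imset _ (@mulIg _ (tperm x y))); apply: eq_card => S.
apply/imsetP/pairingsP => [[S']|[h1 h2 h3]].
  rewrite in_set => /andP[/pairingsP[h1 h2 h3] /eqP S'x] ->.
  have S'y : S' y = x by rewrite -S'x h1.
  have out z : z != x -> z != y -> (S' z != x) && (S' z != y).
    move=> zx zy; apply/andP; split; [rewrite -[X in _ != X]S'y|rewrite -[X in _ != X]S'x];
      by rewrite (inj_eq perm_inj).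
  have E z : (S' * tperm x y)%g z = if (z == x) || (z == y) then z else S' z.
    rewrite permM; case: (eqVneq z x) => [->|zx] /=; first by rewrite S'x tpermR.
    case: (eqVneq z y) => [->|zy] /=; first by rewrite S'y tpermL.
    by case/andP: (out z zx zy) => a b; rewrite tpermD // eq_sym.
  split=> z; rewrite !E.
  - case: (boolP ((z == x) || (z == y))) => [e|]; first by rewrite /= e.
    by rewrite negb_or => /andP[zx zy]; case/andP: (out z zx zy) => /negbTE -> /negbTE -> /=.
  - rewrite !in_setD1; case: ifP => [/orP[]->|]; rewrite ?eqxx ?andbF //.
    by move/negbT; rewrite negb_or => /andP[zx zy]; rewrite zx zy.
  - by case: ifP.
have Sx : S x = x by apply/eqP; have := h2 x; rewrite !in_setD1 eqxx /= andbF => /negbFE.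
have Sy : S y = y by apply/eqP; have := h2 y; rewrite !in_setD1 eqxx /= => /negbFE.
have out z : z != x -> z != y -> (S z != x) && (S z != y).
  move=> zx zy; apply/andP; split; [rewrite -[X in _ != X]Sx|rewrite -[X in _ != X]Sy];
    by rewrite (inj_eq perm_inj).
exists (S * tperm x y)%g; last by rewrite -mulgA tperm2 mulg1.
have E z : (S * tperm x y)%g z = if z == x then y else if z == y then x else S z.
  rewrite permM; case: (eqVneq z x) => [->|zx] /=; first by rewrite Sx tpermL.
  case: (eqVneq z y) => [->|zy] /=; first by rewrite Sy tpermR.
  by case/andP: (out z zx zy) => a b; rewrite tpermD // eq_sym.
rewrite in_set E !eqxx andbT; apply/pairingsP; split=> z; rewrite !E.
- case: (eqVneq z x) => [->|zx]; first by rewrite (negbTE yx) eqxx.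
  case: (eqVneq z y) => [->|zy]; first by rewrite eqxx.
  by case/andP: (out z zx zy) => /negbTE -> /negbTE ->.
- case: (eqVneq z x) => [->|zx]; first by rewrite yx xA.
  case: (eqVneq z y) => [->|zy]; first by rewrite eq_sym yx yA.
  by rewrite h2 !in_setD1 zx zy.
- case: (eqVneq z x) => [->|zx] //; case: (eqVneq z y) => [->|zy] //.
Qed.

(** Integration by parts in the variable of [x] selects a partner with the same label, which is the
    recursion of [card_pairings_rec]. *)
Lemma card_pairings A : #|pairings A|%:R = gauss (\prod_(z in A) 'X_(g z)).
Proof.
move: {2}#|A| (leqnn #|A|) => k; elim: k A => [|k IHk] A.
  rewrite leqn0 cards_eq0 => /eqP ->; rewrite big_set0 gauss1.
  suff -> : pairings set0 = [set 1%g] by rewrite cards1.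
  apply/setP => S; rewrite in_set1; apply/pairingsP/eqP => [[_ h2 _]|->].
    by apply/permP => z; apply/eqP; rewrite perm1; have := h2 z; rewrite in_set0 => /negbFE.
  by split=> z; rewrite !perm1 ?eqxx ?in_set0.
case: (set_0Vmem A) => [->|[x xA]] cA.
  by apply: IHk; rewrite cards0.
have cAx : (#|A :\ x| <= k)%N by move: cA; rewrite (cardsD1 x) xA.
rewrite (card_pairings_rec xA) (big_setD1 x xA) /= gauss_wick mderiv_prod_set gauss_sum natr_sum.
rewrite big_mkcondr /=; apply: eq_bigr => y yA.
rewrite mderivX mnm1E; case: eqP => [e|_]; last by rewrite scale0r mul0r gauss0.
have -> : (U_(g y) - U_(g x) = 0)%MM.
  by rewrite e; apply/mnmP => i; rewrite mnmBE subnn mnm0E.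
rewrite mpolyX0 scale1r mul1r IHk //.
by apply: leq_trans cAx; apply: subset_leq_card; exact: subsetDl.
Qed.

End Pairings.
End Gauss.

(** * A Cayley identity for products of leading minors *)

Section AlternatingSum.
Variables (R : comNzRingType) (n : nat) (U : finType).
Variables (C : U -> R) (F : U -> 'I_n -> 'I_n).
Let Psi (X : 'M[R]_n) := \sum_u C u * \prod_i X i (F u i).

(** For fixed [u] the alternating sum is the determinant of a product, [\det (E u) * \det X]. The
    constant is read off at the identity matrix, whose row permutations are the [perm_mx s]. *)
Lemma alternating_sum (X : 'M[R]_n) :
  \sum_(s : 'S_n) (-1) ^+ s * Psi (row_perm s X) =
  \det X * \sum_(s : 'S_n) (-1) ^+ s * Psi (perm_mx s).
Proof.
pose E (u : U) : 'M[R]_n := \matrix_(i, l) (l == F u i)%:R.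
have key Y : \sum_(s : 'S_n) (-1) ^+ s * Psi (row_perm s Y) = \sum_u C u * (\det (E u) * \det Y).
  under eq_bigr => s _ do rewrite mulr_sumr.
  rewrite exchange_big; apply: eq_bigr => u _ /=.
  rewrite -[\det Y]det_tr -det_mulmx mulr_sumr; apply: eq_bigr => s _.
  rewrite mulrCA; congr (_ * (_ * _)); apply: eq_bigr => i _.
  rewrite !mxE (bigD1 (F u i)) //= !mxE eqxx mul1r big1 ?addr0 // => l ne.
  by rewrite !mxE (negbTE ne) mul0r.
rewrite key mulr_sumr; have := key 1%:M.
have -> : \sum_(s : 'S_n) (-1) ^+ s * Psi (row_perm s 1%:M) =
   \sum_(s : 'S_n) (-1) ^+ s * Psi (perm_mx s) by [].
rewrite -mulr_sumr => ->; rewrite mulr_sumr; apply: eq_bigr => u _.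
by rewrite det1 mulr1 mulrA mulrC.
Qed.

End AlternatingSum.

Lemma det_row0 (R : comNzRingType) n (A : 'M[R]_n) i : (forall l, A i l = 0) -> \det A = 0.
Proof. by move=> h; rewrite (expand_det_row A i) big1 // => l _; rewrite h mul0r. Qed.

Section Cayley.
Variables (n N : nat) (v : 'I_n -> 'I_n -> 'I_N).
Hypothesis v_inj : forall i j k l, v i j = v k l -> i = k /\ j = l.
Local Notation R := {mpoly rat[N]}.

(* [\det (minor_mx m)] is the leading principal minor of order [m] of the generic matrix. *)
Definition minor_mx (m : nat) : 'M[R]_n :=
  \matrix_(i, j) if (i < m)%N then 'X_(v i j) else (i == j)%:R.

Section Factors.
Variables (K : nat) (ms : 'I_K -> nat).
Implicit Types (t : {ffun 'I_n -> option 'I_K}) (X : 'M[R]_n).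

(* [t i = Some j] records that the derivative in row [i] hits the [j]-th minor (this kills it
   unless [i < ms j]); [t i = None] that row [i] is not differentiated. *)
Definition replaced t X j : 'M[R]_n := \matrix_(i, l)
  if t i == Some j then (if (i < ms j)%N then X i l else 0) else minor_mx (ms j) i l.

(** At [X = perm_mx s] this is the product of minors differentiated along the entries [(i, s i)]; at
    a row permutation of [minor_mx r] variables are put back. The last product accounts for the rows
    where the outer minor is the identity. *)
Definition polar t X : R :=
  (\prod_j \det (replaced t X j)) * \prod_(i | t i == None) X i i.

Definition upd t x o : {ffun 'I_n -> option 'I_K} := [ffun i => if i == x then o else t i].

(** Each term uses exactly one entry of every row of [X], in the minor recorded by [t] or on the
    diagonal: the shape required by [alternating_sum]. *)
Lemma polar_multilinear t X : polar t X =
  \sum_(u : {ffun 'I_K -> 'S_n})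
    (\prod_j (-1) ^+ u j * \prod_i (if t i is Some j0 then
        (i < ms j0)%:R * \prod_(j | j != j0) minor_mx (ms j) i (u j i)
      else \prod_j minor_mx (ms j) i (u j i))) *
    \prod_i X i (if t i is Some j0 then u j0 i else i).
Proof.
rewrite /polar bigA_distr_bigA mulr_suml; apply: eq_bigr => u _.
rewrite big_split /= -!mulrA; congr (_ * _).
rewrite exchange_big /= [X in _ * X = _]big_mkcond -!big_split /=.
apply: eq_bigr => i _; case e: (t i) => [j0|] /=.
  rewrite mulr1 (bigD1 j0) //= mxE e eqxx mulrAC [_%:R * _]mulrC -!mulrA.
  case: ifP => _; last by rewrite !mul0r !mulr0.
  rewrite mul1r; congr (_ * _); apply: eq_bigr => j nj.
  by rewrite mxE e (inj_eq (fun a b => @Some_inj _ a b)) eq_sym (negbTE nj).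
by congr (_ * _); apply: eq_bigr => j _; rewrite mxE e.
Qed.

Lemma polar_alternating t X :
  \sum_(s : 'S_n) (-1) ^+ s * polar t (row_perm s X) =
  \det X * \sum_(s : 'S_n) (-1) ^+ s * polar t (perm_mx s).
Proof.
under eq_bigr => s _ do rewrite polar_multilinear.
under [in RHS]eq_bigr => s _ do rewrite polar_multilinear.
exact: alternating_sum.
Qed.

Lemma mderiv_nat (b : nat) k : (b%:R : R)^`M(k) = 0.
Proof. by rewrite -mpolyC_nat mderivC. Qed.

Lemma mderiv_det_row (A : 'M[R]_n) i k :
  (forall l j, l != i -> (A l j)^`M(k) = 0) ->
  (\det A)^`M(k) = \det (\matrix_(l, j) if l == i then (A i j)^`M(k) else A l j).
Proof.
move=> h; rewrite /determinant raddf_sum; apply: eq_bigr => s _ /=.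
have sgE (p : R) : ((-1) ^+ s * p)^`M(k) = (-1) ^+ s * p^`M(k).
  by case: (odd_perm s); rewrite ?expr1 ?expr0 ?mul1r // !mulN1r mderivN.
rewrite sgE; congr (_ * _).
rewrite (eq_bigl (fun l => l \in [set: 'I_n])); last by move=> l; rewrite in_setT.
rewrite mderiv_prod_set (big_setD1 i (in_setT i)) /= [X in _ + X]big1 ?addr0; last first.
  by move=> l /setD1P[li _]; rewrite h // mul0r.
rewrite [RHS](eq_bigl (fun l => l \in [set: 'I_n])); last by move=> l; rewrite in_setT.
rewrite [RHS](big_setD1 i (in_setT i)) /= !mxE eqxx; congr (_ * _).
by apply: eq_bigr => l /setD1P[/negbTE li _]; rewrite mxE li.
Qed.

Lemma mderiv_replaced t (s : 'S_n) i j : t i = None ->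
  (\det (replaced t (perm_mx s) j))^`M(v i (s i)) =
  \det (replaced (upd t i (Some j)) (perm_mx s) j).
Proof.
have vE l a : ('X_(v l a) : R)^`M(v i (s i)) = ((l == i) && (a == s i))%:R.
  rewrite mderivX mnm1E; case: eqP => [/v_inj[-> ->]|ne].
    rewrite !eqxx.
    have -> : (U_(v i (s i)) - U_(v i (s i)) = 0)%MM.
      by apply/mnmP => k; rewrite mnmBE subnn mnm0E.
    by rewrite mpolyX0 scale1r.
  rewrite scale0r; case: andP => // -[/eqP e1 /eqP e2]; case: ne.
  by rewrite e1 e2.
move=> ti; rewrite (mderiv_det_row (i := i)); last first.
  move=> l a li; rewrite !mxE; case: ifP => _; first by case: ifP => _; rewrite ?mderiv_nat ?raddf0.
  by case: ifP => _; rewrite ?mderiv_nat // vE (negbTE li).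
congr (\det _); apply/matrixP => l a; rewrite !mxE ffunE.
case: (eqVneq l i) => [->|li] //.
rewrite ti /= eqxx; case: ifP => _; last by rewrite mderiv_nat.
by rewrite vE eqxx eq_sym.
Qed.

Lemma mderiv_prod_replaced t (s : 'S_n) i : t i = None ->
  (\prod_j \det (replaced t (perm_mx s) j))^`M(v i (s i)) =
  \sum_j0 \prod_j \det (replaced (upd t i (Some j0)) (perm_mx s) j).
Proof.
move=> ti; rewrite (eq_bigl (fun l => l \in [set: 'I_K])); last by move=> l; rewrite in_setT.
rewrite mderiv_prod_set; apply: eq_big => [j|j _]; first by rewrite in_setT.
rewrite mderiv_replaced // [RHS](bigD1 j) //=; congr (_ * _).
apply: eq_big => [k|k]; first by rewrite in_setD1 in_setT andbT.
move=> /setD1P[kj _]; congr (\det _); apply/matrixP => l a; rewrite !mxE ffunE.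
case: (eqVneq l i) => [->|//]; rewrite ti /=.
by have -> : (Some j == Some k) = false by apply/eqP => -[e]; rewrite e eqxx in kj.
Qed.

Definition extensions t (q : seq 'I_n) := [set t' : {ffun 'I_n -> option 'I_K} |
  [forall i, if i \in q then t' i != None else t' i == t i]].

(** The rows of [q] are integrated by parts one at a time. The remaining variables lie in other
    rows, so each derivative acts only on the minors, in a row not yet differentiated. *)
Lemma gauss_wick_rows (s : 'S_n) (q : seq 'I_n) t :
  uniq q -> (forall i, i \in q -> t i = None) ->
  gauss (\prod_(i <- q) 'X_(v i (s i)) * \prod_j \det (replaced t (perm_mx s) j)) =
  \sum_(t' in extensions t q) gauss (\prod_j \det (replaced t' (perm_mx s) j)).
Proof.
elim: q t => [|i q IHq] t /=.
  move=> _ _; rewrite big_nil mul1r.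
  suff -> : extensions t [::] = [set t] by rewrite big_set1.
  apply/setP => t'; rewrite in_set in_set1; apply/forallP/eqP => [h|-> //].
  by apply/ffunP => i; apply/eqP; have := h i.
case/andP => iq uq hq.
have ti : t i = None by apply: hq; rewrite inE eqxx.
rewrite big_cons -mulrA gauss_wick mderivM.
have -> : (\prod_(k <- q) 'X_(v k (s k)) : R)^`M(v i (s i)) = 0.
  elim: (q) iq => [|k l IHl]; first by rewrite big_nil -mpolyC1 mderivC.
  rewrite inE negb_or big_cons mderivM => /andP[ik /IHl ->]; rewrite mulr0 addr0.
  rewrite mderivX mnm1E; case: eqP => [/v_inj[e _]|_]; first by rewrite e eqxx in ik.
  by rewrite scale0r mul0r.
rewrite mul0r add0r mderiv_prod_replaced // mulr_sumr gauss_sum.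
rewrite (partition_big (fun t' : {ffun 'I_n -> option 'I_K} => t' i) (fun o => o != None)) /=; last first.
  move=> t'; rewrite in_set => /forallP/(_ i); rewrite inE eqxx /=.
  by case: (t' i).
rewrite (reindex_omap Some id); last by case.
rewrite [RHS](eq_bigl xpredT); last by move=> j; rewrite /= eqxx.
apply: eq_bigr => j _; rewrite IHq //; last first.
  move=> k kq; rewrite ffunE; case: eqP => [e|_]; first by rewrite -e kq in iq.
  by apply: hq; rewrite inE kq orbT.
apply: eq_bigl => t'; rewrite !in_set; apply/forallP/andP => [h|[/forallP h /eqP e] k].
  split.
    apply/forallP => k; have := h k; rewrite inE ffunE.
    by case: (eqVneq k i) => [->|_] //=; rewrite (negbTE iq) => /eqP ->.
  by have := h i; rewrite (negbTE iq) ffunE eqxx => /eqP ->.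
have := h k; rewrite inE ffunE; case: (eqVneq k i) => [->|_] //= _.
by rewrite (negbTE iq); move: e; case: (t' i) => //= a ->.
Qed.

Definition rows_used r := [set t : {ffun 'I_n -> option 'I_K} |
  [forall i, (t i != None) == (i < r)%N]].

(** In the expansion of the outer minor, the rows below [r] give variables to integrate by parts,
    and the identity rows give the factors [s i == i] found in the last product of [polar]. *)
Lemma gauss_minor r : gauss (\det (minor_mx r) * \prod_j \det (minor_mx (ms j))) =
  gauss (\sum_(t in rows_used r) \sum_(s : 'S_n) (-1) ^+ s * polar t (perm_mx s)).
Proof.
have gsg (s : 'S_n) (p : R) : gauss ((-1) ^+ s * p) = (-1) ^+ s * gauss p.
  by case: (odd_perm s); rewrite ?expr1 ?expr0 ?mul1r // !mulN1r -scaleN1r gaussZ mulN1r.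
rewrite exchange_big gauss_sum /determinant mulr_suml gauss_sum; apply: eq_bigr => s _ /=.
rewrite -mulr_sumr -mulrA !gsg; congr (_ * _).
pose t0 : {ffun 'I_n -> option 'I_K} := [ffun _ => None].
pose q := [seq i : 'I_n <- enum 'I_n | (i < r)%N].
have rep0 j : replaced t0 (perm_mx s) j = minor_mx (ms j).
  by apply/matrixP => i l; rewrite !mxE ffunE.
have ext0 : extensions t0 q = rows_used r.
  apply/setP => t; rewrite !in_set; apply: eq_forallb => i.
  rewrite mem_filter mem_enum andbT ffunE; case: (i < r)%N; by case: (t i).
pose c : rat := \prod_(i : 'I_n | ~~ (i < r)%N) (s i == i)%:R.
have cE : \prod_(i : 'I_n | ~~ (i < r)%N) ((s i == i)%:R : R) = c%:MP.
  by rewrite /c rmorph_prod; apply: eq_bigr => i _; rewrite /= mpolyC_nat.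
have -> : \prod_i minor_mx r i (s i) = c *: \prod_(i <- q) ('X_(v i (s i)) : R).
  rewrite (bigID (fun i : 'I_n => (i < r)%N)) /= mulrC -mul_mpolyC -cE; congr (_ * _).
    by apply: eq_bigr => i /negbTE ir; rewrite mxE ir eq_sym.
  by rewrite /q big_filter big_enum_cond; apply: eq_bigr => i ir; rewrite mxE ir.
have -> : \prod_j \det (minor_mx (ms j)) = \prod_j \det (replaced t0 (perm_mx s) j).
  by apply: eq_bigr => j _; rewrite rep0.
rewrite -scalerAl gaussZ gauss_wick_rows; first last.
- by move=> i _; rewrite ffunE.
- by rewrite filter_uniq ?enum_uniq.
rewrite ext0 gauss_sum mulr_sumr; apply: eq_bigr => t; rewrite in_set => /forallP ht.
rewrite -gaussZ -mul_mpolyC -cE mulrC; congr (gauss (_ * _)).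
apply: eq_big => [i|i _]; last by rewrite !mxE.
by rewrite -(eqP (ht i)) negbK.
Qed.

(** The pairs that survive at [X = minor_mx r]: [s] only permutes rows differentiated in the same
    minor, so each minor is restored up to sign. *)
Definition compatible t (s : 'S_n) :=
  [&& [forall i, if t i is Some j then (i < ms j)%N else true],
      [forall i, t (s i) == t i] & [forall i, (t i == None) ==> (s i == i)]].

Lemma compatibleP t (s : 'S_n) :
  reflect [/\ forall i j, t i = Some j -> (i < ms j)%N, forall i, t (s i) = t i
            & forall i, t i = None -> s i = i] (compatible t s).
Proof.
apply: (iffP and3P) => [[/forallP h1 /forallP h2 /forallP h3]|[h1 h2 h3]].
  split=> [i j e|i|i e]; first by have := h1 i; rewrite e.
    exact/eqP.
  by apply/eqP; have := h3 i; rewrite e.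
split; apply/forallP => i.
- by case e: (t i) => [j|] //; exact: h1 e.
- by rewrite h2.
- by apply/implyP => /eqP /h3 ->.
Qed.

Variable r : nat.
Hypothesis ms_le : forall j, (ms j <= r)%N.

(** Induction on the number of points moved by [s]: splitting off a transposition swaps two rows of
    a single minor, the one [t] assigns to both, and at [s = 1] every differentiated row is back in
    place. *)
Lemma polar_compatible t (s : 'S_n) : t \in rows_used r -> compatible t s ->
  polar t (row_perm s (minor_mx r)) = (-1) ^+ s * \prod_j \det (minor_mx (ms j)).
Proof.
rewrite in_set => /forallP ht.
have ltr (i : 'I_n) : (i < r)%N = (t i != None) by rewrite (eqP (ht i)).
move: {2}#|[set i | s i != i]| (leqnn #|[set i | s i != i]|) => k.
elim: k s => [|k IHk] s cs hs; have [h1 h2 h3] := compatibleP _ _ hs.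
  have -> : s = 1%g.
    apply/permP => i; rewrite perm1; apply/eqP; apply: contraTT cs => si.
    by rewrite -ltnNge card_gt0; apply/set0Pn; exists i; rewrite in_set.
  rewrite odd_perm1 expr0 mul1r row_perm1 /polar [X in _ * X]big1 ?mulr1; last first.
    by move=> i /eqP e; rewrite !mxE ltr e !eqxx.
  apply: eq_bigr => j _; congr (\det _); apply/matrixP => i l; rewrite !mxE.
  case: eqP => // e; rewrite (h1 _ _ e).
  by rewrite ltr e.
have [i|s1] := pickP (fun i => s i != i); last first.
  apply: IHk hs.
  suff -> : #|[set i | s i != i]| = 0%N by [].
  by apply: eq_card0 => i; rewrite in_set s1.
move=> si; pose z := s^-1%g i.
have sz : s z = i by rewrite permKV.
have iz : i != z by apply: contraNneq si => e; rewrite {1}e sz.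
pose s' := (tperm i z * s)%g.
have ss' : s = (tperm i z * s')%g by rewrite mulgA tperm2 mul1g.
have tz : t z = t i by rewrite -(h2 z) sz.
have tt a : t (tperm i z a) = t a by case: tpermP => // ->.
have s'i : s' i = i by rewrite permM tpermL.
have ti : t i <> None by move=> e; case/eqP: si; exact: h3.
have cs' : compatible t s'.
  apply/compatibleP; split=> [||a ta]; first exact: h1.
    by move=> a; rewrite permM h2 tt.
  rewrite permM tpermD ?h3 //; apply/eqP => e; apply: ti; first by rewrite e.
  by rewrite -tz e.
have ks' : (#|[set a | s' a != a]| <= k)%N.
  rewrite -ltnS; apply: leq_trans cs; apply: proper_card; apply/properP; split.
    apply/subsetP => a; rewrite !in_set; apply: contraNneq => sa.
    rewrite permM tpermD ?sa //.
      by apply: contraNneq si => ->; rewrite sa.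
    by apply: contraNneq iz => e; rewrite -sz e sa.
  by exists i; rewrite in_set ?s'i ?eqxx.
have -> : (-1) ^+ s = - (-1) ^+ s' :> R by rewrite ss' odd_permM odd_tperm iz addTb signrN.
rewrite mulNr -(IHk s' ks' cs').
rewrite /polar -mulNr; congr (_ * _); last first.
  apply: eq_bigr => a /eqP ta.
  by have [_ _ h3'] := compatibleP _ _ cs'; rewrite !mxE (h3 _ ta) (h3' _ ta).
case ei: (t i) ti => [j0|//] _.
rewrite (bigD1 j0) //= [in RHS](bigD1 j0) //= -mulNr; congr (_ * _).
  have -> : replaced t (row_perm s (minor_mx r)) j0 =
     row_perm (tperm i z) (replaced t (row_perm s' (minor_mx r)) j0).
    apply/matrixP => a l; rewrite ![LHS]mxE ![RHS]mxE tt.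
    case: eqP => ta.
      rewrite (h1 _ _ ta) (h1 (tperm i z a) j0) ?tt // !mxE ss' permM //.
    rewrite !mxE; rewrite tpermD //; apply/eqP => e; apply: ta; first by rewrite -e.
    by rewrite -e tz.
  by rewrite row_permE det_mulmx det_perm odd_tperm iz expr1 mulN1r.
apply: eq_bigr => j nj; congr (\det _); apply/matrixP => a l; rewrite !mxE.
case: eqP => // ta; case: ifP => // _.
have -> : s a = s' a; last by [].
rewrite permM tpermD //; apply/eqP => e; case/eqP: nj.
  by move: ta; rewrite -e ei => -[].
by move: ta; rewrite -e tz ei => -[].
Qed.

(* A repeated row forces [s] to send each row to one used by the same minor or by a strictly
   larger one; summing the sizes along [s] excludes the latter. *)
Lemma polar_incompatible t (s : 'S_n) : t \in rows_used r -> ~~ compatible t s ->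
  polar t (row_perm s (minor_mx r)) = 0.
Proof.
rewrite in_set => /forallP ht; apply: contraNeq => nz.
have ltr (i : 'I_n) : (i < r)%N = (t i != None) by rewrite (eqP (ht i)).
move: nz; rewrite mulf_eq0 negb_or => /andP[/prodf_neq0 nzd /prodf_neq0 nzN].
have h1 (i : 'I_n) j : t i = Some j -> (i < ms j)%N.
  move=> e; apply: contraTT (nzd j isT) => nij; rewrite negbK; apply/eqP.
  by apply: (det_row0 (i := i)) => l; rewrite mxE e eqxx (negbTE nij).
have step i j : t i = Some j -> t (s i) = Some j \/ (ms j <= s i)%N /\ (s i < r)%N.
  move=> e; case: (eqVneq (t (s i)) (Some j)) => [|ne]; [by left | right].
  apply/andP; apply: contraTT (nzd j isT) => bad; rewrite negbK; apply/eqP.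
  have isi : i != s i by apply: contraNneq ne => <-; rewrite e.
  apply: (determinant_alternate isi) => l.
  rewrite !mxE e eqxx (h1 _ _ e) (negbTE ne).
  case: (ltnP (s i) (ms j)) => [lt|le]; first by rewrite (leq_trans lt).
  by move: bad; rewrite le /= => /negbTE ->.
have some_s i : t i != None -> t (s i) != None.
  case e: (t i) => [j|//] _; case: (step _ _ e) => [-> //|[_ lt]].
  by rewrite -ltr.
(* [s] maps the finite set of used rows into itself, hence onto itself, so it also preserves the
   complement. *)
have none_s i : t i = None -> t (s i) = None.
  move=> e; apply/eqP; apply: contraT => nsi.
  have im : s @: [set a | t a != None] = [set a | t a != None].
    apply/eqP; rewrite eqEcard card_imset ?leqnn ?andbT; last exact: perm_inj.
    by apply/subsetP => b /imsetP[a]; rewrite !in_set => ha ->; exact: some_s.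
  have : s i \in s @: [set a | t a != None] by rewrite im in_set.
  by rewrite mem_imset ?in_set ?e //; exact: perm_inj.
pose h i := if t i is Some j then ms j else 0%N.
have hle i : (h i <= h (s i) ?= iff (t (s i) == t i))%N.
  rewrite /h; case e: (t i) => [j|]; last first.
    by rewrite none_s // eqxx; exact/leqif_refl.
  case: (step _ _ e) => [->|[le lt]]; first by rewrite eqxx; exact/leqif_refl.
  case e': (t (s i)) => [j'|]; last by move: lt; rewrite ltr e'.
  have lt' := leq_ltn_trans le (h1 _ _ e').
  split; first exact: ltnW.
  rewrite (ltn_eqF lt'); apply/esym/negbTE/eqP => -[ej].
  by rewrite ej ltnn in lt'.
have /leqif_sum := fun i (_ : true) => hle i.
move=> [_]; rewrite [X in _ == X](_ : _ = \sum_i h i)%N; last first.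
  by rewrite [RHS](reindex_inj (@perm_inj _ s)).
rewrite eqxx => /esym/forallP h2.
apply/compatibleP; split=> // [i|i e]; first by apply/eqP; have := h2 i.
have := nzN i; rewrite e eqxx => /(_ isT); rewrite !mxE.
have := ltr (s i); rewrite none_s // eqxx => ->.
by case: (s i =P i) => //= _; rewrite mulr0n eqxx.
Qed.

(** Letting the differentiated rows start at [a] instead of 0 permits a downward induction on the
    first row. *)
Definition pairs_from (a : nat) : {set {ffun 'I_n -> option 'I_K} * 'S_n} :=
  [set p : {ffun 'I_n -> option 'I_K} * 'S_n | [forall i : 'I_n, (p.1 i != None) == (a <= i < r)%N] && compatible p.1 p.2].

Hypothesis rn : (r <= n)%N.

Definition weight i := (#|[set j | (i < ms j)%N]| + (r - i.+1))%N.

(* Row [a] is either a new fixed point of the permutation, assigned to any minor containing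
   it, or is inserted in the cycle of a larger row and inherits its minor. *)
Lemma card_pairs_from_step a : (a < r)%N ->
  #|pairs_from a| = (weight a * #|pairs_from a.+1|)%N.
Proof.
move=> ar; have an : (a < n)%N := leq_trans ar rn.
pose x := Ordinal an.
pose choices : {set 'I_K + 'I_n} :=
  [set c : 'I_K + 'I_n | match c with inl j => (a < ms j)%N | inr y => (a < y < r)%N end].
pose ins (q : ({ffun 'I_n -> option 'I_K} * 'S_n) * ('I_K + 'I_n)) :=
  match q.2 with
  | inl j => (upd q.1.1 x (Some j), q.1.2)
  | inr y => (upd q.1.1 x (q.1.1 y), (q.1.2 * tperm x y)%g)
  end.
have card_choices : #|choices| = weight a.
  have -> : choices = (inl @: [set j | (a < ms j)%N]) :|: (inr @: [set y : 'I_n | (a < y < r)%N]).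
    apply/setP => -[j|y]; rewrite in_setU in_set.
      rewrite mem_imset ?in_set; last by move=> ? ? [].
      by case: imsetP => [[y _ //]|_]; rewrite orbF.
    rewrite [X in _ || X]mem_imset ?in_set; last by move=> ? ? [].
    by case: imsetP => [[j _ //]|_].
  rewrite cardsU !card_imset; try by move=> ? ? [].
  have -> : (inl @: [set j | (a < ms j)%N]) :&: (inr @: [set y : 'I_n | (a < y < r)%N]) = set0.
    by apply/setP => c; rewrite in_setI in_set0; apply/negP => /andP[/imsetP[j _ ->] /imsetP[]].
  rewrite cards0 subn0 /weight; congr (_ + _)%N.
  have lt (k : 'I_(r - a.+1)) : (a.+1 + k < n)%N by have := ltn_ord k; lia.
  pose g (k : 'I_(r - a.+1)) := Ordinal (lt k).
  have gi : injective g by move=> k l /(congr1 val) /= /addnI/val_inj.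
  rewrite -[RHS]card_ord -cardsT -(card_imset _ gi); apply: eq_card => y.
  rewrite in_set; apply/idP/imsetP => [/andP[ay yr]|[k _ ->]]; last first.
    by rewrite /=; have := ltn_ord k; lia.
  have hk : (y - a.+1 < r - a.+1)%N by lia.
  by exists (Ordinal hk) => //; apply: val_inj => /=; lia.
have ins_in q : q \in setX (pairs_from a.+1) choices -> ins q \in pairs_from a.
  case: q => -[t s] c; rewrite in_setX in_set => /andP[/andP[/= /forallP dom /compatibleP[h1 h2 h3]]].
  have tx : t x = None by have := dom x; rewrite /= ltnn; case: (t x).
  have sx : s x = x := h3 _ tx.
  have domx (o : option 'I_K) : o != None ->
      [forall i : 'I_n, (upd t x o i != None) == (a <= i < r)%N].
    move=> o1; apply/forallP => i; rewrite ffunE; case: (eqVneq i x) => [->|ix].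
      by rewrite o1 leqnn ar.
    rewrite (eqP (dom i)); apply/eqP; congr (_ && _).
    by rewrite ltn_neqAle; case: eqP => //= e; case/eqP: ix; apply: val_inj.
  rewrite in_set; case: c => [j|y] hc.
    rewrite /ins in_set /= domx //=; apply/compatibleP; split=> [i k|i|i]; rewrite !ffunE.
    - by case: eqP => [-> [<-] //|_]; exact: h1.
    - case: (eqVneq i x) => [->|ix]; first by rewrite sx eqxx.
      by rewrite -{1}sx (inj_eq perm_inj) (negbTE ix).
    - by case: eqP => // _; exact: h3.
  have yx : y != x by apply: contraTneq hc => ->; rewrite /= ltnn.
  have ty : t y != None by rewrite (eqP (dom y)).
  rewrite /ins in_set /= domx //=; apply/compatibleP; split=> [i k|i|i]; rewrite !ffunE.
  - case: eqP => [-> e|_]; last exact: h1.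
    by case/andP: hc => ay _; apply: ltn_trans ay (h1 _ _ e).
  - rewrite permM; case: (eqVneq i x) => [->|ix]; first by rewrite sx tpermL (negbTE yx).
    have six : s i != x by rewrite -{1}sx (inj_eq perm_inj).
    case: tpermP => [e|e|_ _].
    + by rewrite e eqxx in six.
    + by rewrite eqxx -(h2 i) e.
    + by rewrite (negbTE six) h2.
  - case: (eqVneq i x) => [->|ix e]; first by move/eqP; rewrite (negbTE ty).
    rewrite permM h3 // tpermD //; first by rewrite eq_sym.
    by apply: contraNneq ty => ->; rewrite e.
have ins_inj : {in setX (pairs_from a.+1) choices &, injective ins}.
  move=> [[t s] c] [[t' s'] c']; rewrite !in_setX !in_set /=.
  case/andP=> /andP[/forallP dom /compatibleP[_ _ h3]] hc.
  case/andP=> /andP[/forallP dom' /compatibleP[_ _ h3']] hc'.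
  have tx : t x = None by have := dom x; rewrite /= ltnn; case: (t x).
  have tx' : t' x = None by have := dom' x; rewrite /= ltnn; case: (t' x).
  have sx := h3 _ tx; have sx' := h3' _ tx'.
  have updE o o' : upd t x o = upd t' x o' -> t = t' /\ o = o'.
    move/ffunP => e; split; last by have := e x; rewrite !ffunE eqxx.
    apply/ffunP => i; case: (eqVneq i x) => [->|ix]; first by rewrite tx.
    by have := e i; rewrite !ffunE (negbTE ix).
  have neq (y : 'I_n) : (a < y < r)%N -> y <> x by move=> h e; rewrite e /= ltnn in h.
  rewrite /ins /=; case: c hc => [j|y] hc; case: c' hc' => [j'|y'] hc' [] /updE[<- e].
  - by move=> <-; case: e => ->.
  - by move=> es; have := sx; rewrite es permM sx' tpermL => /neq; case.
  - by move=> es; have := sx'; rewrite -es permM sx tpermL => /neq; case.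
  - move=> es; have yy : y = y'.
      by have := congr1 (fun p : 'S_n => p x) es; rewrite /= !permM sx sx' !tpermL.
    by rewrite -yy in es *; move/mulIg: es => ->.
rewrite -card_choices mulnC -cardsX -(card_in_imset ins_inj); apply: eq_card => -[t s].
apply/idP/imsetP => [|[q hq ->]]; last exact: ins_in.
rewrite in_set /= => /andP[/forallP dom /compatibleP[h1 h2 h3]].
have tx : t x != None by rewrite (eqP (dom x)) leqnn ar.
have dom' : [forall i : 'I_n, (upd t x None i != None) == (a.+1 <= i < r)%N].
  apply/forallP => i; rewrite ffunE; case: (eqVneq i x) => [->|ix]; first by rewrite /= ltnn.
  rewrite (eqP (dom i)); apply/eqP; congr (_ && _).
  by rewrite [RHS]ltn_neqAle; case: eqP => //= e; case/eqP: ix; apply: val_inj.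
case: (eqVneq (s x) x) => [sx|sx].
  case etx: (t x) tx => [j|//] _.
  exists ((upd t x None, s), inl j); last first.
    by rewrite /ins /=; congr (_, _); apply/ffunP => i; rewrite !ffunE; case: eqP => // ->.
  rewrite in_setX !in_set /= dom' (h1 _ _ etx) andbT; apply/compatibleP; split=> [i k|i|i]; rewrite !ffunE.
  - by case: eqP => // _; exact: h1.
  - case: (eqVneq i x) => [->|ix]; first by rewrite sx eqxx.
    by rewrite -{1}sx (inj_eq perm_inj) (negbTE ix).
  - by case: eqP => [->|_] //; exact: h3.
exists ((upd t x None, (s * tperm x (s x))%g), inr (s x)); last first.
  rewrite /ins /=; congr (_, _); last by rewrite -mulgA tperm2 mulg1.
  by apply/ffunP => i; rewrite !ffunE (negbTE sx) h2; case: eqP => // ->.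
rewrite in_setX !in_set /= dom' /=; apply/andP; split; last first.
  have : t (s x) != None by rewrite h2.
  rewrite (eqP (dom (s x))) => /andP[le ->]; rewrite andbT ltn_neqAle le andbT.
  by apply: contraNneq sx => e; apply/eqP/val_inj.
apply/compatibleP; split=> [i k|i|i]; rewrite !ffunE.
- by case: eqP => // _; exact: h1.
- rewrite permM; case: (eqVneq i x) => [->|ix]; first by rewrite tpermR eqxx.
  case: tpermP => [e|e|/eqP ne _].
  + by rewrite (negbTE sx) h2 -(h2 i) e.
  + by move/perm_inj: e ix => ->; rewrite eqxx.
  + by rewrite (negbTE ne) h2.
- case: (eqVneq i x) => [->|ix e]; first by rewrite permM tpermR.
  rewrite permM (h3 _ e) tpermD //; first by rewrite eq_sym.
  by apply: contraNneq tx => h; rewrite -h2 h e.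
Qed.

Lemma card_pairs : #|pairs_from 0| = (\prod_(0 <= i < r) weight i)%N.
Proof.
have H a : (a <= r)%N -> #|pairs_from a| = (\prod_(a <= i < r) weight i)%N.
  move=> ar; rewrite -(subKn ar); move: (r - a)%N (leq_subr a r) => d.
  elim: d => [|d IHd] dr.
    rewrite subn0 big_geq //.
    suff -> : pairs_from r = [set ([ffun _ => None], 1%g)] by rewrite cards1.
    apply/setP => -[t s]; rewrite in_set in_set1 /=; apply/andP/eqP => [[/forallP h]|[-> ->]].
      have tn i : t i = None.
        have := h i; case: (t i) => //= j; rewrite leqNgt.
        by case: (i < r)%N.
      case/compatibleP => _ _ h3; congr (_, _); first by apply/ffunP => i; rewrite ffunE tn.
      by apply/permP => i; rewrite perm1 h3.
    split; last by apply/compatibleP; split=> [i j|i|i]; rewrite ?ffunE ?perm1.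
    apply/forallP => i; rewrite ffunE /=; rewrite leqNgt; by case: (i < r)%N.
  have lt : (r - d.+1 < r)%N by lia.
  have e : (r - d.+1).+1 = (r - d)%N by lia.
  rewrite card_pairs_from_step // e IHd ?(ltnW dr) // [RHS]big_ltn // e //.
exact: H.
Qed.

(** Seen by specializing the generic matrix to the identity. In [cayley] both sides are compared
    after multiplication by this minor, which is then cancelled. *)
Lemma minor_neq0 m : \det (minor_mx m) != 0.
Proof.
pose e k : rat := [exists i, k == v i i]%:R.
have ev i j : e (v i j) = (i == j)%:R.
  rewrite /e; congr (nat_of_bool _)%:R; apply/existsP/eqP => [[k /eqP/v_inj[-> ->]]|->] //.
  by exists j.
apply/eqP => /(congr1 (meval e)); rewrite -det_map_mx rmorph0.
suff -> : map_mx (meval e) (minor_mx m) = 1%:M by rewrite det1 => /eqP; rewrite oner_eq0.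
apply/matrixP => i j; rewrite !mxE; case: ifP => _; first by rewrite mevalXU ev.
by rewrite rmorph_nat.
Qed.

(* Wick's formula turns the outer minor into [det(d)], and [det(X) det(d)] multiplies a product
   of leading minors by a constant. *)
Lemma cayley Q : \prod_j \det (minor_mx (ms j)) = \det (minor_mx r) * Q ->
  gauss (\det (minor_mx r) * (\det (minor_mx r) * Q)) =
  (\prod_(0 <= i < r) weight i)%:R * gauss Q.
Proof.
move=> eQ; rewrite -eQ gauss_minor -gaussZ; congr gauss.
apply: (mulfI (minor_neq0 r)).
rewrite mulr_sumr.
rewrite (eq_bigr (fun t => \sum_(s : 'S_n) (-1) ^+ s * polar t (row_perm s (minor_mx r))));
  last by move=> t _; rewrite polar_alternating.
transitivity (\sum_(p in pairs_from 0) \prod_j \det (minor_mx (ms j))); last first.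
  by rewrite sumr_const card_pairs eQ -scalerAr scaler_nat.
rewrite pair_big_dep /= (bigID (fun p => compatible p.1 p.2)) /= [X in _ + X]big1 ?addr0; last first.
  by move=> [t s] /= /andP[/andP[ht _] hc]; rewrite polar_incompatible ?mulr0.
apply: eq_big => [[t s]|[t s]] /=.
  by rewrite !in_set /= andbT; congr (_ && _).
by move=> /andP[/andP[ht _] hc]; rewrite polar_compatible // signrMK.
Qed.

End Factors.

(** One minor of order [r] is integrated by parts against all the others, namely one of order [r]
    and two for each member of [cs]; hence row [i] lies in [1 + 2 * count] of them. *)
Lemma gauss_columns r (cs : seq nat) : (r <= n)%N -> all (fun m => m <= r)%N cs ->
  gauss (\prod_(m <- r :: cs) \det (minor_mx m) ^+ 2) =
  (\prod_(0 <= i < r) (2 * count (fun m => i < m)%N cs + (r - i.+1) + 1))%:R *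
  gauss (\prod_(m <- cs) \det (minor_mx m) ^+ 2).
Proof.
move=> rn hcs; pose l := r :: cs ++ cs; pose ms (j : 'I_(size l)) := nth 0%N l j.
have ms_le j : (ms j <= r)%N.
  have : ms j \in l by exact: mem_nth.
  by rewrite inE mem_cat orbb => /orP[/eqP->|/(allP hcs)].
have prodl : \prod_j \det (minor_mx (ms j)) =
    \det (minor_mx r) * \prod_(m <- cs) \det (minor_mx m) ^+ 2.
  transitivity (\prod_(m <- l) \det (minor_mx m)).
    by rewrite [RHS](big_nth 0%N) big_mkord.
  by rewrite /l big_cons big_cat /= -big_split; congr (_ * _); apply: eq_bigr.
rewrite big_cons expr2 -mulrA (cayley ms_le rn prodl); congr (_%:R * _).
apply: eq_big_nat => i /andP[_ ir]; rewrite /weight.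
have -> : #|[set j | (i < ms j)%N]| = count (fun m => i < m)%N l.
  by rewrite -sum1_count [RHS](big_nth 0%N) big_mkord sum1dep_card.
by rewrite /l /= count_cat ir; lia.
Qed.

End Cayley.

(** * The leading coefficient *)

Lemma conjpart_at_gt lam i j : is_part lam -> (i < conjpart_at lam j)%N = (j < nth 0 lam i)%N.
Proof.
case/andP => so _; rewrite /conjpart_at.
elim: lam so i => [|a l IHl] /= so i; first by rewrite nth_nil.
have sl : sorted geq l by exact: path_sorted so.
case: (ltnP j a) => ja; first by case: i => [|i] //=; rewrite add1n ltnS IHl.
have /allP hl := order_path_min geq_trans so.
have -> : count (fun b => (j < b)%N) l = 0%N.
  by apply/eqP; rewrite -leqn0 leqNgt -has_count; apply/hasPn => b /hl /= ba; rewrite -leqNgt (leq_trans ba).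
rewrite addn0 ltn0; apply/esym/negbTE; rewrite -leqNgt; case: i => [|i] //=.
case: (ltnP i (size l)) => h; last by rewrite nth_default.
by apply: leq_trans ja; apply: hl; exact: mem_nth.
Qed.

Section Leading.
Variables (n : nat) (lam : seq nat).
Hypotheses (lam_part : is_part lam) (lam_sum : sumn lam = n).
Local Notation cell := (dcell n lam).
Local Notation cl := (conjpart_at lam).

Let v (i j : 'I_n) : 'I_#|{: 'I_n * 'I_n}| := enum_rank (i, j).

Lemma v_inj i j k l : v i j = v k l -> i = k /\ j = l.
Proof. by move/enum_rank_inj => -[-> ->]. Qed.

Lemma row_lt_column (x : cell) : (row x < cl (col x))%N.
Proof. by rewrite conjpart_at_gt //; exact: (valP x). Qed.

Lemma column_cell (p : 'I_n * bool) (i : 'I_n) : (i < cl p.1)%N ->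
  exists x : cell, [/\ row x = i, col x = p.1 & half x = p.2].
Proof.
rewrite conjpart_at_gt // => h.
by exists (exist _ ((i, p.1), p.2) h : cell).
Qed.

(** Row pairings that respect [c] match cells carrying the same variable, indexed by row and value,
    so [card_pairings] applies to the set of all cells. *)
Lemma Rcount_gauss (c : {ffun cell -> 'I_n}) :
  (Rcount c)%:R = gauss (\prod_x 'X_(v (row x) (c x))).
Proof.
rewrite (eq_bigl (fun x => x \in [set: cell])); last by move=> x; rewrite in_setT.
rewrite -card_pairings /Rcount; congr (_%:R); apply: eq_card => S.
rewrite in_set; apply/idP/pairingsP => [/andP[/row_admP[ppS hr] /forallP hc]|[h1 h2 h3]].
  split=> x; first exact: ppK.
    by rewrite in_setT pp_neq.
  by rewrite hr (eqP (hc x)).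
apply/andP; split.
  apply/row_admP; split; last by move=> x; case: (v_inj (h3 x)).
  by apply/forallP => x; rewrite h1 eqxx h2 in_setT.
by apply/forallP => x; case: (v_inj (h3 x)) => _ ->.
Qed.

(** * Fillings given by permutations of the half-columns *)

Definition colperms := {ffun 'I_n * bool -> 'S_n}.

(** Permutations of all [n] rows that fix those below the column: these are the terms left in the
    expansion of [\det (minor_mx v (cl j))], whose lower rows are those of the identity. *)
Definition col_stable : {set colperms} :=
  [set u : colperms | [forall p : 'I_n * bool, [forall i : 'I_n, (cl p.1 <= i)%N ==> (u p i == i)]]].

Lemma col_stableP (u : colperms) :
  reflect (forall (p : 'I_n * bool) (i : 'I_n), (cl p.1 <= i)%N -> u p i = i) (u \in col_stable).
Proof.
rewrite in_set; apply: (iffP forallP) => h p.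
  by move=> i hi; have /forallP/(_ i) := h p; rewrite hi => /eqP.
by apply/forallP => i; apply/implyP => /h ->.
Qed.

Definition filling (u : colperms) : {ffun cell -> 'I_n} := [ffun x => u (col x, half x) (row x)].

Lemma col_stable_lt (u : colperms) (p : 'I_n * bool) (i : 'I_n) : u \in col_stable -> (u p i < cl p.1)%N = (i < cl p.1)%N.
Proof.
move=> /col_stableP hu; case: (ltnP i (cl p.1)) => hi; last by rewrite hu // ltnNge hi.
rewrite ltnNge; apply/negP => h; have := hu p _ h => /perm_inj e.
by move: hi; rewrite -e ltnNge h.
Qed.

Lemma sg_flip : @sg n lam (flip n lam) = 1.
Proof.
have := loop_sign (pp_flip n lam) (pp_flip n lam) (@half_flip n lam) (@half_flip n lam)
  (card_cell lam_part lam_sum).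
rewrite /sg => ->.
suff -> : restr_perm [set x | ~~ half x] (flip n lam * flip n lam) = 1%g by rewrite odd_perm1.
apply/permP => x; rewrite perm1; case: (boolP (half x)) => hx.
  exact: (restr_mul_out _ _ hx).
by rewrite (restr_mul_in (@half_flip n lam) (@half_flip n lam) hx) (ppK (pp_flip n lam)).
Qed.

(** A column pair-partition that also preserves rows can only exchange the halves of each box. *)
Lemma Dsum_row : Dsum [ffun x : cell => row x] = 1.
Proof.
rewrite /Dsum (bigD1 (flip n lam)) /=.
  rewrite sg_flip big1 ?addr0 // => S /andP[/andP[/col_admP[_ hc hh] /forallP hr] ne].
  case/eqP: ne; apply/permP => x; apply: cell_eq.
  - by have /eqP := hr x; rewrite !ffunE row_flip.
  - by rewrite hc col_flip.
  - by rewrite hh half_flip.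
apply/andP; split.
  apply/col_admP; split; [exact: pp_flip|exact: col_flip|exact: half_flip].
by apply/forallP => x; rewrite !ffunE row_flip.
Qed.

(** Induction on the number of cells whose entry differs from their row: a transposition within a
    half-column puts one entry in place and changes the sign of both sides. *)
Lemma Dsum_filling (u : colperms) : u \in col_stable -> Dsum (filling u) = \prod_p (-1) ^+ u p.
Proof.
move: {2}#|[set x | filling u x != row x]| (leqnn #|[set x | filling u x != row x]|) => k.
elim: k u => [|k IHk] u cu hu; have /col_stableP hu' := hu.
  have fE x : filling u x = row x.
    apply/eqP; apply: contraTT cu => nx; rewrite -ltnNge card_gt0.
    by apply/set0Pn; exists x; rewrite in_set.
  have -> : filling u = [ffun x => row x] by apply/ffunP => x; rewrite fE ffunE.
  rewrite Dsum_row big1 // => p _.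
  suff -> : u p = 1%g by rewrite odd_perm1.
  apply/permP => i; rewrite perm1; case: (ltnP i (cl p.1)) => hi; last exact: hu'.
  have [x [rx cx hx]] := column_cell hi.
  by have := fE x; rewrite ffunE rx cx hx; case: (p).
case: (pickP (fun x => filling u x != row x)) => [x nx|fE]; last first.
  apply: IHk hu; suff -> : #|[set x | filling u x != row x]| = 0%N by [].
  by apply: eq_card0 => x; rewrite in_set fE.
pose p := (col x, half x); pose z := (u p)^-1%g (row x).
have uz : u p z = row x by rewrite permKV.
have zlt : (z < cl p.1)%N by rewrite -(col_stable_lt p z hu) uz row_lt_column.
have [y [ry cy hy]] := column_cell zlt.
have zx : z != row x by apply: contraNneq nx => e; rewrite ffunE -/p -{1}e uz.
have xy : x != y by apply: contraNneq zx => ->; rewrite ry.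
pose u' : colperms := [ffun p' => if p' == p then (tperm (row x) z * u p)%g else u p'].
have hu2 : u' \in col_stable.
  apply/col_stableP => p' i hi; rewrite ffunE; case: eqP hi => [->|_] hi; last exact: hu'.
  rewrite permM tpermD ?hu' //; apply: contraTneq hi => <-; rewrite -ltnNge //.
  exact: row_lt_column.
have fu' : filling u' = [ffun w => filling u (tperm x y w)].
  apply/ffunP => w; rewrite !ffunE xpair_eqE.
  case: tpermP => [->|->|wx wy].
  - by rewrite !eqxx /= permM tpermL cy hy ry.
  - by rewrite cy hy !eqxx /= permM ry tpermR.
  - case: andP => // -[/eqP cw /eqP hw]; rewrite permM tpermD ?cw ?hw //.
      by apply/eqP => e; apply: wx; apply: cell_eq.
    by apply/eqP => e; apply: wy; apply: cell_eq; rewrite ?ry ?cy ?hy.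
have ku' : (#|[set x | filling u' x != row x]| <= k)%N.
  rewrite -ltnS; apply: leq_trans cu; apply: proper_card; apply/properP; split.
    apply/subsetP => w; rewrite !in_set; apply: contraNneq => fw; rewrite fu' ffunE.
    case: tpermP => [e|e|_ _]; last by rewrite fw.
      by move: nx; rewrite -e fw eqxx.
    exfalso; move: fw; rewrite e ffunE cy hy ry uz => e'.
    by move: zx; rewrite e' eqxx.
  exists x; rewrite in_set // negbK fu' ffunE tpermL ffunE cy hy ry.
  by rewrite uz.
have := IHk u' ku' hu2; rewrite fu' (Dsum_tperm lam_part lam_sum _ xy) ?cy ?hy // => e.
apply: oppr_inj; rewrite e (bigD1 p) //= [in RHS](bigD1 p) //= ffunE eqxx.
rewrite odd_permM odd_tperm eq_sym zx addTb signrN mulNr; congr (- (_ * _)).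
by apply: eq_bigr => p' /negbTE ne; rewrite ffunE ne.
Qed.

(** Moving each cell within its half-column to the row named by its entry permutes the cells, so the
    value [a] occurs as often as row [a] has cells. *)
Lemma content_filling (u : colperms) : u \in col_stable -> content (filling u) = mono n lam.
Proof.
move=> hu; have nz : Dsum (filling u) != 0.
  by rewrite Dsum_filling //; apply/prodf_neq0 => p _; rewrite signr_eq0.
apply/mnmP => a; rewrite mnmE; apply/eqP.
rewrite -(eqn_pmul2l (isT : (0 < 2)%N)) -(card_value a nz) -(card_row lam_sum a).
have lt (x : cell) : in_diag lam (val (filling u x), val (col x)).
  have := row_lt_column x; rewrite -(col_stable_lt (col x, half x) (row x) hu) /=.
  by rewrite conjpart_at_gt // ffunE.
pose w (x : cell) : cell := exist _ ((filling u x, col x), half x) (lt x).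
have wi : injective w.
  move=> x y e; have ec : col x = col y by exact: (congr1 (@col n lam) e).
  have eh : half x = half y by exact: (congr1 (@half n lam) e).
  have er : filling u x = filling u y by exact: (congr1 (@row n lam) e).
  by move: er; rewrite !ffunE ec eh => /perm_inj er; exact: cell_eq.
have [w' wK w'K] := injF_bij wi.
rewrite -(card_imset _ wi); apply/eqP; apply: eq_card => y.
by rewrite -[y]w'K mem_imset // !in_set.
Qed.

Lemma filling_inj : {in col_stable &, injective filling}.
Proof.
move=> u u' /col_stableP hu /col_stableP hu' /ffunP e; apply/ffunP => p; apply/permP => i.
case: (ltnP i (cl p.1)) => hi; last by rewrite hu // hu'.
have [x [rx cx hx]] := column_cell hi.
by have := e x; rewrite !ffunE rx cx hx; case: (p).
Qed.

(** In each half-column at most as many values as rows are below [i], and the totals agree because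
    the content is [lam]; so equality holds everywhere. With [i] the length of the column of [x],
    all its rows are below [i], hence all its values. *)
Lemma column_values (c : {ffun cell -> 'I_n}) (x : cell) : Dsum c != 0 -> content c = mono n lam -> (c x < cl (col x))%N.
Proof.
move=> nz ec; set i := cl (col x).
have le (p : 'I_n * bool) : (#|column [set y : cell | c y < i]%N p.1 p.2| <=
             #|column [set y : cell | row y < i]%N p.1 p.2|)%N.
  by apply: (card_column_rows_lt lam_part); exact: card_column_values_lt.
have eq : (\sum_(p : 'I_n * bool) #|column [set y : cell | c y < i]%N p.1 p.2| =
           \sum_(p : 'I_n * bool) #|column [set y : cell | row y < i]%N p.1 p.2|)%N.
  rewrite -!card_columns (card_values_lt i lam_part lam_sum nz ec).
  by rewrite (card_rows_lt lam_part lam_sum).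
pose p := (col x, half x).
have ep : #|column [set y : cell | c y < i]%N p.1 p.2| = #|column [set y : cell | row y < i]%N p.1 p.2|.
  apply/eqP; rewrite eqn_leq le /=.
  have : (\sum_(p' | p' != p) #|column [set y : cell | c y < i]%N p'.1 p'.2| <=
    \sum_(p' | p' != p) #|column [set y : cell | row y < i]%N p'.1 p'.2|)%N by apply: leq_sum.
  move: eq; rewrite (bigD1 p) //= [X in _ = X -> _](bigD1 p) //=.
  lia.
have full : column [set y : cell | (row y < i)%N] p.1 p.2 = column [set: cell] p.1 p.2.
  apply/setP => y; rewrite !in_set; apply/andP/andP => -[h1 /andP[h2 h3]]; split=> //; rewrite ?h2 //.
  have e : col y = col x := eqP h2.
  by rewrite /i -e; exact: row_lt_column.
have sub : column [set y : cell | (c y < i)%N] p.1 p.2 \subset column [set: cell] p.1 p.2.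
  by apply/subsetP => y; rewrite !in_set => /andP[_ ->].
have /setP/(_ x) : column [set y : cell | (c y < i)%N] p.1 p.2 = column [set: cell] p.1 p.2.
  by apply/eqP; rewrite eqEcard sub -full ep leqnn.
by rewrite !in_set !eqxx /= !andbT => ->.
Qed.

Lemma filling_surj (c : {ffun cell -> 'I_n}) : Dsum c != 0 -> content c = mono n lam ->
  exists2 u, u \in col_stable & c = filling u.
Proof.
move=> nz ec.
pose f (p : 'I_n * bool) (i : 'I_n) : 'I_n :=
  if [pick x : cell | [&& row x == i, col x == p.1 & half x == p.2]] is Some x then c x else i.
have fE (x : cell) : f (col x, half x) (row x) = c x.
  rewrite /f; case: pickP => [y /and3P[/eqP e1 /eqP e2 /eqP e3]|/(_ x)]; last by rewrite !eqxx.
  by rewrite (cell_eq e1 e2 e3).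
have f_out (p : 'I_n * bool) (i : 'I_n) : (cl p.1 <= i)%N -> f p i = i.
  rewrite /f => h; case: pickP => // x /and3P[/eqP e1 /eqP e2 _].
  by have := row_lt_column x; rewrite e1 e2 ltnNge h.
have f_lt (p : 'I_n * bool) (i : 'I_n) : (i < cl p.1)%N -> (f p i < cl p.1)%N.
  move=> hi; have [x [rx cx hx]] := column_cell hi.
  have -> : f p i = c x by rewrite -(fE x) rx cx hx; case: (p).
  by rewrite -cx; exact: column_values.
have f_inj p : injective (f p).
  move=> i k; case: (ltnP i (cl p.1)) => hi; case: (ltnP k (cl p.1)) => hk.
  - have [x [rx cx hx]] := column_cell hi; have [y [ry cy hy]] := column_cell hk.
    have pE : p = (col x, half x) by rewrite cx hx; case: (p).
    rewrite {1}pE -rx fE.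
    have -> : f p k = c y by rewrite -(fE y) ry cy hy; case: (p).
    by move=> e; rewrite -ry (Dsum_inj lam_part lam_sum nz _ _ e) ?cx ?cy ?hx ?hy.
  - by rewrite (f_out p k) // => e; have := f_lt p i hi; rewrite e ltnNge hk.
  - by rewrite (f_out p i) // => e; have := f_lt p k hk; rewrite -e ltnNge hi.
  - by rewrite !f_out.
exists [ffun p => perm (f_inj p)].
  by apply/col_stableP => p i hi; rewrite ffunE permE f_out.
by apply/ffunP => x; rewrite !ffunE permE fE.
Qed.

(** The determinants are expanded together. Families outside [col_stable] meet a zero in an identity
    row; the others are exactly the contributing fillings, with [Dsum] as sign and [Rcount] as
    Gaussian moment. *)
Lemma ypoly_leading_gauss :
  (ypoly n lam)@_(mono n lam) = gauss (\prod_(p : 'I_n * bool) \det (minor_mx v (cl p.1))).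
Proof.
have gsg (s : bool) (p : {mpoly rat[_]}) : gauss ((-1) ^+ s * p) = (-1) ^+ s * gauss p.
  by case: s; rewrite ?expr1 ?expr0 ?mul1r // !mulN1r -scaleN1r gaussZ mulN1r.
have gsgs (u : colperms) (p : {mpoly rat[_]}) :
   gauss (\prod_q (-1) ^+ u q * p) = \prod_q (-1) ^+ u q * gauss p.
  elim/big_rec2: _ => [|q a b _ IH]; first by rewrite !mul1r.
  by rewrite -!mulrA gsg IH.
rewrite (mcoeff_ypoly lam_part lam_sum) /determinant bigA_distr_bigA /= gauss_sum.
transitivity (\sum_(c in filling @: col_stable) Dsum c * (Rcount c)%:R).
  rewrite big_mkcond [RHS]big_mkcond; apply: eq_bigr => c _.
  case: imsetP => [[u hu ->]|nim]; first by rewrite content_filling // eqxx.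
  case: eqP => // ec; case: (eqVneq (Dsum c) 0) => [->|nz]; first by rewrite mul0r.
  by case: nim; have [u hu e] := filling_surj nz ec; exists u.
rewrite (big_imset _ filling_inj) /= big_mkcond; apply: eq_bigr => u _.
rewrite big_split /= gsgs; case: ifP => [hu|/negbT].
  rewrite Dsum_filling // Rcount_gauss; congr (_ * gauss _).
  rewrite pair_big_dep /=.
  rewrite (bigID (fun pi : ('I_n * bool) * 'I_n => (pi.2 < cl pi.1.1)%N)) /=.
  rewrite [X in _ = _ * X]big1 ?mulr1; last first.
    move=> [p i] /=; rewrite -leqNgt mxE ltnNge => h; rewrite h /=.
    by have /col_stableP -> := hu; rewrite ?eqxx.
  pose h (x : cell) : ('I_n * bool) * 'I_n := ((col x, half x), row x).
  have hi : {in [set: cell] &, injective h} by move=> x y _ _ [] *; exact: cell_eq.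
  rewrite [RHS](eq_bigl (fun q => q \in h @: [set: cell])); last first.
    move=> [p i] /=; apply/idP/imsetP => [hi'|[x _ [-> ->]]]; last exact: (row_lt_column x).
    have [x [rx cx hx]] := column_cell hi'.
    exists x; first by rewrite in_setT.
    by rewrite /h rx cx hx; case: (p).
  rewrite (big_imset _ hi) /= [RHS](eq_bigl xpredT); last by move=> x; rewrite in_setT.
  by apply: eq_bigr => x _; rewrite mxE /= row_lt_column ffunE.
move=> hu; have [p [i [le ne]]] : exists p : 'I_n * bool, exists i : 'I_n, (cl p.1 <= i)%N /\ u p i != i.
  move: hu; rewrite in_set negb_forall => /existsP[p]; rewrite negb_forall => /existsP[i].
  by rewrite negb_imply => /andP[h1 h2]; exists p, i.
suff -> : \prod_(q : 'I_n * bool) \prod_i minor_mx v (cl q.1) i (u q i) = 0 by rewrite gauss0 mulr0.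
rewrite (bigD1 p) //= (bigD1 i) //= mxE ltnNge le /= eq_sym (negbTE ne).
by rewrite !mul0r.
Qed.

Definition column_lengths := [seq cl j | j <- iota 0 n].

Lemma gauss_column_seq (cs : seq nat) : sorted geq cs -> all (fun m => m <= n)%N cs ->
  gauss (\prod_(m <- cs) \det (minor_mx v m) ^+ 2) =
  (\prod_(0 <= j < size cs) \prod_(0 <= i < nth 0 cs j)
    (2 * count (fun m => i < m) (drop j.+1 cs) + (nth 0 cs j - i.+1) + 1))%N%:R.
Proof.
elim: cs => [|r cs IHcs] /=; first by rewrite !big_nil gauss1.
move=> so /andP[rn csn].
have lr : all (fun m => m <= r)%N cs by exact: (order_path_min geq_trans so).
rewrite (gauss_columns v_inj rn lr) IHcs ?(path_sorted so) //.
by rewrite -natrM big_nat_recl //= drop0.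
Qed.

(** For the box in row [i] and column [j], the later columns reaching row [i] number
    [lam_i - j - 1], its arm, and [cl j - i - 1] is its leg. The weights of [gauss_column_seq] are
    thus the hook factors at [alpha = 2], listed by columns. *)
Lemma ypoly_leading : (ypoly n lam)@_(mono n lam) = hookc 2 lam.
Proof.
have szn : (size lam <= n)%N.
  by rewrite -[X in (_ <= X)%N]lam_sum size_leq_sumn //; case/andP: lam_part.
have lamn i : (nth 0 lam i <= n)%N by rewrite -[X in (_ <= X)%N]lam_sum nth_leq_sumn.
have cl_le j : (cl j <= size lam)%N by exact: count_size.
have -> : (ypoly n lam)@_(mono n lam) = gauss (\prod_(m <- column_lengths) \det (minor_mx v m) ^+ 2).
  rewrite ypoly_leading_gauss; congr gauss.
  rewrite -(pair_big predT predT (fun (j : 'I_n) (_ : bool) => \det (minor_mx v (cl j)))) /=.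
  rewrite /column_lengths big_map; have -> : iota 0 n = index_iota 0 n by rewrite /index_iota subn0.
  rewrite big_mkord.
  by apply: eq_bigr => j _; rewrite big_bool expr2.
have so : sorted geq column_lengths.
  rewrite /column_lengths; apply: (homo_sorted (e := leq)); last exact: iota_sorted.
  move=> a b ab /=; apply: sub_count => c /=; exact: leq_ltn_trans.
have all_le : all (fun m => m <= n)%N column_lengths.
  by apply/allP => m /mapP[j _ ->]; exact: leq_trans (cl_le j) szn.
rewrite gauss_column_seq // size_map size_iota.
have nthE j : (j < n)%N -> nth 0%N column_lengths j = cl j.
  by move=> jn; rewrite (nth_map 0%N) ?size_iota // nth_iota.
have countE i j : (j < n)%N -> count (fun m => (i < m)%N) (drop j.+1 column_lengths) = (nth 0 lam i - j - 1)%N.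
  move=> jn; rewrite /column_lengths -map_drop drop_iota add0n count_map.
  have -> : count (preim cl (fun m => i < m)%N) (iota j.+1 (n - j.+1)) =
     count (fun k => k < nth 0 lam i)%N (iota j.+1 (n - j.+1)).
    by apply: eq_count => k; rewrite /= conjpart_at_gt.
  have := lamn i; move: (nth 0%N lam i) => a an.
  have aux b d : count (fun k => (k < a)%N) (iota b d) = (minn a (b + d) - b)%N.
    by elim: d b => [|d IHd] b /=; [lia | rewrite IHd; case: ltnP; lia].
  rewrite aux; lia.
rewrite /hookc natr_prod.
transitivity (\prod_(i < size lam) \prod_(j < n | (j < nth 0 lam i)%N)
   ((2 * (nth 0 lam i - j - 1) + (cl j - i.+1) + 1)%N%:R : rat)).
  rewrite big_mkord.
  transitivity (\prod_(j < n) \prod_(i < size lam | (j < nth 0 lam i)%N)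
     ((2 * (nth 0 lam i - j - 1) + (cl j - i.+1) + 1)%N%:R : rat)).
    apply: eq_bigr => j _; rewrite natr_prod nthE // big_mkord.
    rewrite (big_ord_widen_cond (size lam) predT (fun i => (2 * count (fun m => i < m)%N (drop j.+1 column_lengths) + (cl j - i.+1) + 1)%N%:R : rat)) ?cl_le //=.
    by apply: eq_big => [i|i _]; [rewrite conjpart_at_gt | rewrite countE].
  by rewrite (exchange_big_dep predT).
apply: eq_bigr => i _.
rewrite (big_ord_widen_cond n predT (fun j => (2 * (nth 0 lam i - j - 1)%N%:R + (cl j - i - 1)%N%:R + 1 : rat))) ?lamn //=.
apply: eq_bigr => j _; rewrite -natrM -natrD natr1 addn1.
by rewrite -[(cl j - i - 1)%N]subnDA addn1.
Qed.

End Leading.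

(** * Lifting the functions counted by N1 *)

Lemma size_gltype (T : finType) (A B : {perm T}) : size (gltype A B) = #|gloops A B|.
Proof. by rewrite size_sort size_map cardE. Qed.

Lemma loop_common (T : finType) (A B : {perm T}) y : pp A -> pp B ->
  A y = B y -> loop A B y = [set y; A y].
Proof.
move=> ppA ppB e; apply/setP => z; rewrite in_set2; apply/idP/orP => [|[]/eqP->].
- move=> zy; apply/orP; move: z zy; apply: (loop_ind (P := fun z => (z == y) || (z == A y))).
  + by move=> z /orP[]/eqP->; rewrite ?(ppK ppA) eqxx ?orbT.
  + by move=> z /orP[]/eqP->; rewrite -?e ?eqxx ?orbT // e (ppK ppB) eqxx.
  + by rewrite eqxx.
- exact: loop_refl.
- by rewrite loopA // loop_refl.
Qed.

Section EmbeddingComplement.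
Variables (T X : finType) (A B : {perm T}) (A' B' : {perm X}) (f : {ffun T -> X}).
Hypotheses (ppA : pp A) (ppB : pp B) (ppA' : pp A') (ppB' : pp B').
Hypothesis f_emb : f \in embeddings A B A' B'.

Lemma embedding_codomA y : (A' y \in codom f) = (y \in codom f).
Proof.
case/embeddingsP: f_emb => _ fA _.
apply/codomP/codomP => -[z e]; exists (A z); last by rewrite fA e.
by rewrite fA -e (ppK ppA').
Qed.

Lemma loop_disjoint_codom y : y \notin codom f -> [disjoint loop A' B' y & codom f].
Proof.
move=> yf; apply/pred0P => z /=; apply/negP => /andP[zy /codomP[x ez]].
move: zy; rewrite loop_memC // ez (embedding_loop ppA ppB ppA' ppB') // => /imsetP[w _ e].
by move: yf; rewrite e codom_f.
Qed.

Lemma embedding_gltype_trivial : (forall y, y \notin codom f -> A' y = B' y) ->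
  perm_eq (gltype A' B') (gltype A B ++ nseq (sumn (gltype A' B') - sumn (gltype A B)) 1%N).
Proof.
move=> triv; have pe := embedding_gltype ppA ppB ppA' ppB' f_emb.
set s := [seq _ | _ <- _] in pe.
have s1 : s = nseq (size s) 1%N.
  apply/all_pred1P; apply/allP => a /mapP[C]; rewrite mem_enum in_set => /andP[hC dC] ->.
  case/gloopsP: hC dC => y ->; move/pred0P/(_ y); rewrite /= loop_refl /= => /negbT yf.
  by rewrite (loop_common ppA' ppB' (triv _ yf)) cards2 (eq_sym y) pp_neq.
have := perm_sumn pe; rewrite sumn_cat => ->.
have -> : sumn s = size s by rewrite {1}s1 sumn_nseq mul1n.
by rewrite addKn -s1.
Qed.

(** Comparison of types leaves only loops of half-length 1 outside the image; such a loop has two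
    elements, so [A'] and [B'] agree on it. *)
Lemma embedding_trivial_outside d :
  perm_eq (gltype A' B') (gltype A B ++ nseq d 1%N) ->
  forall y, y \notin codom f -> A' y = B' y.
Proof.
move=> pd y yf; have := embedding_gltype ppA ppB ppA' ppB' f_emb.
rewrite (permPl pd) perm_cat2l => pe.
have sz : (#|loop A' B' y| %/ 2)%N = 1%N.
  have : (#|loop A' B' y| %/ 2)%N \in nseq d 1%N.
    rewrite (perm_mem pe); apply/mapP; exists (loop A' B' y) => //.
    by rewrite mem_enum in_set mem_gloops loop_disjoint_codom.
  by rewrite mem_nseq => /andP[_ /eqP].
have c2 : #|loop A' B' y| = 2 by move: sz; rewrite card_loop_half // card_loop // => ->.
apply/eqP; apply: contraT => ne.
have : (#|[set y; A' y; B' y]| <= #|loop A' B' y|)%N.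
  apply: subset_leq_card; apply/subsetP => z; rewrite !in_setU !in_set1 => /orP[/orP[]|] /eqP->.
  - exact: loop_refl.
  - by rewrite loopA // loop_refl.
  - by rewrite loopB // loop_refl.
rewrite c2 -setUA cardsU1 cards2 ne in_set2.
by rewrite [y == A' y]eq_sym [y == B' y]eq_sym (negbTE (pp_neq y ppA')) (negbTE (pp_neq y ppB')).
Qed.

End EmbeddingComplement.

Section Lifts.
Variables (k : nat) (S1 S2 : {perm 'I_(2 * k)}) (lam : seq nat).
Hypotheses (ppS1 : pp S1) (ppS2 : pp S2).
Implicit Types (f : {ffun 'I_(2 * k) -> dcell (sumn lam) lam}).
Local Notation n := (sumn lam).
Local Notation T := 'I_(2 * k).
Local Notation cell := (dcell n lam).

Definition admissible (f : {ffun T -> cell}) :=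
  [forall z, [&& col (f (S1 z)) == col (f z), half (f (S1 z)) == ~~ half (f z)
    & row (f (S2 z)) == row (f z)]].
Definition lifts (f : {ffun T -> cell}) (S0 : {perm T}) :=
  [forall z, f (S0 z) == flip n lam (f z)].

Lemma admissibleP f : reflect
  [/\ forall z, col (f (S1 z)) = col (f z), forall z, half (f (S1 z)) = ~~ half (f z)
    & forall z, row (f (S2 z)) = row (f z)] (admissible f).
Proof.
apply: (iffP forallP) => [h|[h1 h2 h3] z]; last by rewrite h1 h2 h3 !eqxx.
by split=> z; case/and3P: (h z) => /eqP ? /eqP ? /eqP.
Qed.

Lemma liftsP f (S0 : {perm T}) : reflect (forall z, f (S0 z) = flip n lam (f z)) (lifts f S0).
Proof. by apply: (iffP forallP) => h z; apply/eqP; rewrite h. Qed.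

(* A two-colouring of the loops of [(S0, S1)] chooses the half of the box [f z]. *)
Lemma N1_lifts (S0 : {perm T}) : pp S0 ->
  2 ^+ nloops S0 S1 * (N1 S0 S1 S2 lam)%:R =
  #|[set f : {ffun T -> cell} | admissible f && lifts f S0]|%:R :> rat.
Proof.
move=> ppS0.
have -> : 2 ^+ nloops S0 S1 = #|two_colourings S0 S1|%:R :> rat.
  by rewrite card_two_colourings.
rewrite /N1 -natrM -cardsX; congr (_%:R).
pose pr (f : {ffun T -> cell}) : {ffun T -> bool} * {ffun T -> 'I_n * 'I_n} :=
  ([ffun z => half (f z)], [ffun z => (row (f z), col (f z))]).
have pr_inj : injective pr.
  move=> f g [/ffunP e1 /ffunP e2]; apply/ffunP => z; have := e1 z; have := e2 z.
  by rewrite !ffunE => -[r c] h; exact: cell_eq.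
rewrite -[RHS](card_imset _ pr_inj); apply: eq_card => -[h g].
rewrite in_setX !in_set; apply/andP/imsetP => [[/forallP hh /forallP hg]|[f]]; last first.
  rewrite in_set => /andP[/admissibleP[h1 h2 h3] /liftsP h0] [-> ->].
  split; apply/forallP => z; rewrite !ffunE.
    by rewrite h0 half_flip h2 !eqxx.
  rewrite h0 row_flip col_flip h1 h3 !eqxx /= !andbT.
  exact: (valP (f z)).
have hd z : in_diag lam (val (g z).1, val (g z).2) by case/andP: (hg z).
exists [ffun z => exist _ (g z, h z) (hd z) : cell]; last first.
  congr (_, _); apply/ffunP => z; rewrite !ffunE //.
  by rewrite /row /col /=; case: (g z).
have hg' z : [/\ g z = g (S0 z), (g z).2 = (g (S1 z)).2 & (g z).1 = (g (S2 z)).1].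
  by case/andP: (hg z) => _ /and3P[/eqP ? /eqP ? /eqP].
rewrite in_set; apply/andP; split.
  apply/admissibleP; split=> z; rewrite !ffunE /col /half /row /=.
  - by case: (hg' z).
  - by case/andP: (hh z) => _ /eqP.
  - by case: (hg' z).
apply/liftsP => z; apply: cell_eq; rewrite ?row_flip ?col_flip ?half_flip !ffunE /row /col /half /=.
- by case: (hg' z) => <-.
- by case: (hg' z) => <-.
- by case/andP: (hh z) => /eqP.
Qed.

Definition lift_sign (S0 : {perm T}) : rat := (-1) ^+ (k - nloops S0 S1).

(** Conjugation by the transposition of two points with the same image keeps [S0] a lift and
    reverses its sign; the colouring needed for this is the half of [f z]. *)
Lemma lift_sum_noninjective f : admissible f -> ~~ injectiveb f ->
  \sum_(S0 : {perm T} | pp S0 && lifts f S0) lift_sign S0 = 0.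
Proof.
move=> /admissibleP[h1 h2 h3] /injectivePn[x [y nxy e]].
apply: rat_opp_eq0.
rewrite [LHS](reindex_inj (can_inj (@conj_tpermK _ x y))) /= -[RHS]sumrN.
have ft z : f (tperm x y z) = f z by case: tpermP => // ->.
have imp (S0 : {perm T}) : pp S0 && lifts f S0 -> pp (S0 ^ tperm x y) && lifts f (S0 ^ tperm x y).
  case/andP=> ppS0 /liftsP h; apply/andP; split; first exact: conj_pp.
  apply/liftsP => z; rewrite -{1}[z](tpermK x y) conj_tpermE ft h.
  by rewrite ft.
apply: eq_big => [S0|S0 hS0].
  by apply/idP/idP => [/imp|/imp //]; rewrite conj_tpermK.
have {hS0} : pp S0 && lifts f S0 by have := imp _ hS0; rewrite conj_tpermK.
case/andP=> ppS0 /liftsP h0.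
rewrite /lift_sign /nloops.
have E (S : {perm T}) : loops S S1 = gloops S1 S by rewrite (gloopsC S1).
rewrite !E.
apply: (loop_sign_flip (half := fun z => half (f z)) ppS1 ppS0 _ h2 _ nxy).
- by rewrite card_ord.
- by move=> z; rewrite h0 half_flip.
- by rewrite e.
Qed.

Lemma N1_sum :
  \sum_(S0 : {perm T} | is_pp S0) lift_sign S0 * 2 ^+ nloops S0 S1 * (N1 S0 S1 S2 lam)%:R =
  \sum_(f : {ffun T -> cell} | injectiveb f && admissible f)
    \sum_(S0 : {perm T} | pp S0 && lifts f S0) lift_sign S0.
Proof.
transitivity (\sum_(S0 : {perm T} | pp S0) \sum_(f : {ffun T -> cell} | admissible f && lifts f S0) lift_sign S0).
  apply: eq_bigr => S0 ppS0; rewrite -mulrA N1_lifts // -sum1_card natr_sum mulr_sumr.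
  by apply: eq_big => [f|f _]; rewrite ?in_set ?mulr1.
rewrite (exchange_big_dep admissible) /=; last by move=> S0 f _ /andP[].
rewrite (bigID (fun f : {ffun T -> cell} => injectiveb f)) /= [X in _ + X]big1 ?addr0; last first.
  move=> f /andP[af nf]; rewrite -[RHS](lift_sum_noninjective af nf).
  by apply: eq_bigl => S0; rewrite af.
apply: eq_big => [f|f /andP[af _]]; first by rewrite andbC.
by apply: eq_bigl => S0; rewrite af.
Qed.

End Lifts.

(** * Extending a pair-partition along an injective lift *)

Section Extension.
Variables (T : finType) (n : nat) (lam : seq nat).
Local Notation cell := (dcell n lam).
Local Notation flip := (flip n lam).
Variable f : {ffun T -> cell}.
Hypothesis f_inj : injective f.
Variable S0 : {perm T}.
Hypothesis f_lift : forall z, f (S0 z) = flip (f z).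

Lemma lift_codom y : (flip y \in codom f) = (y \in codom f).
Proof.
apply/codomP/codomP => -[z e]; exists (S0 z); rewrite f_lift -e //.
by rewrite (ppK (pp_flip n lam)).
Qed.

Definition extend_fun (S : {perm T}) (y : cell) : cell :=
  if [pick z | f z == y] is Some z then f (S z) else flip y.

Lemma extend_fun_in S z : extend_fun S (f z) = f (S z).
Proof.
rewrite /extend_fun; case: pickP => [w /eqP/f_inj -> //|/(_ z)]; by rewrite eqxx.
Qed.

Lemma extend_fun_out S y : y \notin codom f -> extend_fun S y = flip y.
Proof.
by rewrite /extend_fun; case: pickP => // w /eqP <-; rewrite codom_f.
Qed.

Lemma extend_fun_inj S : injective (extend_fun S).
Proof.
move=> x y; case: (boolP (x \in codom f)) => [/codomP[z ->]|hx];
  case: (boolP (y \in codom f)) => [/codomP[w ->]|hy].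
- by rewrite !extend_fun_in => /f_inj/perm_inj ->.
- rewrite extend_fun_in extend_fun_out // => e.
  by move: hy; rewrite -lift_codom -e codom_f.
- rewrite extend_fun_in extend_fun_out // => e.
  by move: hx; rewrite -lift_codom e codom_f.
- by rewrite !extend_fun_out // => /perm_inj.
Qed.

Definition extend S : {perm cell} := perm (@extend_fun_inj S).

Lemma extend_in S z : extend S (f z) = f (S z).
Proof. by rewrite permE extend_fun_in. Qed.

Lemma extend_out S y : y \notin codom f -> extend S y = flip y.
Proof. by move=> h; rewrite permE extend_fun_out. Qed.

Lemma pp_extend S : pp S -> pp (extend S).
Proof.
move=> ppS; apply/forallP => y; case: (boolP (y \in codom f)) => [/codomP[z ->]|hy].
  by rewrite !extend_in (ppK ppS) eqxx /= (inj_eq f_inj) pp_neq.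
have hy' : flip y \notin codom f by rewrite lift_codom.
by rewrite !extend_out // (ppK (pp_flip n lam)) eqxx (pp_neq _ (pp_flip n lam)).
Qed.

End Extension.

Section LiftSum.
Variables (k : nat) (S1 S2 : {perm 'I_(2 * k)}) (lam : seq nat).
Hypotheses (ppS1 : pp S1) (ppS2 : pp S2) (lam_part : is_part lam).
Local Notation n := (sumn lam).
Local Notation T := 'I_(2 * k).
Local Notation cell := (dcell n lam).
Let rho := gltype S1 S2 ++ nseq (n - k) 1%N.

Lemma sumn_gltype_ord (A B : {perm T}) : pp A -> pp B -> sumn (gltype A B) = k.
Proof.
by move=> a b; apply/eqP; rewrite -(eqn_pmul2l (isT : (0 < 2)%N)) sumn_gltype // card_ord.
Qed.

Lemma sumn_gltype_cell (A B : {perm cell}) : pp A -> pp B -> sumn (gltype A B) = n.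
Proof.
move=> a b; apply/eqP; rewrite -(eqn_pmul2l (isT : (0 < 2)%N)) (sumn_gltype a b).
by rewrite (card_cell lam_part erefl) eqxx.
Qed.

Lemma is_part_cat_ones (s : seq nat) d : is_part s -> is_part (s ++ nseq d 1%N).
Proof.
case/andP => so s0; rewrite /is_part all_cat s0 /=; apply/andP; split; last by elim: d.
case: s so s0 => [|a s] /= so s0; first by elim: d => //= -[|d].
rewrite cat_path so /=; have : (0 < last a s)%N.
  by case/andP: s0 => a0 /allP h; case: (s) h => //= b l h; apply: h; exact: mem_last.
case: d => //= d -> /=; by elim: d.
Qed.

Lemma sum_eq1 (I : finType) (P : pred I) (F : I -> rat) i0 :
  P i0 -> (forall i, P i -> i = i0) -> \sum_(i | P i) F i = F i0.
Proof.
move=> p0 u; rewrite (bigD1 i0) //= big1 ?addr0 // => i /andP[/u -> ].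
by rewrite eqxx.
Qed.

(** Both sides have at most one nonzero term: injectivity of [f] makes [S0] unique, and [(S1', S2')]
    has to be the extension of [(S1, S2)] by [flip]. It remains to compare two signs. *)
Lemma adm_pair_sum (f : {ffun T -> cell}) :
  \sum_(S1' | col_adm S1') \sum_(S2' | row_adm S2')
    sg S1' * ((gltype S1' S2' == rho) && (f \in embeddings S1 S2 S1' S2'))%:R =
  if injectiveb f && admissible S1 S2 f then
    \sum_(S0 : {perm T} | pp S0 && lifts f S0) lift_sign S1 S0 else 0.
Proof.
have props S1' S2' : col_adm S1' -> row_adm S2' ->
    (gltype S1' S2' == rho) && (f \in embeddings S1 S2 S1' S2') ->
    [/\ injective f, admissible S1 S2 f & exists2 S0 : {perm T}, pp S0 && lifts f S0 &
      (forall y, y \notin codom f -> S1' y = flip n lam y /\ S2' y = flip n lam y)].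
  move=> /col_admP[pp1 c1 h1] /row_admP[pp2 r2] /andP[/eqP gl femb].
  case/embeddingsP: (femb) => fi f1 f2.
  have out y : y \notin codom f -> S1' y = flip n lam y /\ S2' y = flip n lam y.
    move=> hy; have e := embedding_trivial_outside ppS1 ppS2 pp1 pp2 femb (d := n - k) _ hy.
    have {}e : S1' y = S2' y by apply: e; rewrite gl perm_refl.
    (* The common partner of [y] is in the same row because of [S2'], and in the same column but the
       other half because of [S1']: it is the other half of the same box. *)
    suff e1 : S1' y = flip n lam y by rewrite -e.
    apply: cell_eq; rewrite ?row_flip ?col_flip ?half_flip //.
    by rewrite e.
  split=> //.
    by apply/admissibleP; split=> z; rewrite ?f1 ?f2.
  have flip_in z : flip n lam (f z) \in codom f.
    apply: contraT => h; case: (out _ h); rewrite (ppK (pp_flip n lam)) => e _.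
    have : S1' (flip n lam (f z)) \in codom f by rewrite e codom_f.
    by rewrite (embedding_codomA pp1 femb) (negbTE h).
  pose s z := iinv (flip_in z).
  have fs z : f (s z) = flip n lam (f z) by exact: f_iinv.
  have sK : involutive s by move=> z; apply: fi; rewrite !fs (ppK (pp_flip n lam)).
  exists (perm (inv_inj sK)) => //; apply/andP; split.
    apply/forallP => z; rewrite !permE sK eqxx /=; apply/eqP => e.
    by have := pp_neq (f z) (pp_flip n lam); rewrite -fs e eqxx.
  by apply/liftsP => z; rewrite permE fs.
have zero : (~~ (injectiveb f && admissible S1 S2 f)) ||
    [forall S0 : {perm T}, ~~ (pp S0 && lifts f S0)] ->
  \sum_(S1' | col_adm S1') \sum_(S2' | row_adm S2')
    sg S1' * ((gltype S1' S2' == rho) && (f \in embeddings S1 S2 S1' S2'))%:R = 0.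
  move=> nope; apply: big1 => S1' a1; apply: big1 => S2' a2.
  case b: (_ && _); last by rewrite mulr0.
  have [fi fa [S0 hS0 _]] := props _ _ a1 a2 b; move: nope.
  rewrite fa andbT; have -> : injectiveb f by exact/injectiveP.
  by move=> /= /forallP/(_ S0); rewrite hS0.
case: ifP => [/andP[/injectiveP fi fa]|/negbT nadm]; last by apply: zero; rewrite nadm.
case: (pickP (fun S0 : {perm T} => pp S0 && lifts f S0)) => [S0 /andP[ppS0 /liftsP fl]|none]; last first.
  rewrite [RHS]big_pred0 //; apply: zero; apply/orP; right.
  by apply/forallP => S0; rewrite none.
have uS0 S : pp S && lifts f S -> S = S0.
  by case/andP => _ /liftsP h; apply/permP => z; apply: fi; rewrite h fl.
have hS0 : pp S0 && lifts f S0 by rewrite ppS0; apply/liftsP.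
rewrite (sum_eq1 (P := fun S : {perm T} => pp S && lifts f S) _ hS0 uS0).
pose E1 := extend fi fl S1; pose E2 := extend fi fl S2.
have ppE1 : pp E1 := pp_extend fi fl ppS1.
have ppE2 : pp E2 := pp_extend fi fl ppS2.
have in1 z : E1 (f z) = f (S1 z) := extend_in fi fl S1 z.
have in2 z : E2 (f z) = f (S2 z) := extend_in fi fl S2 z.
have out1 y : y \notin codom f -> E1 y = flip n lam y := @extend_out _ _ _ _ fi _ fl S1 y.
have out2 y : y \notin codom f -> E2 y = flip n lam y := @extend_out _ _ _ _ fi _ fl S2 y.
clearbody E1 E2.
case/admissibleP: (fa) => a1 a2 a3.
have colE1 : col_adm E1.
  apply/col_admP; split; first exact: ppE1.
    move=> y; case: (boolP (y \in codom f)) => [/codomP[z ->]|hy]; first by rewrite in1 a1.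
    by rewrite (out1 _ hy) col_flip.
  move=> y; case: (boolP (y \in codom f)) => [/codomP[z ->]|hy]; first by rewrite in1 a2.
  by rewrite (out1 _ hy) half_flip.
have rowE2 : row_adm E2.
  apply/row_admP; split; first exact: ppE2.
  move=> y; case: (boolP (y \in codom f)) => [/codomP[z ->]|hy]; first by rewrite in2 a3.
  by rewrite (out2 _ hy) row_flip.
have embE : f \in embeddings S1 S2 E1 E2.
  by apply/embeddingsP; split=> // z; rewrite ?in1 ?in2.
have trivE y : y \notin codom f -> E1 y = E2 y by move=> hy; rewrite (out1 _ hy) (out2 _ hy).
have glE : gltype E1 E2 = rho.
  have pe := embedding_gltype_trivial ppS1 ppS2 ppE1 ppE2 embE trivE.
  move: pe; rewrite (sumn_gltype_cell ppE1 ppE2) (sumn_gltype_ord ppS1 ppS2) -/rho => pe.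
  have /andP[so _] : is_part rho by apply: is_part_cat_ones; exact: is_part_gltype.
  have /andP[so' _] := is_part_gltype ppE1 ppE2.
  by apply: (sorted_eq geq_trans _ so' so pe) => a b /anti_leq ->.
have uniqE S1' S2' : col_adm S1' -> row_adm S2' ->
    (gltype S1' S2' == rho) && (f \in embeddings S1 S2 S1' S2') -> S1' = E1 /\ S2' = E2.
  move=> c1 r2 b; have [_ _ [_ _ out]] := props _ _ c1 r2 b.
  case/andP: b => _ /embeddingsP[_ f1 f2].
  split; apply/permP => y; case: (boolP (y \in codom f)) => [/codomP[z ->]|hy].
  - by rewrite -f1 in1.
  - by rewrite (out1 _ hy); case: (out _ hy).
  - by rewrite -f2 in2.
  - by rewrite (out2 _ hy); case: (out _ hy).
transitivity (sg E1).
  pose G S1' S2' : rat :=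
    sg S1' * ((gltype S1' S2' == rho) && (f \in embeddings S1 S2 S1' S2'))%:R.
  have G1 : G E1 E2 = sg E1.
    rewrite /G; set b := (_ && _); have -> : b = true; last by rewrite mulr1.
    by apply/andP; split; [apply/eqP; exact: glE | exact: embE].
  have G0 S1' S2' : col_adm S1' -> row_adm S2' -> (S1' != E1) || (S2' != E2) -> G S1' S2' = 0.
    move=> c1 r2 ne; rewrite /G; case b: (_ && _); last by rewrite mulr0.
    by case: (uniqE _ _ c1 r2 b) => e1 e2; rewrite e1 e2 !eqxx in ne.
  change (\sum_(S1' | col_adm S1') \sum_(S2' | row_adm S2') G S1' S2' = sg E1).
  clearbody G; rewrite (bigD1 E1 colE1) /= (bigD1 E2 rowE2) /= G1.
  rewrite [X in _ + X + _]big1 ?addr0; last first.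
    by move=> S2' /andP[r2 ne]; rewrite G0 ?ne ?orbT.
  rewrite big1 ?addr0 // => S1' /andP[c1 ne]; apply: big1 => S2' r2.
  by rewrite G0 ?ne.
have embS0 : f \in embeddings S0 S1 (flip n lam) E1.
  by apply/embeddingsP; split=> // z; rewrite in1.
have ppF := pp_flip n lam.
have trivF y : y \notin codom f -> flip n lam y = E1 y by move=> hy; rewrite (out1 _ hy).
(* The loops of [(flip, E1)] are the images of those of [(S0, S1)] and one for each of the [n - k]
   remaining boxes, so the two exponents are equal. *)
have := perm_size (embedding_gltype_trivial ppS0 ppS1 ppF ppE1 embS0 trivF).
rewrite size_cat size_nseq !size_gltype (sumn_gltype_cell ppF ppE1) (sumn_gltype_ord ppS0 ppS1).
have kn : (k <= n)%N.
  have := leq_card f fi; rewrite card_ord (card_cell lam_part erefl).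
  by rewrite leq_pmul2l.
rewrite /sg /lift_sign => ->; congr (_ ^+ _).
rewrite -[nloops S0 S1]/#|gloops S0 S1|.
by rewrite addnC subnDA (subKn kn).
Qed.

End LiftSum.

(** * Conclusion *)

Lemma sum_embeddings (k : nat) (S1 S2 : {perm 'I_(2 * k)}) (lam : seq nat) :
  pp S1 -> pp S2 -> is_part lam -> (k <= sumn lam)%N ->
  let mu := gltype S1 S2 in
  let rho := mu ++ nseq (sumn lam - k) 1%N in
  \sum_(f : {ffun 'I_(2 * k) -> dcell (sumn lam) lam})
    \sum_(A | col_adm A) \sum_(B | row_adm B)
      sg A * ((gltype A B == rho) && (f \in embeddings S1 S2 A B))%:R =
  (2 ^ size mu * zee mu * 'C(sumn lam - k + mult 1 mu, mult 1 mu))%:R * ycoef (sumn lam) lam rho.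
Proof.
move=> ppS1 ppS2 lp kn mu rho.
rewrite exchange_big /ycoef mulr_sumr; apply: eq_bigr => A /col_admP[ppA _ _].
rewrite exchange_big mulr_sumr; apply: eq_bigr => B /row_admP[ppB _].
transitivity (sg A * (gltype A B == rho)%:R * #|embeddings S1 S2 A B|%:R).
  rewrite -sum1_card natr_sum mulr_sumr [RHS]big_mkcond /=; apply: eq_bigr => f _.
  by rewrite -mulnb natrM mulrA; case: (f \in _); rewrite ?mulr1 ?mulr0.
rewrite mulrC; case: eqP => [e|_]; last by rewrite !mulr0.
congr (_%:R * _); rewrite (card_embeddings ppS1 ppS2 ppA ppB) e.
exact: emb_count_zee (gltype_gt0 ppS1 ppS2).
Qed.

Theorem theorem1p6 (k : nat) (mu : seq nat) (S1 S2 : {perm 'I_(2 * k)})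
  (J : seq nat -> seq nat -> rat) :
  is_part mu -> sumn mu = k ->
  is_pp S1 -> is_pp S2 -> ltype S1 S2 = mu ->
  jack_J_family 2 J ->
  forall lam : seq nat, is_part lam ->
    Sigma J mu lam =
    (2 ^+ size mu)^-1 *
    \sum_(S0 : {perm 'I_(2 * k)} | is_pp S0)
       (-1) ^+ (k - nloops S0 S1) * 2 ^+ nloops S0 S1 *
       (N1 S0 S1 S2 lam)%:R.
Proof.
move=> mu_part mu_sum ppS1 ppS2 mu_type jack lam lam_part.
have {mu_type} emu : gltype S1 S2 = mu := mu_type.
transitivity ((2 ^+ size mu)^-1 * \sum_(f : {ffun 'I_(2 * k) -> dcell (sumn lam) lam})
    \sum_(A | col_adm A) \sum_(B | row_adm B)
      sg A * ((gltype A B == gltype S1 S2 ++ nseq (sumn lam - k) 1%N) &&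
        (f \in embeddings S1 S2 A B))%:R); last first.
  congr (_ * _); apply/esym; apply: (etrans (@N1_sum k S1 S2 lam ppS1)).
  by rewrite big_mkcond; apply: eq_bigr => f _; rewrite (adm_pair_sum ppS1 ppS2 lam_part).
(* When [lam] has fewer than [k] boxes, no map from [2 * k] points to its cells is injective, in
   accordance with the zero clause of [Sigma]. *)
rewrite /Sigma mu_sum; case: leqP => kn; last first.
  rewrite big1 ?mulr0 // => f _; rewrite (adm_pair_sum ppS1 ppS2 lam_part).
  case: injectiveP => //= fi; have := leq_card f fi.
  by rewrite card_ord (card_cell lam_part erefl) leq_pmul2l // leqNgt kn.
rewrite (sum_embeddings ppS1 ppS2 lam_part kn) emu.
have -> : J lam (mu ++ nseq (sumn lam - k) 1%N) =
    ycoef (sumn lam) lam (mu ++ nseq (sumn lam - k) 1%N).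
  apply: (jack_zonal _ jack).
  - by move=> nu; rewrite mem_parts_of => /andP[np /eqP ns]; exact: ypoly_leading.
  - by rewrite mem_parts_of lam_part eqxx.
  - rewrite mem_parts_of is_part_cat_ones //=.
    by rewrite sumn_cat sumn_nseq mul1n mu_sum subnKC.
rewrite mulrA; congr (_ * _); rewrite !natrM natrX -!mulrA mulKf; last first.
  by rewrite expf_neq0.
by rewrite mulrC.
Qed.
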